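(* Let $(W_t,V_t,J_t)_{t\in\mathbb{N}_0}$ be a stationary Markov chain satisfying the standing conditions (i)–(v) of the discrete-time model with reset described in the context, with associated objects $\Omega$ and $A:\Omega\to\mathbb{C}^{N\times N}$. Let $\Omega^\circ$ denote the interior of $\Omega$. If there exists a positive real number $\alpha$ in $\Omega^\circ$ such that $\zeta(A(\alpha))=0$, then $$0<\liminf_{w\to\infty}w^{-d_\alpha+1}e^{\alpha w}\,\mathrm{P}(W_0>w)\leq\limsup_{w\to\infty}w^{-d_\alpha+1}e^{\alpha w}\,\mathrm{P}(W_0>w)<\infty,$$ where $d_\alpha$ is the length of the longest chain of classes of $A(\alpha)$. If there exists a negative real number $-\beta$ in $\Omega^\circ$ such that $\zeta(A(-\beta))=0$, then $$0<\liminf_{w\to\infty}w^{-d_{-\beta}+1}e^{\beta w}\,\mathrm{P}(W_0<-w)\leq\limsup_{w\to\infty}w^{-d_{-\beta}+1}e^{\beta w}\,\mathrm{P}(W_0<-w)<\infty,$$ where $d_{-\beta}$ is the length of the longest chain of classes of $A(-\beta)$.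
   Context: Matrix notions. The spectral abscissa $\zeta(B)$ of a complex square matrix $B$ is the maximum of the real parts of its eigenvalues. A square matrix is Metzler if it is real with nonnegative off-diagonal entries. An $N\times N$ matrix $B$ generates a directed graph with vertex set $\{1,\dots,N\}$ and an edge from $m$ to $n$ for each pair $m\neq n$ such that the $(m,n)$-entry of $B$ is nonzero. Vertex $m$ has access to $n$ if $m=n$ or there is a path of directed edges from $m$ to $n$. The classes of $B$ are the equivalence classes of vertices under mutual access. For classes $\gamma,\delta$, write $\gamma\prec\delta$ if $\gamma\neq\delta$ and some vertex in $\gamma$ has access to some vertex in $\delta$. A class $\gamma$ is initial if there is no class $\delta$ with $\delta\prec\gamma$, and final if there is no class $\delta$ with $\gamma\prec\delta$. A class $\gamma$ of a Metzler matrix $B$ is basic if $\zeta(B_{\gamma,\gamma})=\zeta(B)$, where $B_{\gamma,\gamma}$ is the submatrix with rows and columns indexed by $\gamma$. A tuple of classes $(\gamma_1,\dots,\gamma_\ell)$ is a chain if $\ell=1$ or $\gamma_k\prec\gamma_{k+1}$ for each $k<\ell$; its length is the number of basic classes it contains. The length of the longest chain is the maximum length over all chains. The symbol $\odot$ denotes the entry-wise product of matrices. $\mathbb{N}_0=\{0\}\cup\mathbb{N}$. Standing conditions on the stationary Markov chain $(W,V,J)=(W_t,V_t,J_t)_{t\in\mathbb{N}_0}$: (i) The state space for $(W,V,J)$ is $\mathbb{R}\times\{0,1\}\times\{1,\dots,N\}$ for some $N\in\mathbb{N}$. (ii) $(V,J)$ is a Markov chain such that for each $t\in\mathbb{N}$,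 each $u,v\in\{0,1\}$ and each $m,n\in\{1,\dots,N\}$, $$\mathrm{P}(V_{t+1}=0\mid V_t=u,J_t=m)=\sum_{n=1}^N\pi_{m,n}\upsilon_{m,n}\quad\text{and}$$ $$\mathrm{P}(J_{t+1}=n\mid V_{t+1}=v,V_t=u,J_t=m)=\mathbf{1}(v=0)\pi_{m,n}+\mathbf{1}(v=1)\varpi_n,$$ where $\Pi=(\pi_{m,n})$ is a nonnegative $N\times N$ matrix with rows summing to one, $\Upsilon=(\upsilon_{m,n})$ is an $N\times N$ matrix with entries in $[0,1]$, and $\varpi=(\varpi_n)$ is a nonnegative $N\times1$ vector with entries summing to one. (iii) There exists an iid sequence of real $N\times N$ random matrices $(\varepsilon_t)_{t\in\mathbb{N}}$, independent of $(V,J)$, such that for each $t\in\mathbb{N}$, $W_{t+1}=\mathbf{1}(V_{t+1}=0)[W_t+\varepsilon_{t+1}(J_t,J_{t+1})]$, where $\varepsilon_t(m,n)$ is the $(m,n)$-entry of $\varepsilon_t$. (iv) Each initial class of $\Pi\odot\Upsilon$ contains a state $n$ such that $\varpi_n>0$. (v) Each final class of $\Pi$ contains states $m$ and $n$ (possibly with $m=n$) such that $\pi_{m,n}>0$ and $\upsilon_{m,n}<1$. Associated objects: $\varphi_{m,n}(z)=\mathrm{E}(e^{z\varepsilon_1(m,n)})$ is the Laplace transform for $\varepsilon_1(m,n)$, with domain $\{z\in\mathbb{C}:\mathrm{E}(e^{\mathrm{Re}(z)\varepsilon_1(m,n)})<\infty\}$. (If $\mathrm{P}(J_0=m,J_1=n)=0$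 then it is assumed, without loss of generality, that $\varepsilon_1(m,n)=0$, so that $\varphi_{m,n}(z)=1$ for all $z\in\mathbb{C}$.) $\Omega$ is the intersection of the domains of all $\varphi_{m,n}$. $\Phi:\Omega\to\mathbb{C}^{N\times N}$ is the matrix-valued function whose $(m,n)$-entry is the restriction of $\varphi_{m,n}$ to $\Omega$. $A:\Omega\to\mathbb{C}^{N\times N}$ is defined by $A(z)=\Pi\odot\Upsilon\odot\Phi(z)-I$, where $I$ is the $N\times N$ identity matrix.
   Formalization: In condition (ii), the probability of J_{t+1}=n given V_{t+1}=0, V_t=u, J_t=m is taken to be π_{m,n}υ_{m,n}/Σ_k π_{m,k}υ_{m,k} instead of the printed π_{m,n}, under which the claim fails (e.g. N=2, all π_{m,n}=1/2, Υ=I, ε(1,1)=1, other entries of ε equal to −1). *)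

(* Defs.v *)
From HB Require Import structures.
From mathcomp Require Import all_boot all_order all_algebra.
From mathcomp Require Import all_classical all_reals all_analysis.
From mathcomp.real_closed Require Export complex.

Set Implicit Arguments.
Unset Strict Implicit.
Unset Printing Implicit Defensive.

Import Order.TTheory GRing.Theory Num.Theory numFieldNormedType.Exports.

Local Open Scope classical_set_scope.
Local Open Scope ring_scope.

Section MatrixClasses.
Variables (K : nmodType) (N : nat).
Implicit Types (B : 'M[K]_N) (g h : {set 'I_N}) (s : seq {set 'I_N}).

Definition mx_edge B : rel 'I_N := fun i j => (i != j) && (B i j != 0).

Definition access B : rel 'I_N := connect (mx_edge B).

Definition mutual_access B : rel 'I_N :=
  fun i j => access B i j && access B j i.

Definition mx_classes B : {set {set 'I_N}} :=
  equivalence_partition (mutual_access B) [set: 'I_N].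

Definition class_prec B : rel {set 'I_N} := fun g h =>
  (g != h) && [exists i in g, exists j in h, access B i j].

Definition initial_class B g : bool :=
  (g \in mx_classes B) && [forall h in mx_classes B, ~~ class_prec B h g].

Definition final_class B g : bool :=
  (g \in mx_classes B) && [forall h in mx_classes B, ~~ class_prec B g h].

Definition class_submx B g : 'M[K]_#|g| :=
  mxsub (@enum_val _ (mem g)) (@enum_val _ (mem g)) B.

Definition is_chain B s : bool :=
  [&& s != [::], all (fun g => g \in mx_classes B) s & sorted (class_prec B) s].

End MatrixClasses.

Section Spectral.
Variables (R : realType).

(* The set of eigenvalues of a complex matrix of size at least 1 is finite and
   nonempty, so the supremum is a maximum. *)
Definition spectral_abscissa (N : nat) (B : 'M[R[i]]_N) : R :=
  sup [set complex.Re z | z in [set z : R[i] | eigenvalue B z]].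

Definition basic_class (N : nat) (B : 'M[R[i]]_N) (g : {set 'I_N}) : bool :=
  spectral_abscissa (class_submx B g) == spectral_abscissa B.

Definition chain_length (N : nat) (B : 'M[R[i]]_N) (s : seq {set 'I_N}) : nat :=
  count (basic_class B) s.

Definition longest_chain_length (N : nat) (B : 'M[R[i]]_N) (l : nat) : Prop :=
  (exists2 s, is_chain B s & chain_length B s = l) /\
  (forall s, is_chain B s -> (chain_length B s <= l)%N).

End Spectral.

(* Measurable spaces are pointed, hence the nonempty ordinals. *)
HB.instance Definition _ (n : nat) := isPointed.Build 'I_n.+1 ord0.
HB.instance Definition _ (n : nat) :=
  @isMeasurable.Build default_measure_display 'I_n.+1 discrete_measurable
    discrete_measurable0 discrete_measurableC discrete_measurableU.

(* The sigma-algebra on U generated by the maps f i. *)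
Definition sigma_of {I U : Type} {d} {S : measurableType d} (f : I -> U -> S) :
    set (set U) :=
  <<s \bigcup_i preimage_set_system [set: U] (f i) measurable >>.

Section Probability.
Local Open Scope ereal_scope.
Context {d : measure_display} {T : measurableType d} {R : realType}.
Variable P : probability T R.

Definition cond_prob (A B : set T) : R :=
  (fine (P (A `&` B)) / fine (P B))%R.

Definition independent2 (F G : set (set T)) : Prop :=
  forall A B, F A -> G B -> P (A `&` B) = P A * P B.

Definition mutually_independent (F : nat -> set (set T)) : Prop :=
  forall (s : seq nat) (A : nat -> set T), uniq s ->
    (forall t, t \in s -> F t (A t)) ->
    P (\bigcap_(t in [set` s]) A t) = \prod_(t <- s) P (A t).

(* Here k (X t x) B is a regular version of the conditional probability of
   X t.+1 in B given X t. *)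
Definition markov_chain {d'} {S : measurableType d'} (X : nat -> T -> S) : Prop :=
  (forall t, measurable_fun [set: T] (X t)) /\
  forall t, exists k : R.-pker S ~> S, forall A B,
    sigma_of (fun s : 'I_t.+1 => X s) A -> measurable B ->
    P (A `&` X t.+1 @^-1` B) = \int[P]_(x in A) k (X t x) B.

(* The law of the path (X t)_t on the product sigma-algebra is invariant under
   the shift. *)
Definition stationary {d'} {S : measurableType d'} (X : nat -> T -> S) : Prop :=
  forall C : set (nat -> S), sigma_of (fun t (p : nat -> S) => p t) C ->
    P [set x | C (fun t => X t.+1 x)] = P [set x | C (fun t => X t x)].

Definition random_matrix (N : nat) (M : T -> 'M[R]_N) : Prop :=
  forall i j, measurable_fun [set: T] (fun x => M x i j).

Definition iid_matrices (N : nat) (M : nat -> T -> 'M[R]_N) : Prop :=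
  [/\ forall t, random_matrix (M t),
      mutually_independent
        (fun t => sigma_of (fun (ij : 'I_N * 'I_N) x => M t x ij.1 ij.2)) &
      forall t (C : set 'M[R]_N),
        sigma_of (fun (ij : 'I_N * 'I_N) (B : 'M[R]_N) => B ij.1 ij.2) C ->
        P (M t @^-1` C) = P (M 0%N @^-1` C)].

Definition laplace_domain (X : T -> R) : set R[i] :=
  [set z | 'E_P[fun x => (expR (complex.Re z * X x))%R] < +oo].

(* E[exp (z X)], split into real and imaginary parts; meaningful for z in
   laplace_domain X. *)
Definition laplace (X : T -> R) (z : R[i]) : R[i] :=
  Complex
    (fine 'E_P[fun x => (expR (complex.Re z * X x) * cos (complex.Im z * X x))%R])
    (fine 'E_P[fun x => (expR (complex.Re z * X x) * sin (complex.Im z * X x))%R]).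

End Probability.

Definition hadamard (K : pzSemiRingType) (N : nat) (B C : 'M[K]_N) : 'M[K]_N :=
  map2_mx *%R B C.

Section Reset.
Context {d : measure_display} {T : measurableType d} {R : realType}.
Variables (P : probability T R) (n : nat).
Local Notation N := n.+1.
Variables (Pi Ups : 'M[R]_N) (varpi : 'cV[R]_N) (eps : nat -> T -> 'M[R]_N).

(* P(V_{t+1} = 0, J_{t+1} = j | V_t = u, J_t = i) is Pi i j * Ups i j: the new
   state j is drawn from row i of Pi, and the transition then survives, without
   reset, with probability Ups i j. Hence J_{t+1} given V_{t+1} = 0 has the
   normalized weights of rc_J, not the weights Pi i j, which would contradict
   the role of hadamard Pi Ups as the matrix of transitions without reset in Amx.
   V t x = true encodes V_t = 1 (reset); eps 0 is not used. *)
Record reset_chain (W : nat -> T -> R) (V : nat -> T -> bool)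
    (J : nat -> T -> 'I_N) : Prop := ResetChain {
  rc_Pi_ge0 : forall i j, 0 <= Pi i j;
  rc_Pi_sum : forall i, \sum_j Pi i j = 1;
  rc_Ups01 : forall i j, 0 <= Ups i j <= 1;
  rc_varpi_ge0 : forall j, 0 <= varpi j 0;
  rc_varpi_sum : \sum_j varpi j 0 = 1;
  rc_markov : markov_chain P (fun t x => (W t x, V t x, J t x));
  rc_stationary : stationary P (fun t x => (W t x, V t x, J t x));
  rc_markovVJ : markov_chain P (fun t x => (V t x, J t x));
  rc_V : forall (t : nat) (u : bool) (i : 'I_N), (0 < t)%N ->
    P [set x | V t x = u /\ J t x = i] != 0%E ->
    cond_prob P [set x | V t.+1 x = false] [set x | V t x = u /\ J t x = i] =
      \sum_j Pi i j * Ups i j;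
  rc_J : forall (t : nat) (u v : bool) (i j : 'I_N), (0 < t)%N ->
    P [set x | [/\ V t.+1 x = v, V t x = u & J t x = i]] != 0%E ->
    cond_prob P [set x | J t.+1 x = j]
        [set x | [/\ V t.+1 x = v, V t x = u & J t x = i]] =
      if v then varpi j 0
      else Pi i j * Ups i j / \sum_k Pi i k * Ups i k;
  rc_eps_iid : iid_matrices P (fun t => eps t.+1);
  rc_eps_indep : independent2 P
    (sigma_of (fun (tij : nat * 'I_N * 'I_N) x =>
       eps tij.1.1.+1 x tij.1.2 tij.2))
    (sigma_of (fun t x => (V t x, J t x)));
  rc_W : forall t, (0 < t)%N -> {ae P, forall x,
    W t.+1 x =
      if V t.+1 x then 0 else W t x + eps t.+1 x (J t x) (J t.+1 x)};
  rc_initial : forall g, initial_class (hadamard Pi Ups) g ->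
    exists2 j, j \in g & 0 < varpi j 0;
  rc_final : forall g, final_class Pi g ->
    exists i j, [/\ i \in g, j \in g, 0 < Pi i j & Ups i j < 1];
  rc_eps_null : forall i j,
    P [set x | J 0%N x = i /\ J 1%N x = j] = 0%E ->
    {ae P, forall x, eps 1%N x i j = 0} }.

Definition Omega : set R[i] :=
  [set z | forall i j, laplace_domain P (fun x => eps 1%N x i j) z].

(* R[i]^o carries the topology of the modulus. *)
Definition Omega_interior : set R[i] := interior (Omega : set (R[i])^o).

Definition Phi (z : R[i]) : 'M[R[i]]_N :=
  \matrix_(i, j) laplace P (fun x => eps 1%N x i j) z.

Definition Amx (z : R[i]) : 'M[R[i]]_N :=
  hadamard (map_mx (real_complex R) (hadamard Pi Ups)) (Phi z) - 1%:M.

End Reset.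

(* Main.v *)
Require Import Defs.
From HB Require Import structures.
From mathcomp Require Import all_boot all_order all_algebra.
From mathcomp Require Import all_classical all_reals all_analysis.
From mathcomp Require Import measurable_realfun.
From mathcomp Require Import ring lra.
Import Order.TTheory GRing.Theory Num.Theory numFieldNormedType.Exports.
Local Open Scope classical_set_scope.
Local Open Scope ring_scope.

(* Write q i j = Pi i j * Ups i j, and let (op f) i y be the sum over j of
   q i j * E (f j (y + eps i j)). Decomposing with respect to the last reset and the path
   of J since then, P(W_0 > w) is the sum over i of c i * u i (- w), where
   c i = P(V_0 = 1, J_0 = i) and u, the sum of the op^k (1_{y > 0}), is the least
   nonnegative solution of 1_{y > 0} + op u <= u. The tail of W_0 is thus estimated by
   comparison arguments, without complex analysis.

   Upper bound: at z = alpha - 1/w, Perron eigenvectors of the classes are combined into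
   a vector v with (q o phi(z)) v <= v; crossing a basic class costs a factor w, so that
   v = O(w^(d-1)) on the classes with access to a basic class, and exp(z y) v
   dominates u there up to lower order terms.

   Lower bound: on a basic class, the function exp(alpha y) 1_{y <= 0} r is subharmonic
   up to a bounded defect, whence u >= c exp(alpha y) there. Along a longest chain,
   the Green matrix at alpha - b/w of the chain stopped on the last basic class gains a
   factor w for each basic class crossed before, and an exponential window transfers
   this lower bound to u. Condition (iv) makes c i positive for some i at
   the start of the chain. The left tail is obtained by changing eps into - eps. *)

(** * Perron theory of nonnegative matrices *)

(** At alpha itself no positive v satisfies M v <= v, with M = q o phi(alpha), as soon as a basic
    class has access to another class: pair with the left eigenvector of the basic class. At alpha -
    e the roots leave room: they are log-convex in z, at most 1 at alpha, and less than 1 at 0 by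
    condition (v), so that every basic class gains a margin of order e. For e = 1/w the change of
    exponent costs the constant factor exp 1 only, and the power of w comes from v alone. M v <= v
    still leaves no room for the source 1_{y > 0}. It is paid by [kap], a bound on the mean time to
    a reset: the supersolution is the minimum of exp(z y) v and [kap]. States without access to a
    basic class are split off first. They act on the others as a source decaying at a rate a >
    alpha, which exists because alpha is interior, and this tapered source is resolved into
    translated unit steps. In the lower bound e = b0 / w with b0 a large constant, so that the error
    exp(- b0 / 2) made by the window is smaller than the main term. *)

Section Perron.
Variable R : realType.

Definition strict_super (I : finType) (B : I -> I -> R) (lam : R) :=
  exists x : I -> R, (forall i, 0 < x i) /\
    forall i, \sum_j B i j * x j < lam * x i.

(** Pairing [u] with the defect lam x - B x gives a sum that is at most 0 by the hypothesis on [u],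
    while all its terms are nonnegative. The defect is positive everywhere, so [u] vanishes. *)
Lemma strict_super_pairing (I : finType) (B : I -> I -> R) lam (u : I -> R) :
  strict_super I B lam -> (forall i, 0 <= u i) ->
  (forall j, lam * u j <= \sum_i u i * B i j) -> forall i, u i = 0.
Proof.
move=> [x [x0 Bx]] u0 uB i.
have : \sum_j u j * (lam * x j - \sum_k B j k * x k) <= 0.
  under eq_bigr do rewrite mulrBr mulr_sumr.
  rewrite sumrB exchange_big /= -sumrB; apply: sumr_le0 => j _.
  under [in X in _ - X]eq_bigr do rewrite mulrA.
  rewrite -mulr_suml mulrA -mulrBl (mulrC (u j)) pmulr_lle0 //.
  by rewrite subr_le0.
have Hge j : 0 <= u j * (lam * x j - \sum_k B j k * x k).
  by rewrite mulr_ge0 // subr_ge0 ltW.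
have H0 : \sum_j u j * (lam * x j - \sum_k B j k * x k) >= 0 by apply: sumr_ge0.
move=> Hle; have /eqP : \sum_j u j * (lam * x j - \sum_k B j k * x k) = 0.
  by apply/eqP; rewrite eq_le Hle H0.
rewrite psumr_eq0 // => /allP/(_ i); rewrite mem_index_enum => /(_ isT) /=.
by rewrite mulf_eq0 subr_eq0 (gt_eqF (Bx i)) orbF => /eqP.
Qed.

Lemma strict_super_le (I : finType) (B : I -> I -> R) lam mu :
  lam <= mu -> strict_super I B lam -> strict_super I B mu.
Proof.
move=> le [x [x0 Bx]]; exists x; split=> // i; apply: lt_le_trans (Bx i) _.
by rewrite ler_wpM2r // ltW.
Qed.

(** Minimum principle: at an index minimizing x i / y i, with [y] a strict supersolution, a negative
    minimum would make the defect of [x] negative. *)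
Lemma strict_super_resolvent_ge0 (k : nat) (M : 'M[R]_k) lam (x : 'cV[R]_k) :
  (forall i j, 0 <= M i j) -> strict_super _ M lam ->
  (forall i, 0 <= lam * x i 0 - \sum_j M i j * x j 0) -> forall i, 0 <= x i 0.
Proof.
move=> M0 [y [y0 My]] Hx i0.
case: (@arg_minP _ _ _ i0 xpredT (fun i => x i 0 / y i) isT) => /= i _ Hi.
suff : 0 <= x i 0 / y i.
  move=> H; have := le_trans H (Hi i0 isT).
  by rewrite pmulr_lge0 // invr_gt0.
set t := x i 0 / y i; rewrite leNgt; apply/negP => t0.
have Hxy j : t * y j <= x j 0 by rewrite -ler_pdivlMr // Hi.
have : lam * x i 0 - \sum_j M i j * x j 0 < 0.
  have -> : x i 0 = t * y i by rewrite /t mulfVK // gt_eqF.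
  rewrite subr_lt0; apply: (@lt_le_trans _ _ (\sum_j M i j * (t * y j))); last first.
    by apply: ler_sum => j _; rewrite ler_wpM2l.
  under eq_bigr do rewrite mulrCA.
  by rewrite -mulr_sumr mulrCA ltr_nM2l.
by rewrite ltNge Hx.
Qed.

(** The root is the infimum s of the lam that admit a strict supersolution. If s - M had an inverse
    Q, then Q e (e the constant vector 1) would be a limit of nonnegative resolvents, hence
    positive, and a strict supersolution slightly below s. *)
Lemma perron_root (k : nat) (M : 'M[R]_k) : (0 < k)%N -> (forall i j, 0 <= M i j) ->
  exists s, [/\ 0 <= s, forall lam, s < lam -> strict_super _ M lam &
    exists2 v : 'rV[R]_k, v != 0 & v *m M = s *: v].
Proof.
move=> k0 M0; pose i0 := Ordinal k0.
pose good : set R := [set lam | strict_super _ M lam].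
have goodlb : lbound good 0.
  move=> lam [x [x0 Mx]]; rewrite -(pmulr_lge0 _ (x0 i0)).
  by apply/ltW/(le_lt_trans _ (Mx i0))/sumr_ge0 => j _; rewrite mulr_ge0 // ltW.
have good0 : good !=set0.
  exists (1 + \sum_i \sum_j M i j); exists (fun=> 1); split=> // i.
  rewrite mulr1; under eq_bigr do rewrite mulr1.
  rewrite [in ltRHS](bigD1 i) //= addrCA ltrDl ltr_wpDr //.
  by apply: sumr_ge0 => j _; apply: sumr_ge0.
have infgood : has_inf good by split=> //; exists 0.
pose s := inf good.
have s0 : 0 <= s by apply: lb_le_inf.
have sgood lam : s < lam -> good lam.
  by move=> /(inf_lt good0)[mu muG /ltW] /strict_super_le; apply.
exists s; split=> //.
suff : \det (s%:M - M) == 0.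
  move=> /det0P[v v0]; rewrite mulmxBr mul_mx_scalar => /eqP.
  by rewrite subr_eq0 => /eqP E; exists v.
apply/negPn/negP => detN0.
have unitM : s%:M - M \in unitmx by rewrite unitmxE unitfE.
pose Q := invmx (s%:M - M); pose e : 'cV[R]_k := const_mx 1.
pose C : R := \sum_i \sum_j `|Q i j|.
have C0 : 0 <= C by apply: sumr_ge0 => i _; apply: sumr_ge0.
have QC (y : 'cV[R]_k) (b : R) i : (forall j, `|y j 0| <= b) -> `|(Q *m y) i 0| <= C * b.
  move=> yb; have b0 : 0 <= b by exact: le_trans (yb i).
  rewrite mxE (le_trans (ler_norm_sum _ _ _)) //.
  apply: (@le_trans _ _ ((\sum_j `|Q i j|) * b)).
    by rewrite mulr_suml; apply: ler_sum => j _; rewrite normrM ler_wpM2l.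
  rewrite ler_wpM2r // /C [leRHS](bigD1 i) //= lerDl.
  by apply: sumr_ge0 => l _; apply: sumr_ge0.
have SC (y : 'cV[R]_k) (b : R) : (forall j, `|y j 0| <= b) ->
    forall i, `|(Q *m y) i 0| <= C * b by move=> H i; exact: QC.
(* For lam just above s the solution x of (lam - M) x = e is nonnegative and bounded by 2 C. Since Q
   e = x + (lam - s) Q x, the negative part of Q e is of order lam - s. *)
have step lam : s < lam -> (lam - s) * C <= 2^-1 ->
    forall i, - ((lam - s) * C * (2 * C)) <= (Q *m e) i 0.
  move=> slam small; have G := sgood _ slam.
  have unitL : lam%:M - M \in unitmx.
    rewrite unitmxE unitfE; apply/negP => /det0P[v v0]; rewrite mulmxBr mul_mx_scalar => /eqP.
    rewrite subr_eq0 => /eqP vM; apply/negP: v0; rewrite negbK; apply/eqP/rowP => j.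
    rewrite mxE; apply/eqP; rewrite -normr_eq0; apply/eqP.
    apply: (@strict_super_pairing _ M lam (fun j => `|v 0 j|)) => //= l.
    have [lam0|lam0] := leP 0 lam; last first.
      by rewrite (@le_trans _ _ 0) // ?sumr_ge0 //; [nra|move=> *; rewrite mulr_ge0].
    have := congr1 (fun A : 'rV_k => A 0 l) vM; rewrite !mxE => E.
    have -> : lam * `|v 0 l| = `|lam * v 0 l| by rewrite normrM ger0_norm.
    rewrite E (le_trans (ler_norm_sum _ _ _)) //.
    by apply: ler_sum => i _; rewrite normrM [`|M _ _|]ger0_norm.
  have [x Hx] : exists x, (lam%:M - M) *m x = e.
    by exists (invmx (lam%:M - M) *m e); rewrite mulmxA mulmxV // mul1mx.
  have Hxi i : lam * x i 0 - \sum_j M i j * x j 0 = 1.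
    have := congr1 (fun A : 'cV_k => A i 0) Hx; rewrite mulmxBl mul_scalar_mx.
    by rewrite !mxE.
  have x0 : forall i, 0 <= x i 0.
    by apply: (@strict_super_resolvent_ge0 _ M lam) => // i; rewrite Hxi.
  have Ex : x = Q *m e - (lam - s) *: (Q *m x).
    have : (s%:M - M) *m x = e - (lam - s) *: x.
      by rewrite -Hx !mulmxBl !mul_scalar_mx scalerBl opprB [RHS]addrC addrA subrK.
    move=> /(congr1 (mulmx Q)); rewrite mulmxA mulVmx // mul1mx => {1}->.
    by rewrite mulmxBr -scalemxAr.
  case: (@arg_maxP _ _ _ i0 xpredT (fun i => x i 0) isT) => /= im _ Him.
  have normx j : `|x j 0| <= x im 0 by rewrite ger0_norm // Him.
  have Qe i : `|(Q *m e) i 0| <= C.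
    by rewrite -[leRHS]mulr1; apply: QC => j; rewrite mxE normr1.
  have Exi i : x i 0 = (Q *m e) i 0 - (lam - s) * (Q *m x) i 0.
    by have := congr1 (fun A : 'cV_k => A i 0) Ex; rewrite !mxE.
  have xm : x im 0 <= 2 * C.
    have := Exi im; have := Qe im; have := QC x _ im normx.
    rewrite !ler_norml => /andP[H1 H2] /andP[H3 H4] E.
    have := x0 im; have : 0 < lam - s by rewrite subr_gt0.
    move: (x im 0) ((Q *m e) im 0) ((Q *m x) im 0) (lam - s) H1 H2 H3 H4 E small => X A B l.
    nra.
  move=> i; have := Exi i; have := QC x (2 * C) i (fun j => le_trans (normx j) xm).
  rewrite ler_norml => /andP[H1 H2] E; have := x0 i.
  have : 0 < lam - s by rewrite subr_gt0.
  move: (x i 0) ((Q *m e) i 0) ((Q *m x) i 0) (lam - s) H1 H2 E => X A B l; nra.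
have Qe0 i : 0 <= (Q *m e) i 0.
  apply/ler_addgt0Pr => eps eps0.
  pose dl := Num.min ((2 * (C + 1))^-1) (eps / (2 * C * C + 1)).
  have d1 : 0 < 2 * (C + 1) by nra.
  have d2 : 0 < 2 * C * C + 1 by nra.
  have dl0 : 0 < dl by rewrite lt_min invr_gt0 d1 divr_gt0.
  have dl1 : dl * (2 * (C + 1)) <= 1 by rewrite -ler_pdivlMr // mul1r ge_min lexx.
  have dl2 : dl * (2 * C * C + 1) <= eps by rewrite -ler_pdivlMr // ge_min lexx orbT.
  have := @step (s + dl); rewrite ltrDl addrAC subrr add0r => /(_ dl0) H.
  have {H}/(_ i) := H ltac:(nra).
  nra.
have HQ i : s * (Q *m e) i 0 - \sum_j M i j * (Q *m e) j 0 = 1.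
  have : (s%:M - M) *m (Q *m e) = e by rewrite mulmxA mulmxV // mul1mx.
  move=> /(congr1 (fun A : 'cV_k => A i 0)); rewrite mulmxBl mul_scalar_mx.
  by move: (Q *m e) => y; rewrite !mxE.
have HQ1 i : 1 <= s * (Q *m e) i 0.
  have : 0 <= \sum_j M i j * (Q *m e) j 0 by apply: sumr_ge0 => j _; rewrite mulr_ge0.
  by have := HQ i; lra.
have Qe1 i : 0 < (Q *m e) i 0.
  by rewrite lt_neqAle Qe0 andbT eq_sym; apply/eqP => H; have := HQ1 i; rewrite H mulr0 ler10.
(* Small enough for dl * (Q e) i < 1, while the defect of Q e at s equals 1. *)
pose dl := (1 + \sum_i (Q *m e) i 0)^-1.
have S0 : 0 <= \sum_i (Q *m e) i 0 by apply: sumr_ge0.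
have : good (s - dl).
  exists (fun i => (Q *m e) i 0); split=> // i.
  have Hd : dl * (Q *m e) i 0 < 1.
    rewrite mulrC ltr_pdivrMr ?mul1r; last by lra.
    rewrite (bigD1 i) //= addrCA ltrDl ltr_wpDr // sumr_ge0 //.
  by have := HQ i; rewrite mulrBl; lra.
move=> /(ge_inf (ex_intro _ 0 goodlb)); rewrite leNgt => /negP; apply.
by rewrite ltrBlDr ltrDl invr_gt0; lra.
Qed.

(** The moduli of [v] satisfy s u <= u M. Pairing u with strict supersolutions at s + dl, made
    comparable by Harnack constants uniform in dl, bounds the excess at each index by a multiple of
    dl; hence equality. Positivity then spreads along paths. *)
Lemma irreducible_left_eigenvector (k : nat) (M : 'M[R]_k) s (v : 'rV[R]_k) :
  (forall i j, 0 <= M i j) -> 0 <= s ->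
  (forall i j, connect (fun i j => M i j != 0) i j) ->
  (forall lam, s < lam -> strict_super _ M lam) ->
  v != 0 -> v *m M = s *: v ->
  exists u : 'I_k -> R, (forall i, 0 < u i) /\
    forall j, \sum_i u i * M i j = s * u j.
Proof.
move=> M0 s0 irr sup v0 vM.
pose u i := `|v 0 i|.
have u0 i : 0 <= u i by exact: normr_ge0.
have Mpos i j : M i j != 0 -> 0 < M i j by rewrite lt_neqAle eq_sym M0 andbT.
(* Each edge from i to l of a path gives x l <= (s + 1) / M i l * x i, uniformly in lam <= s + 1. *)
have harnack i j : exists2 C, 0 < C & forall lam (x : 'I_k -> R), lam <= s + 1 ->
    (forall i, 0 < x i) -> (forall i, \sum_j M i j * x j < lam * x i) -> x j <= C * x i.
  have /connectP[p + ->] := irr i j; elim: p i => [|l p IH] i /=.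
    by move=> _; exists 1 => // lam x _ _ _; rewrite mul1r.
  move=> /andP[/Mpos Mil] /IH[C C0 HC].
  have s1 : 0 < s + 1 by rewrite ltr_wpDl.
  exists (C * ((s + 1) / M i l)); first by rewrite mulr_gt0 // divr_gt0.
  move=> lam x lams x0 Mx; apply: le_trans (HC _ _ lams x0 Mx) _.
  rewrite -mulrA ler_wpM2l ?(ltW C0) // mulrAC ler_pdivlMr //.
  apply: (@le_trans _ _ (lam * x i)); last by rewrite ler_wpM2r // ltW.
  apply: le_trans (ltW (Mx i)); rewrite (bigD1 l) //= mulrC lerDl.
  by apply: sumr_ge0 => m _; rewrite mulr_ge0 // ltW.
have uM j : s * u j <= \sum_i u i * M i j.
  have := congr1 (fun A : 'rV_k => A 0 j) vM; rewrite !mxE => E.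
  have -> : s * u j = `|s * v 0 j| by rewrite normrM ger0_norm.
  rewrite -E (le_trans (ler_norm_sum _ _ _)) //.
  by apply: ler_sum => i _; rewrite normrM [`|M _ _|]ger0_norm.
have uMeq j : \sum_i u i * M i j = s * u j.
  apply/eqP; rewrite eq_le uM andbT -subr_le0.
  set w := _ - _.
  have [D D0 HD] : exists2 D, 0 <= D & forall lam (x : 'I_k -> R), lam <= s + 1 ->
      (forall i, 0 < x i) -> (forall i, \sum_j M i j * x j < lam * x i) ->
      \sum_i u i * x i <= D * x j.
    have /choice[C HC] : forall i, exists C, 0 < C /\ forall lam (x : 'I_k -> R), lam <= s + 1 ->
      (forall i, 0 < x i) -> (forall i, \sum_j M i j * x j < lam * x i) -> x i <= C * x j.
      by move=> i; have [C C0 H] := harnack j i; exists C.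
    exists (\sum_i u i * C i).
      by apply: sumr_ge0 => i _; rewrite mulr_ge0 // ltW // (HC i).1.
    move=> lam x l1 x0 Mx; rewrite mulr_suml; apply: ler_sum => i _.
    by rewrite -mulrA ler_wpM2l //; apply: (HC i).2 l1 x0 Mx.
  apply/ler_addgt0Pr => eps eps0; rewrite add0r.
  pose dl := Num.min 1 (eps / (D + 1)).
  have D1 : 0 < D + 1 by rewrite ltr_wpDl.
  have dl0 : 0 < dl by rewrite lt_min ltr01 divr_gt0.
  have dl2 : dl * (D + 1) <= eps by rewrite -ler_pdivlMr // ge_min lexx orbT.
  have [|x [x0 Mx]] := sup (s + dl); first by rewrite ltrDl.
  have dl1 : s + dl <= s + 1 by rewrite lerD2l ge_min lexx.
  have Hs := HD _ _ dl1 x0 Mx.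
  suff H : w * x j <= dl * (D * x j).
    have : w <= dl * D by rewrite mulrA ler_pM2r in H.
    by nra.
  apply: (@le_trans _ _ (dl * \sum_i u i * x i)); last by rewrite ler_pM2l.
  apply: (@le_trans _ _ (\sum_l (\sum_i u i * M i l - s * u l) * x l)).
    rewrite [leRHS](bigD1 j) //= lerDl; apply: sumr_ge0 => l _.
    by rewrite mulr_ge0 ?subr_ge0 // ltW.
  under eq_bigr do rewrite mulrBl mulr_suml.
  rewrite sumrB exchange_big /= -sumrB mulr_sumr; apply: ler_sum => i _.
  under eq_bigr do rewrite -mulrA.
  rewrite -mulr_sumr -mulrA [in leLHS]mulrCA -mulrBr mulrCA ler_wpM2l //.
  by have := Mx i; rewrite mulrDl; lra.
exists u; split=> // j; have [i ui] : exists i, 0 < u i.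
  apply/existsP; apply: contraNT v0 => /existsPn H; apply/eqP/rowP => i; rewrite mxE.
  by have := H i; rewrite normr_gt0 negbK => /eqP.
have /connectP[p + ->] := irr i j; elim: p i ui => [|l p IH] i ui //= /andP[/Mpos Mil].
apply: IH; rewrite lt_neqAle u0 andbT eq_sym; apply/eqP => ul0.
have := uMeq l; rewrite ul0 mulr0 (bigD1 i) //=.
have : 0 < u i * M i l by rewrite mulr_gt0.
have : 0 <= \sum_(i0 < k | i0 != i) u i0 * M i0 l by apply: sumr_ge0 => m _; rewrite mulr_ge0.
lra.
Qed.

Lemma connect_total_rev (I : finType) (e : rel I) :
  (forall i j, connect e i j) -> forall i j, connect (fun i j => e j i) i j.
Proof.
move=> H i j; suff : connect [rel x y | e y x] i j by [].
by rewrite connect_rev /= H.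
Qed.

(** The right eigenvector is a left eigenvector of the transpose. The two roots agree because both
    equal the value of l M r divided by l r, which is positive. *)
Lemma perron_irreducible (k : nat) (M : 'M[R]_k) : (0 < k)%N ->
  (forall i j, 0 <= M i j) ->
  (forall i j, connect (fun i j => M i j != 0) i j) ->
  exists s (l r : 'I_k -> R), [/\ 0 <= s, forall lam, s < lam -> strict_super _ M lam,
    (forall i, 0 < l i) /\ (forall i, 0 < r i),
    forall j, \sum_i l i * M i j = s * l j &
    forall i, \sum_j M i j * r j = s * r i].
Proof.
move=> k0 M0 irr.
have [s [s0 sup [v v0 vM]]] := perron_root _ _ k0 M0.
have [l [l0 lM]] := irreducible_left_eigenvector _ _ _ _ M0 s0 irr sup v0 vM.
have MT0 i j : 0 <= M^T i j by rewrite mxE.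
have [t [t0 tsup [w w0 wM]]] := perron_root _ _ k0 MT0.
have irrT i j : connect (fun i j => M^T i j != 0) i j.
  have := connect_total_rev _ _ irr i j.
  by rewrite (@eq_connect _ _ (fun i j => M^T i j != 0)) // => a b /=; rewrite mxE.
have [r [r0 Mr]] := irreducible_left_eigenvector _ _ _ _ MT0 t0 irrT tsup w0 wM.
have rM i : \sum_j M i j * r j = t * r i.
  by rewrite -Mr; apply: eq_bigr => j _; rewrite mxE mulrC.
suff st : s = t by exists s, l, r; split=> // i; rewrite st.
have pos : 0 < \sum_i l i * r i.
  rewrite (bigD1 (Ordinal k0)) //= ltr_pwDl ?mulr_gt0 // sumr_ge0 // => i _.
  by rewrite mulr_ge0 // ltW.
apply: (mulIf (lt0r_neq0 pos)); rewrite /= !mulr_sumr.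
transitivity (\sum_j \sum_i l i * M i j * r j).
  by apply: eq_bigr => j _; rewrite -mulr_suml lM mulrA.
rewrite exchange_big /=; apply: eq_bigr => i _; rewrite mulrCA -rM mulr_sumr.
by apply: eq_bigr => j _; rewrite mulrA.
Qed.

(** For an eigenvalue z one has Re z + 1 <= |z + 1|. If |z + 1| > s, the moduli of a left
    eigenvector vanish by [strict_super_pairing]. The value s - 1 is attained by [v]. *)
Lemma spectral_abscissa_shift (k : nat) (M : 'M[R]_k) s (v : 'rV[R]_k) :
  (forall i j, 0 <= M i j) -> 0 <= s ->
  (forall lam, s < lam -> strict_super _ M lam) ->
  v != 0 -> v *m M = s *: v ->
  spectral_abscissa (map_mx (real_complex R) M - 1%:M) = s - 1.
Proof.
move=> M0 s0 sup v0 vM; rewrite /spectral_abscissa; set S := (X in reals.sup X).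
have ub : ubound S (s - 1).
  move=> _ [z /= /eigenvalueP[w wz w0] <-].
  pose c := complex.Re `|z + 1|.
  have normE (x : R[i]) : `|x| = real_complex R (complex.Re `|x|).
    by rewrite normc_def.
  have Rez : complex.Re z + 1 <= c.
    rewrite /c normc_def /=; case: z {wz c} => a b /=; rewrite addr0.
    apply: le_trans (ler_norm _) _; rewrite -sqrtr_sqr ler_wsqrtr //.
    by rewrite lerDl sqr_ge0.
  suff : c <= s by lra.
  rewrite leNgt; apply/negP => sc.
  pose u i := complex.Re `|w 0 i|.
  have u0 i : 0 <= u i by rewrite /u normc_def /= sqrtr_ge0.
  have H := @strict_super_pairing _ M c u (sup c sc) u0.
  case/negP : w0; apply/eqP/rowP => i; rewrite mxE; apply/eqP.
  rewrite -normr_eq0 normE -/(u i) H // => j.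
  rewrite -lecR -[leLHS]/(real_complex R (c * u j)) rmorphM /= -!normE -normrM.
  have -> : (z + 1) * w 0 j = \sum_i w 0 i * real_complex R (M i j).
    have := congr1 (fun A : 'rV_k => A 0 j) wz; rewrite mulmxBr mulmx1 !mxE => E.
    rewrite mulrDl mul1r -E subrK.
    by apply: eq_bigr => l _; rewrite mxE.
  rewrite (le_trans (ler_norm_sum _ _ _)) // rmorph_sum; apply: ler_sum => l _ /=.
  by rewrite normrM rmorphM /= -normE [`|real_complex R _|]ger0_norm // ler0c.
have inS : S (s - 1).
  exists (real_complex R (s - 1)) => //=; apply/eigenvalueP; exists (map_mx (real_complex R) v).
    by rewrite mulmxBr mulmx1 -map_mxM vM map_mxZ rmorphB rmorph1 scalerBl scale1r.
  by rewrite map_mx_eq0.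
apply/eqP; rewrite eq_le; apply/andP; split; first by apply: ge_sup => //; exists (s - 1).
by apply: ub_le_sup => //; exists (s - 1).
Qed.

End Perron.

(** * Classes of a matrix and their Perron data *)

Section Classes.
Context {K : nmodType} {N : nat}.
Variable B : 'M[K]_N.

Definition class_of (i : 'I_N) : {set 'I_N} := [set j | mutual_access B i j].

Lemma mutual_access_refl i : mutual_access B i i.
Proof. by rewrite /mutual_access /access connect0. Qed.

Lemma mutual_access_sym i j : mutual_access B i j = mutual_access B j i.
Proof. by rewrite /mutual_access andbC. Qed.

Lemma access_trans i j k : access B i j -> access B j k -> access B i k.
Proof. exact: connect_trans. Qed.

Lemma mutual_access_trans i j k :
  mutual_access B i j -> mutual_access B j k -> mutual_access B i k.
Proof.
move=> /andP[ij ji] /andP[jk kj]; apply/andP; split.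
  exact: access_trans ij jk.
exact: access_trans kj ji.
Qed.

Lemma mem_class_of i : i \in class_of i.
Proof. by rewrite inE mutual_access_refl. Qed.

Lemma class_of_eq i j : mutual_access B i j -> class_of i = class_of j.
Proof.
move=> ij; apply/setP => k; rewrite !inE; apply/idP/idP; last exact: mutual_access_trans.
by apply: mutual_access_trans; rewrite mutual_access_sym.
Qed.

Lemma mx_classesP g : reflect (exists i, g = class_of i) (g \in mx_classes B).
Proof.
apply: (iffP imsetP) => [[i _ ->]|[i ->]].
  by exists i; apply/setP => j; rewrite !inE.
by exists i => //; apply/setP => j; rewrite !inE.
Qed.

Lemma mx_class_eq g i : g \in mx_classes B -> i \in g -> g = class_of i.
Proof. by move=> /mx_classesP[j ->]; rewrite inE => /class_of_eq. Qed.

Lemma class_prec_class_of i j :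
  class_prec B (class_of i) (class_of j) = access B i j && ~~ access B j i.
Proof.
apply/idP/idP.
  move=> /andP[ne /existsP[a /andP[+ /existsP[b /andP[+ ab]]]]].
  rewrite !inE => /andP[ia ai] /andP[jb bj].
  have ij : access B i j by apply: access_trans ia (access_trans _ _ _ ab bj).
  rewrite ij /=; apply: contra ne => ji; apply/eqP/class_of_eq.
  by rewrite /mutual_access ij ji.
move=> /andP[ij Nji]; apply/andP; split.
  apply: contraNN Nji => /eqP E; have := mem_class_of j; rewrite -E inE.
  by move=> /andP[].
by apply/existsP; exists i; rewrite mem_class_of; apply/existsP; exists j; rewrite mem_class_of.
Qed.

End Classes.

(** The graph has no loops, so the diagonal is free: this lets a complex matrix M - I be replaced by
    the real nonnegative M in all statements on classes. *)
Lemma mx_edge_classes (K K' : nmodType) N (B : 'M[K]_N) (B' : 'M[K']_N) :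
  (forall i j, i != j -> (B i j != 0) = (B' i j != 0)) ->
  [/\ access B =2 access B', mx_classes B = mx_classes B' &
    forall g h, class_prec B g h = class_prec B' g h].
Proof.
move=> H; have E : access B =2 access B'.
  apply: eq_connect => i j; rewrite /mx_edge.
  by case: (altP (i =P j)) => //= /H ->.
split=> //.
  apply: eq_imset => i; apply/setP => j.
  by rewrite !inE /mutual_access !E.
move=> g h; rewrite /class_prec; congr (_ && _).
by apply: eq_existsb => i; congr (_ && _); apply: eq_existsb => j; rewrite E.
Qed.

Lemma mx_edge_chain (K K' : nmodType) N (B : 'M[K]_N) (B' : 'M[K']_N) s :
  (forall i j, i != j -> (B i j != 0) = (B' i j != 0)) ->
  is_chain B s = is_chain B' s.
Proof.
move=> /mx_edge_classes[_ E1 E2]; rewrite /is_chain E1; congr [&& _, _ & _].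
exact: eq_sorted.
Qed.

Section PerronClass.
Context {R : realType} {N : nat}.
Variable M : 'M[R]_N.
Hypothesis M0 : forall i j, 0 <= M i j.

(** A path between two vertices of a class stays in it: every intermediate vertex leads to the
    endpoint, which leads back to the start. *)
Lemma class_submx_connect g : g \in mx_classes M ->
  forall a b : 'I_#|g|, connect (fun a b => class_submx M g a b != 0) a b.
Proof.
move=> gM a b.
suff H i j : connect (mx_edge M) i j -> i \in g -> j \in g ->
    forall a b : 'I_#|g|, enum_val a = i -> enum_val b = j ->
    connect (fun a b => class_submx M g a b != 0) a b.
  apply: (H (enum_val a) (enum_val b)) => //; try exact: enum_valP.
  have := enum_valP b; rewrite [in X in _ \in X](mx_class_eq _ _ _ gM (enum_valP a)) inE.
  by move=> /andP[].
move=> /connectP[p + ->] {j a b}; elim: p i => [|k p IH] i /=.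
  by move=> _ _ _ a b <- /enum_val_inj ->; exact: connect0.
move=> /andP[ik kp] ig lg a b ai bl.
have kg : k \in g.
  have gi := mx_class_eq _ _ _ gM ig; rewrite gi inE /mutual_access.
  have aik : access M i k by exact: connect1.
  rewrite aik /=; apply: (access_trans _ _ (last k p)); first by apply/connectP; exists p.
  by move: lg; rewrite gi inE => /andP[].
have := IH k kp kg lg (enum_rank_in kg k) b (enum_rankK_in kg kg) bl.
apply: connect_trans; apply: connect1; rewrite mxE enum_rankK_in // ai.
by case/andP: ik.
Qed.

Lemma perron_class g : g \in mx_classes M ->
  exists s (l r : 'I_N -> R),
  [/\ 0 <= s, (forall i, 0 < l i) /\ (forall i, 0 < r i),
    forall j, j \in g -> \sum_(i in g) l i * M i j = s * l j,
    forall i, i \in g -> \sum_(j in g) M i j * r j = s * r i &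
    spectral_abscissa (map_mx (real_complex R) (class_submx M g) - 1%:M) = s - 1].
Proof.
move=> gM; have [i0 gi0] := elimT (mx_classesP _ _) gM.
have i0g : i0 \in g by rewrite gi0 mem_class_of.
have g0 : (0 < #|g|)%N by apply/card_gt0P; exists i0.
have sub0 a b : 0 <= class_submx M g a b by rewrite mxE.
have [s [l [r [s0 sup [l0 r0] lM rM]]]] :=
  perron_irreducible _ _ _ g0 sub0 (class_submx_connect _ gM).
exists s, (fun i => l (enum_rank_in i0g i)), (fun i => r (enum_rank_in i0g i)).
split=> //.
- move=> j jg; rewrite -lM big_enum_val; apply: eq_bigr => a _.
  by rewrite mxE enum_valK_in enum_rankK_in.
- move=> i ig; rewrite -rM big_enum_val; apply: eq_bigr => a _.
  by rewrite mxE enum_valK_in enum_rankK_in.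
- apply: (@spectral_abscissa_shift _ _ _ _ (\row_a l a)) => //.
    apply/eqP => /(congr1 (fun A : 'rV_ _ => A 0 (Ordinal g0))); rewrite !mxE.
    by move=> E; have := l0 (Ordinal g0); rewrite E ltxx.
  apply/rowP => b; rewrite !mxE -lM; apply: eq_bigr => a _; by rewrite mxE.
Qed.

(** Pairing with the left eigenvector. It turns a supersolution of the whole matrix into a bound on
    the root of each class. *)
Lemma perron_class_super g s (l : 'I_N -> R) (x : 'I_N -> R) lam :
  g \in mx_classes M -> (forall i, 0 < l i) ->
  (forall j, j \in g -> \sum_(i in g) l i * M i j = s * l j) ->
  (forall i, 0 < x i) -> (forall i, i \in g -> \sum_(j in g) M i j * x j <= lam * x i) ->
  s <= lam.
Proof.
move=> gM l0 lM x0 Mx; have [i0 gi0] := elimT (mx_classesP _ _) gM.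
have i0g : i0 \in g by rewrite gi0 mem_class_of.
have pos : 0 < \sum_(i in g) l i * x i.
  rewrite (bigD1 i0) //= ltr_pwDl ?mulr_gt0 // sumr_ge0 // => i _.
  by rewrite mulr_ge0 // ltW.
rewrite -(ler_pM2r pos) !mulr_sumr.
have -> : \sum_(i in g) s * (l i * x i) = \sum_(j in g) \sum_(i in g) l i * M i j * x j.
  by apply: eq_bigr => j jg; rewrite -mulr_suml lM // mulrA.
rewrite exchange_big /=; apply: ler_sum => i ig; rewrite mulrCA.
under eq_bigr do rewrite -mulrA.
by rewrite -mulr_sumr ler_wpM2l ?Mx // ltW.
Qed.

End PerronClass.

Set Implicit Arguments.
Unset Strict Implicit.
Unset Printing Implicit Defensive.

Section ExtremalClasses.
Variables (K : nmodType) (N : nat) (B : 'M[K]_N).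

(** Take [j] accessible from [i] with the fewest accessible vertices: passing to a class strictly
    after that of [j] would lower this number. *)
Lemma final_class_access i : exists2 j, access B i j & final_class B (class_of B j).
Proof.
have [|j ij jmin] := @arg_minnP _ i (access B i) (fun j => #|[pred k | access B j k]|).
  exact: connect0.
exists j => //; apply/andP; split; first by apply/mx_classesP; exists j.
apply/forall_inP => h /mx_classesP[k ->]; rewrite class_prec_class_of;
  apply/negP => /andP[jk /negP kj].
have := jmin k (connect_trans ij jk); rewrite leqNgt => /negP; apply; apply: proper_card.
apply/properP; split; first by apply/fintype.subsetP => m; rewrite !inE; exact: connect_trans.
by exists j; rewrite inE; [exact: connect0|exact/negP].
Qed.

Lemma initial_class_access i : exists2 j, access B j i & initial_class B (class_of B j).
Proof.
have [|j ij jmin] := @arg_minnP _ i (access B ^~ i) (fun j => #|[pred k | access B k j]|).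
  exact: connect0.
exists j => //; apply/andP; split; first by apply/mx_classesP; exists j.
apply/forall_inP => h /mx_classesP[k ->]; rewrite class_prec_class_of;
  apply/negP => /andP[kj /negP jk].
have := jmin k (connect_trans kj ij); rewrite leqNgt => /negP; apply; apply: proper_card.
apply/properP; split; first by apply/fintype.subsetP => m; rewrite !inE => mk;
  exact: connect_trans kj.
by exists j; rewrite inE; [exact: connect0|exact/negP].
Qed.

End ExtremalClasses.

(** * Survival probabilities *)

Fixpoint survival (R : realType) (I : finType) (q : I -> I -> R) (k : nat) (i : I) : R :=
  if k is k'.+1 then \sum_j q i j * survival q k' j else 1.

Section Survival.
Variables (R : realType) (I : finType) (q : I -> I -> R).
Hypotheses (q0 : forall i j, 0 <= q i j) (q1 : forall i, \sum_j q i j <= 1).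

Lemma survival_ge0 k i : 0 <= survival q k i.
Proof. by elim: k i => //= k IH i; apply: sumr_ge0 => j _; rewrite mulr_ge0. Qed.

Lemma survivalS k i : survival q k.+1 i <= survival q k i.
Proof.
elim: k i => [|k IH] i /=.
  by apply: le_trans (q1 i); apply: ler_sum => j _; rewrite mulr1.
by apply: ler_sum => j _; rewrite ler_wpM2l //; exact: IH.
Qed.

Lemma survival_le m k i : (m <= k)%N -> survival q k i <= survival q m i.
Proof.
elim: k => [|k IH]; first by rewrite leqn0 => /eqP ->.
by rewrite leq_eqVlt => /predU1P[->//|/IH]; apply: le_trans; exact: survivalS.
Qed.

Lemma survival_le1 k i : survival q k i <= 1.
Proof. exact: (@survival_le 0). Qed.

(** [kap] is the sum of the first K survival probabilities divided by 1 - th, where th < 1 bounds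
    the K-th one. Applying q shifts the sum by one, so the difference telescopes to (1 - survival q
    K i) / (1 - th) >= 1. *)
Lemma survival_kappa K : (forall i, survival q K i < 1) ->
  exists kap : I -> R, (forall i, 0 < kap i) /\
    forall i, 1 + \sum_j q i j * kap j <= kap i.
Proof.
move=> sK.
have [th th1 Hth] : exists2 th : R, th < 1 & forall i, survival q K i <= th.
  have [i0|] := pickP I; last by move=> I0; exists 0 => // i; have := I0 i.
  have [|i _ imax] := @arg_maxP _ _ _ i0 xpredT (survival q K); first by [].
  by exists (survival q K i) => // j; exact: imax.
(* For K = 0 the hypothesis reads 1 < 1, which forces [I] to be empty. *)
have K0 : (0 < K)%N || (#|I| == 0)%N.
  case: K sK {Hth} => [s0|//]; apply/orP; right; apply/pred0P => i.
  by have := s0 i; rewrite ltxx.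
have c0 : 0 < (1 - th)^-1 by rewrite invr_gt0 subr_gt0.
exists (fun i => (1 - th)^-1 * \sum_(k < K) survival q k i); split => i.
  rewrite mulr_gt0 //; case/orP: K0 => [|/eqP I0]; last first.
    by have := max_card (pred1 i); rewrite I0 card1.
  case: K {sK Hth} => // K _; rewrite big_ord_recl ltr_pwDl //=.
  by apply: sumr_ge0 => k _; exact: (survival_ge0 k.+1).
have -> : \sum_j q i j * ((1 - th)^-1 * \sum_(k < K) survival q k j) =
    (1 - th)^-1 * \sum_(k < K) survival q k.+1 i.
  rewrite /= exchange_big mulr_sumr; apply: eq_bigr => j _ /=.
  by rewrite mulrCA mulr_sumr.
have tele : \sum_(k < K) survival q k i - \sum_(k < K) survival q k.+1 i = 1 - survival q K i.
  rewrite -sumrB; elim: K {sK Hth K0} => [|k IH]; first by rewrite big_ord0 subrr.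
  by rewrite big_ord_recr /= IH addrA subrK.
by rewrite -lerBrDr -mulrBr tele ler_pdivlMl ?subr_gt0 // mulr1 lerB.
Qed.

(** [kap] bounds the partial sums of the survival probabilities; these decrease, so K times the K-th
    one is at most [kap i]. *)
Lemma survival_cvg0 (kap : I -> R) : (forall i, 0 < kap i) ->
  (forall i, 1 + \sum_j q i j * kap j <= kap i) ->
  forall e, 0 < e -> exists K, forall i, survival q K i <= e.
Proof.
move=> k0 Hk e e0.
have sumk K i : \sum_(k < K) survival q k i <= kap i.
  elim: K i => [|K IH] i; first by rewrite big_ord0 ltW.
  rewrite big_ord_recl /=; apply: le_trans (Hk i); rewrite lerD2l exchange_big /=.
  by apply: ler_sum => j _; rewrite -mulr_sumr ler_wpM2l.
pose C := \sum_i kap i.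
have kC i : kap i <= C by rewrite /C (bigD1 i) //= lerDl sumr_ge0 // => j _; exact: ltW.
exists (Num.truncn (C / e)).+1 => i; set K := _.+1.
have KC : C <= K%:R * e.
  by rewrite -ler_pdivrMr // ltW // truncnS_gt.
have : K%:R * survival q K i <= K%:R * e.
  apply: le_trans KC; apply: le_trans (kC i); apply: le_trans (sumk K i).
  rewrite -[K in K%:R]card_ord -sumr_const mulr_suml.
  by apply: ler_sum => k _; rewrite mul1r survival_le // ltnW.
by rewrite ler_pM2l // ltr0n.
Qed.

End Survival.

(** By [survival_kappa] it suffices that survival is not certain from any state. The states from
    which it is certain forever are closed under transitions of [Pi], so they would contain a final
    class on which no reset is possible, against condition (v). *)
Lemma reset_kappa (R : realType) N (Pi Ups : 'M[R]_N) :
  (forall i j, 0 <= Pi i j) -> (forall i, \sum_j Pi i j = 1) ->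
  (forall i j, 0 <= Ups i j <= 1) ->
  (forall g, final_class Pi g -> exists i j, [/\ i \in g, j \in g, 0 < Pi i j & Ups i j < 1]) ->
  exists kap : 'I_N -> R, (forall i, 0 < kap i) /\
    forall i, 1 + \sum_j Pi i j * Ups i j * kap j <= kap i.
Proof.
move=> Pi0 Pi1 U01 Hfin; set q := fun i j => Pi i j * Ups i j.
have q0 i j : 0 <= q i j by rewrite mulr_ge0 //; case/andP: (U01 i j).
have qP i j : q i j <= Pi i j by rewrite ler_piMr //; case/andP: (U01 i j).
have q1 i : \sum_j q i j <= 1 by rewrite -(Pi1 i); apply: ler_sum.
suff [K HK] : exists K, forall i, survival q K i < 1 by exact: survival_kappa HK.
suff Hi i : exists K, survival q K i < 1.
  have [f Hf] := choice Hi; exists (\max_i f i)%N => i.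
  by apply: le_lt_trans (Hf i); apply: survival_le => //; exact: leq_bigmax.
apply: contrapT => Ni.
pose Z j := forall k, survival q k j = 1.
have Zi : Z i.
  move=> k; apply/eqP; rewrite eq_le survival_le1 //= leNgt; apply/negP => lt1.
  by apply: Ni; exists k.
(* Survival from j is an average of the numbers Ups j k * survival q m k <= 1 with weights Pi j k.
   Its value 1 forces each number of positive weight to be 1. *)
have Zstep j k : Z j -> 0 < Pi j k -> Ups j k = 1 /\ Z k.
  move=> Zj jk.
  have H m : Ups j k * survival q m k = 1.
    have s1 : \sum_l (Pi j l - q j l * survival q m l) = 0.
      by rewrite sumrB Pi1 -/(survival q m.+1 j) Zj subrr.
    have pos l : 0 <= Pi j l - q j l * survival q m l.
      rewrite subr_ge0; apply: le_trans (qP j l).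
      by rewrite ler_piMr // survival_le1.
    have /eqP := s1; rewrite psumr_eq0; last by move=> l _; exact: pos.
    move=> /allP/(_ k (mem_index_enum k)) /= /eqP.
    move=> /eqP; rewrite subr_eq0 /q -mulrA => /eqP H.
    by apply: (mulfI (lt0r_neq0 jk)); rewrite -H mulr1.
  have U1 : Ups j k = 1 by have := H 0%N; rewrite mulr1.
  by split=> // m; have := H m; rewrite U1 mul1r.
have Zacc j : access Pi i j -> Z j.
  move=> /connectP[p + ->]; elim: p i Zi {Ni} => [//|k p IH] m Zm /= /andP[/andP[_ mk] pk].
  apply: IH pk; apply: (Zstep m k Zm _).2.
  by rewrite lt_neqAle eq_sym mk Pi0.
have [j ij fj] := final_class_access Pi i.
have [a [b [ja _ Pab Uab]]] := Hfin _ fj.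
have ia : access Pi i a by move: ja; rewrite inE => /andP[ja _]; exact: connect_trans ja.
have [U1 _] := Zstep a b (Zacc a ia) Pab.
by rewrite U1 ltxx in Uab.
Qed.

(** * The transfer operator and its Green function *)

Section Kernel.
Context {d : measure_display} {T : measurableType d} {R : realType}.
Variables (P : probability T R) (I : finType) (X : I -> I -> T -> R).
Hypothesis mX : forall i j, measurable_fun [set: T] (X i j).
Local Open Scope ereal_scope.
Implicit Types (q : I -> I -> R) (f g h : I -> R -> \bar R).

Definition nnmeas f :=
  (forall i y, 0 <= f i y) /\ forall i, measurable_fun [set: R] (f i).

Definition kernel_op q f : I -> R -> \bar R := fun i y =>
  \sum_j (q i j)%:E * \int[P]_x f j (y + X i j x)%R.

(** Partial sum of the Neumann series of [kernel_op] (see [green_sum]). The recursive form makes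
    comparison arguments immediate inductions on K. *)
Fixpoint green q (K : nat) f : I -> R -> \bar R :=
  if K is K'.+1 then fun i y => f i y + kernel_op q (green q K' f) i y
  else fun _ _ => 0.

Lemma measurable_shift (y : R) f i j : (forall i, measurable_fun [set: R] (f i)) ->
  measurable_fun [set: T] (fun x => f j (y + X i j x)%R).
Proof.
move=> mf; apply: measurableT_comp (mf j) _.
by apply: measurable_funD => //; exact: mX.
Qed.

Lemma integral_shift_ge0 f : nnmeas f -> forall (y : R) i j,
  0 <= \int[P]_x f j (y + X i j x)%R.
Proof. by move=> [f0 _] y i j; apply: integral_ge0 => x _; exact: f0. Qed.

Lemma kernel_op_nnmeas q f : (forall i j, (0 <= q i j)%R) -> nnmeas f ->
  nnmeas (kernel_op q f).
Proof.
move=> q0 nf; have [f0 mf] := nf; split.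
  move=> i y; apply: sume_ge0 => j _; rewrite mule_ge0 ?lee_fin //.
  exact: integral_shift_ge0.
move=> i; apply: emeasurable_sum => j; apply: measurable_funeM.
pose F (z : R * T) := f j (z.1 + X i j z.2)%R.
have mF : measurable_fun [set: R * T] F.
  apply: measurableT_comp (mf j) _; apply: measurable_funD => //.
  by apply: measurableT_comp => //; exact: mX.
exact: (@measurable_fun_fubini_tonelli_F _ _ _ _ _ P F mF (fun z => f0 j _)).
Qed.

Lemma green_nnmeas q K f : (forall i j, (0 <= q i j)%R) -> nnmeas f ->
  nnmeas (green q K f).
Proof.
move=> q0 nf; elim: K => [|K IH] /=; first by split=> // i; exact: measurable_cst.
have [k0 mk] := kernel_op_nnmeas q0 IH; have [f0 mf] := nf; split.
  by move=> i y; rewrite adde_ge0.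
by move=> i; apply: emeasurable_funD.
Qed.

Lemma kernel_op_le q q' f g : (forall i j, (0 <= q i j <= q' i j)%R) ->
  nnmeas f -> nnmeas g -> (forall i y, f i y <= g i y) ->
  forall i y, kernel_op q f i y <= kernel_op q' g i y.
Proof.
move=> qq nf ng fg i y; apply: lee_sum => j _; have /andP[q0 ql] := qq i j.
apply: lee_pmul; rewrite ?lee_fin //; first exact: integral_shift_ge0.
apply: ge0_le_integral => //.
- by move=> x _; exact: nf.1.
- by apply: measurable_shift nf.2.
- by apply: measurable_shift ng.2.
Qed.

Lemma kernel_opD q f g : (forall i j, (0 <= q i j)%R) -> nnmeas f -> nnmeas g ->
  forall i y, kernel_op q (fun i y => f i y + g i y) i y =
    kernel_op q f i y + kernel_op q g i y.
Proof.
move=> q0 nf ng i y; rewrite /kernel_op -big_split; apply: eq_bigr => j _ /=.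
rewrite ge0_integralD //; try by move=> *; (exact: nf.1 || exact: ng.1).
- by rewrite ge0_muleDr // integral_shift_ge0.
- by apply: measurable_shift nf.2.
- by apply: measurable_shift ng.2.
Qed.

Lemma kernel_opZ q f (c : R) : (forall i j, (0 <= q i j)%R) -> (0 <= c)%R -> nnmeas f ->
  forall i y, kernel_op q (fun i y => c%:E * f i y) i y = c%:E * kernel_op q f i y.
Proof.
move=> q0 c0 nf i y; rewrite /kernel_op.
under eq_bigr => j _.
  rewrite ge0_integralZl_EFin //; first last.
  - by apply: measurable_shift nf.2.
  - by move=> x _; exact: nf.1.
  rewrite muleCA; over.
by rewrite -ge0_sume_distrr // => j _; rewrite mule_ge0 ?lee_fin ?integral_shift_ge0.
Qed.

Lemma green_le q q' f g K : (forall i j, (0 <= q i j <= q' i j)%R) ->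
  nnmeas f -> nnmeas g -> (forall i y, f i y <= g i y) ->
  forall i y, green q K f i y <= green q' K g i y.
Proof.
move=> qq nf ng fg; have q0 i j : (0 <= q i j)%R by case/andP: (qq i j).
have q0' i j : (0 <= q' i j)%R by apply: (le_trans (q0 i j)); case/andP: (qq i j).
elim: K => [//|K IH] i y /=; rewrite leeD // kernel_op_le //; exact: green_nnmeas.
Qed.

Lemma kernel_op_mono q f g : (forall i j, (0 <= q i j)%R) ->
  nnmeas f -> nnmeas g -> (forall i y, f i y <= g i y) ->
  forall i y, kernel_op q f i y <= kernel_op q g i y.
Proof. by move=> q0; apply: kernel_op_le => i j; rewrite q0 lexx. Qed.

Lemma green_mono q f g K : (forall i j, (0 <= q i j)%R) ->
  nnmeas f -> nnmeas g -> (forall i y, f i y <= g i y) ->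
  forall i y, green q K f i y <= green q K g i y.
Proof. by move=> q0; apply: green_le => i j; rewrite q0 lexx. Qed.

(** Comparison principle, by induction on K. It yields upper bounds when [h] is explicit, and lower
    bounds on an unknown [h] when [f] is. *)
Lemma green_supersolution q f h K : (forall i j, (0 <= q i j)%R) ->
  nnmeas f -> nnmeas h -> (forall i y, f i y + kernel_op q h i y <= h i y) ->
  forall i y, green q K f i y <= h i y.
Proof.
move=> q0 nf nh fh; elim: K => [|K IH] i y /=; first exact: nh.1.
apply: le_trans (fh i y); rewrite leeD // kernel_op_mono //; exact: green_nnmeas.
Qed.

Lemma nnmeasD f g : nnmeas f -> nnmeas g -> nnmeas (fun i y => f i y + g i y).
Proof.
move=> [f0 mf] [g0 mg]; split; first by move=> i y; rewrite adde_ge0.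
by move=> i; apply: emeasurable_funD.
Qed.

Lemma nnmeasZ (c : R) f : (0 <= c)%R -> nnmeas f -> nnmeas (fun i y => c%:E * f i y).
Proof.
move=> c0 [f0 mf]; split; first by move=> i y; rewrite mule_ge0.
by move=> i; apply: measurable_funeM.
Qed.

Lemma nnmeas_shift f (b : R) : nnmeas f -> nnmeas (fun i y => f i (y + b)%R).
Proof.
move=> [f0 mf]; split; first by move=> i y; exact: f0.
by move=> i; apply: measurableT_comp (mf i) _; apply: measurable_funD.
Qed.

Lemma greenD q f g K : (forall i j, (0 <= q i j)%R) -> nnmeas f -> nnmeas g ->
  forall i y, green q K (fun i y => f i y + g i y) i y = green q K f i y + green q K g i y.
Proof.
move=> q0 nf ng; elim: K => [|K IH] i y /=; first by rewrite adde0.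
rewrite -[RHS]addeACA; congr (_ + _).
rewrite -kernel_opD //; try exact: green_nnmeas.
by congr kernel_op; apply/funext => j; apply/funext => x; exact: IH.
Qed.

Lemma green_shift q f (b : R) K i y :
  green q K (fun i y => f i (y + b)%R) i y = green q K f i (y + b)%R.
Proof.
elim: K i y => [//|K IH] i y /=; congr (_ + _).
apply: eq_bigr => j _; congr (_ * _); apply: eq_integral => x _.
by rewrite IH addrAC.
Qed.

Lemma greenZ q f (c : R) K : (forall i j, (0 <= q i j)%R) -> (0 <= c)%R -> nnmeas f ->
  forall i y, green q K (fun i y => c%:E * f i y) i y = c%:E * green q K f i y.
Proof.
move=> q0 c0 nf; elim: K => [|K IH] i y /=; first by rewrite mule0.
have ng := green_nnmeas K q0 nf; have [k0 _] := kernel_op_nnmeas q0 ng.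
rewrite ge0_muleDr //; last exact: nf.1.
rewrite -kernel_opZ //; congr (_ + _); congr kernel_op.
by apply/funext => j; apply/funext => x; exact: IH.
Qed.

(** Converse comparison, for a subsolution with defect [g]. Uniqueness may fail, so the iterate of
    [f] is kept as a remainder and is made small by [iter_kernel_op_expf]. *)
Lemma green_step q f g K : (forall i j, (0 <= q i j)%R) -> nnmeas f -> nnmeas g ->
  (forall i y, f i y <= kernel_op q f i y + g i y) ->
  forall i y, f i y <= iter K (kernel_op q) f i y + green q K g i y.
Proof.
move=> q0 nf ng fg; have ni k : nnmeas (iter k (kernel_op q) f).
  by elim: k => [//|k IH] /=; exact: kernel_op_nnmeas.
elim: K => [|K IH] i y /=; first by rewrite adde0.
apply: le_trans (fg i y) _; rewrite [in leRHS](addeC (g i y)) addeA leeD //.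
rewrite -kernel_opD //; last exact: green_nnmeas.
apply: kernel_op_mono => //; apply: nnmeasD => //; exact: green_nnmeas.
Qed.

Definition expf (z : R) (v : I -> R) : I -> R -> \bar R :=
  fun i y => (expR (z * y) * v i)%:E.

Definition mgf (i j : I) (z : R) : R := fine (\int[P]_x (expR (z * X i j x))%:E).

Definition mgf_finite (z : R) := forall i j, \int[P]_x (expR (z * X i j x))%:E < +oo.

Lemma measurable_mgf z i j : measurable_fun [set: T] (fun x => (expR (z * X i j x))%:E).
Proof.
by apply/measurable_EFinP; apply: measurableT_comp => //; apply: measurable_funM.
Qed.

Lemma mgfE z i j : mgf_finite z -> \int[P]_x (expR (z * X i j x))%:E = (mgf i j z)%:E.
Proof.
by move=> fz; rewrite fineK // ge0_fin_numE ?fz // integral_ge0.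
Qed.

Lemma mgf_ge0 i j z : (0 <= mgf i j z)%R.
Proof. by apply/fine_ge0/integral_ge0 => x _; rewrite lee_fin expR_ge0. Qed.

Lemma expf_nnmeas z v : (forall i, (0 <= v i)%R) -> nnmeas (expf z v).
Proof.
move=> v0; split; first by move=> i y; rewrite lee_fin mulr_ge0 ?expR_ge0.
move=> i; apply/measurable_EFinP; apply: measurable_funM => //.
by apply: measurableT_comp => //; exact: measurable_funM.
Qed.

(** Exponentials are eigenfunctions of translations, so the operator acts on them through the matrix
    with entries q i j * mgf i j z. Spectral information enters the tail estimates here. *)
Lemma kernel_op_expf q z v : (forall i j, (0 <= q i j)%R) -> (forall i, (0 <= v i)%R) ->
  mgf_finite z -> forall i y,
  kernel_op q (expf z v) i y = expf z (fun i => \sum_j q i j * mgf i j z * v j)%R i y.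
Proof.
move=> q0 v0 fz i y; rewrite /kernel_op /expf mulr_sumr -sumEFin.
apply: eq_bigr => j _.
under eq_integral do rewrite mulrDr expRD mulrAC EFinM.
rewrite ge0_integralZl_EFin ?mulr_ge0 ?expR_ge0 //; last exact: measurable_mgf.
by rewrite mgfE // -!EFinM; congr (_%:E); ring.
Qed.

Lemma mgf_finite_le a z : (0 <= z <= a)%R -> mgf_finite a -> mgf_finite z.
Proof.
move=> /andP[z0 za] fa i j.
apply: (@le_lt_trans _ _ (\int[P]_x (1 + (expR (a * X i j x))%:E))).
  apply: ge0_le_integral => //.
  - exact: measurable_mgf.
  - by apply: emeasurable_funD => //; exact: measurable_mgf.
  move=> x _; rewrite -EFinD lee_fin.
  have [X0|X0] := leP 0%R (X i j x).
    by rewrite ler_wpDl // ler_expR ler_wpM2r.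
  rewrite ler_wpDr ?expR_ge0 // -[leRHS]expR0 ler_expR.
  by rewrite mulr_ge0_le0 // ltW.
rewrite ge0_integralD //; last exact: measurable_mgf.
have -> : \int[P]_(x in [set: T]) (1 : \bar R) = 1.
  by rewrite -[RHS](@probability_setT _ _ _ P) -[RHS]mul1e -integral_cst.
by rewrite lte_add_pinfty ?ltry.
Qed.

Lemma green_expf_super q z (b v : I -> R) K : (forall i j, (0 <= q i j)%R) ->
  (forall i, (0 <= b i)%R) -> (forall i, (0 <= v i)%R) -> mgf_finite z ->
  (forall i, b i + \sum_j q i j * mgf i j z * v j <= v i)%R ->
  forall i y, green q K (expf z b) i y <= expf z v i y.
Proof.
move=> q0 b0 v0 fz bv; apply: green_supersolution => //; try exact: expf_nnmeas.
by move=> i y; rewrite kernel_op_expf // /expf -EFinD lee_fin -mulrDr ler_wpM2l ?expR_ge0.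
Qed.

(** Matrix counterpart of [green]; the two are tied by [green_expf]. *)
Fixpoint resolvent (q : I -> I -> R) (z : R) (K : nat) (b : I -> R) : I -> R :=
  if K is K'.+1 then fun i => (b i + \sum_j q i j * mgf i j z * resolvent q z K' b j)%R
  else fun _ => 0%R.

Lemma resolvent_ge0 q z K b : (forall i j, (0 <= q i j)%R) -> (forall i, (0 <= b i)%R) ->
  forall i, (0 <= resolvent q z K b i)%R.
Proof.
move=> q0 b0; elim: K => [//|K IH] i /=; rewrite addr_ge0 // sumr_ge0 // => j _.
by rewrite !mulr_ge0 ?mgf_ge0.
Qed.

Lemma green_expf q z K b : (forall i j, (0 <= q i j)%R) -> (forall i, (0 <= b i)%R) ->
  mgf_finite z -> forall i y,
  green q K (expf z b) i y = expf z (resolvent q z K b) i y.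
Proof.
move=> q0 b0 fz; elim: K => [|K IH] i y /=; first by rewrite /expf mulr0.
rewrite (_ : green q K (expf z b) = expf z (resolvent q z K b)); last first.
  by apply/funext => j; apply/funext => x; rewrite IH.
rewrite kernel_op_expf //; last by move=> j; exact: resolvent_ge0.
by rewrite /expf -EFinD mulrDr.
Qed.

Lemma iter_kernel_op_expf q z v theta K : (forall i j, (0 <= q i j)%R) ->
  (forall i, (0 <= v i)%R) -> mgf_finite z -> (0 <= theta)%R ->
  (forall i, \sum_j q i j * mgf i j z * v j <= theta * v i)%R ->
  forall f, nnmeas f -> (forall i y, f i y <= expf z v i y) ->
  forall i y, iter K (kernel_op q) f i y <= (theta ^+ K)%:E * expf z v i y.
Proof.
move=> q0 v0 fz t0 Mv f nf fv; have ni k : nnmeas (iter k (kernel_op q) f).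
  by elim: k => [//|k IH] /=; exact: kernel_op_nnmeas.
have ne := expf_nnmeas z v0.
elim: K => [|K IH] i y /=; first by rewrite expr0 mul1e.
apply: le_trans (kernel_op_mono q0 _ _ IH i y) _ => //.
  by apply: nnmeasZ => //; rewrite exprn_ge0.
rewrite kernel_opZ ?exprn_ge0 // // kernel_op_expf // /expf -!EFinM lee_fin.
by rewrite exprSr -!mulrA ler_wpM2l ?exprn_ge0 // mulrCA ler_wpM2l ?expR_ge0.
Qed.

Definition stepf : I -> R -> \bar R := fun _ y => (0 < y)%R%:R%:E.

Lemma stepf_nnmeas : nnmeas stepf.
Proof.
split; first by move=> i y; rewrite lee_fin ler0n.
move=> i; apply/measurable_EFinP.
rewrite (_ : (fun y : R => _) = \1_[set y : R | (0 < y)%R]); last first.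
  by apply/funext => y; rewrite indicE; congr (nat_of_bool _)%:R; apply/idP/idP; rewrite inE.
apply: measurable_indic; rewrite (_ : [set y | _] = `]0%R, +oo[%classic) //.
by apply/seteqP; split=> y /=; rewrite in_itv /= andbT.
Qed.

(** This profile bounds both the source created by the states without access to a basic class
    ([green_step_split]) and the defect of a truncated exponential ([single_class_lower]). *)
Definition taperf (a : R) : I -> R -> \bar R :=
  fun _ y => (expR (a * Num.min y 0))%:E.

Definition remf (a c : R) : I -> R -> \bar R :=
  fun _ y => ((y <= - c)%R%:R * expR (a * y))%:E.

Lemma taperf_nnmeas a : nnmeas (taperf a).
Proof.
split; first by move=> i y; rewrite lee_fin expR_ge0.
move=> i; apply/measurable_EFinP; apply: measurableT_comp => //.
by apply: measurable_funM => //; apply: measurable_minr.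
Qed.

Lemma remf_nnmeas a c : nnmeas (remf a c).
Proof.
split; first by move=> i y; rewrite lee_fin mulr_ge0 ?ler0n ?expR_ge0.
move=> i; apply/measurable_EFinP; apply: measurable_funM; last first.
  by apply: measurableT_comp => //; exact: measurable_funM.
rewrite (_ : (fun y : R => _) = \1_[set y : R | (y <= - c)%R]); last first.
  by apply/funext => y; rewrite indicE; congr (nat_of_bool _)%:R; apply/idP/idP; rewrite inE.
by apply: measurable_indic; rewrite (_ : [set y | _] = `]-oo, (- c)%R]%classic).
Qed.

(* The tapered source is a mixture of translated unit steps. *)
Lemma green_taperf q (z a eps C : R) (v : I -> R) K (b : nat) :
  (forall i j, (0 <= q i j)%R) -> (0 <= z)%R -> (0 < eps)%R -> (z + 2 * eps <= a)%R ->
  (0 <= C)%R -> (forall i, (1 <= v i)%R) -> mgf_finite z ->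
  (forall i, \sum_j q i j * mgf i j z * v j <= v i)%R ->
  (forall i y, green q K stepf i y <= C%:E * expf z v i y) ->
  forall i y, green q K (taperf a) i y <= green q K stepf i (y + b%:R)%R +
    ((C * expR z / (1 - expR (- eps)) + 1) * expR (- eps * b%:R))%:E * expf z v i y.
Proof.
move=> q0 z0 eps0 za C0 v1 fz Mv gC.
have v0 i : (0 <= v i)%R by apply: le_trans (v1 i).
have a0 : (0 < a)%R by lra.
set D := (C * expR z / _ + 1)%R.
have e1 : (0 < 1 - expR (- eps))%R by rewrite subr_gt0 expR_lt1 oppr_lt0.
(* D sums a geometric series of ratio exp(- eps): one peeling step in [rem_le] reproduces the bound
   D exp(- eps c). *)
have HD : (C * expR z + D * expR (- eps) <= D)%R.
  rewrite -lerBrDr (_ : D - D * expR (- eps) = D * (1 - expR (- eps)))%R; last by ring.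
  by rewrite /D mulrDl mulfVK ?gt_eqF // mul1r lerDl ltW.
have D1 : (1 <= D)%R by rewrite lerDr !mulr_ge0 ?expR_ge0 // invr_ge0 ltW.
have nr c := remf_nnmeas a c; have ns := stepf_nnmeas; have ne := expf_nnmeas z v0.
have nsh c := nnmeas_shift c ns.
(* Induction on the number k of unit intervals to peel off. Each is covered by a translated step, to
   which gC applies. Once exp(eps c) >= K, the crude bound K * expf z v suffices: of the gap 2 eps
   between z and a, one eps absorbs K and the other remains as decay. *)
have rem_le k c (Hc : (K%:R <= expR (eps * (c + k%:R)))%R) (c0 : (0 <= c)%R) :
    forall i y, green q K (remf a c) i y <= (D * expR (- eps * c))%:E * expf z v i y.
  elim: k c Hc c0 => [|k IH] c Hc c0 i y.
    have cc0 : (0 <= expR (- (a - z) * c))%R by exact: expR_ge0.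
    apply: (@le_trans _ _ (green q K (fun i y => (expR (- (a - z) * c))%:E * expf z v i y) i y)).
      apply: green_mono => //; first exact: nnmeasZ.
      move=> {}i {}y; rewrite /remf /expf -EFinM lee_fin.
      have [yc|yc] := leP y (- c)%R; last by rewrite mul0r !mulr_ge0 ?expR_ge0.
      rewrite mul1r mulrA -expRD -[leLHS]mulr1 ler_pM ?expR_ge0 // ler_expR.
      have : (0 <= (a - z) * (- c - y))%R by rewrite mulr_ge0; lra.
      by lra.
    rewrite greenZ //.
    have gK k : green q k (expf z v) i y <= k%:R%:E * expf z v i y.
      elim: k i y => [|k IH] {}i {}y /=; first by rewrite mul0e.
      rewrite -natr1 addrC EFinD ge0_muleDl ?lee_fin // mul1e leeD //.
      apply: (@le_trans _ _ (kernel_op q (fun i y => k%:R%:E * expf z v i y) i y)).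
        by apply: kernel_op_mono => //; [exact: green_nnmeas|exact: nnmeasZ].
      rewrite kernel_opZ // lee_wpmul2l ?lee_fin // kernel_op_expf // lee_fin.
      by rewrite ler_wpM2l ?expR_ge0.
    apply: le_trans (lee_wpmul2l _ (gK K)) _; first by rewrite lee_fin.
    rewrite /expf -!EFinM lee_fin [leLHS]mulrA ler_wpM2r ?mulr_ge0 ?expR_ge0 //.
    apply: (@le_trans _ _ (expR (- (a - z) * c) * expR (eps * c)))%R.
      by rewrite ler_wpM2l // (le_trans Hc) // addr0.
    rewrite -expRD -[leLHS]mul1r ler_pM ?expR_ge0 // ler_expR.
    have : (0 <= (a - z - 2 * eps) * c)%R by rewrite mulr_ge0; lra.
    lra.
  have w0 : (0 <= expR (- a * c))%R by exact: expR_ge0.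
  apply: (@le_trans _ _ (green q K (fun i y =>
      (expR (- a * c))%:E * stepf i (y + (c + 1))%R + remf a (c + 1) i y) i y)).
    apply: green_mono => //; first by apply: nnmeasD => //; exact: nnmeasZ.
    move=> {}i {}y; rewrite /stepf /remf -EFinM -EFinD lee_fin.
    have [yc|yc] := leP y (- c)%R; last first.
      by rewrite mul0r addr_ge0 ?mulr_ge0 ?ler0n ?expR_ge0.
    have [yc1|yc1] := leP y (- (c + 1))%R.
      by rewrite mul1r lerDr mulr_ge0 ?ler0n.
    rewrite (_ : (0 < y + (c + 1))%R = true) ?mul0r ?addr0 ?mulr1 ?mul1r; last first.
      by apply/idP; lra.
    by rewrite ler_expR mulNr -mulrN ler_wpM2l // ltW.
  rewrite greenD //; last exact: nnmeasZ.
  rewrite greenZ // green_shift.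
  have Hc1 : (K%:R <= expR (eps * (c + 1 + k%:R)))%R by rewrite -addrA (addrC 1%R) natr1.
  have c10 : (0 <= c + 1)%R by lra.
  apply: le_trans (leeD (lee_wpmul2l _ (gC i _)) (IH _ Hc1 c10 i y)) _; first by rewrite lee_fin.
  rewrite /expf -!EFinM -EFinD lee_fin.
  have -> : (expR (- a * c) * (C * (expR (z * (y + (c + 1))) * v i)) =
    expR (- (a - z) * c) * (C * expR z) * (expR (z * y) * v i))%R.
    rewrite !mulrDr mulr1 !expRD (_ : (- (a - z) * c = - a * c + z * c)%R); last by ring.
    by rewrite expRD; ring.
  have -> : (expR (- eps * (c + 1)) = expR (- eps * c) * expR (- eps))%R.
    by rewrite mulrDr mulr1 expRD.
  rewrite -mulrDl ler_wpM2r ?mulr_ge0 ?expR_ge0 //.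
  apply: (@le_trans _ _ (expR (- eps * c) * (C * expR z + D * expR (- eps))))%R; last first.
    by rewrite [leRHS]mulrC ler_wpM2l ?expR_ge0.
  rewrite mulrDr lerD //; last by rewrite le_eqVlt; apply/orP; left; apply/eqP; ring.
  rewrite ler_wpM2r ?mulr_ge0 ?expR_ge0 // ler_expR.
  have : (0 <= (a - z - eps) * c)%R by rewrite mulr_ge0; lra.
  lra.
move=> i y.
apply: (@le_trans _ _ (green q K (fun i y => stepf i (y + b%:R)%R + remf a b%:R i y) i y)).
  apply: green_mono => //; [exact: taperf_nnmeas|exact: nnmeasD|].
  move=> {}i {}y; rewrite /taperf /stepf /remf -EFinD lee_fin.
  have [yb|yb] := leP y (- b%:R)%R.
    rewrite mul1r ler_wpDl ?ler0n // ler_expR ler_wpM2l ?(ltW a0) // ge_min lexx //.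
  rewrite (_ : (0 < y + b%:R)%R = true); last by apply/idP; lra.
  rewrite mul0r addr0 -expR0 ler_expR.
  by rewrite mulr_ge0_le0 ?(ltW a0) // ge_min lexx orbT.
rewrite greenD // green_shift leeD //.
apply: (rem_le (Num.truncn (K%:R / eps)).+1) => //.
rewrite (@le_trans _ _ (eps * (b%:R + (Num.truncn (K%:R / eps)).+1%:R)))%R //; last first.
  by rewrite (le_trans _ (expR_ge1Dx _)) // lerDr.
rewrite mulrC -ler_pdivrMr // ler_wpDl ?ler0n // ltW //.
by have /andP[] := truncn_itv (divr_ge0 (ler0n R K) (ltW eps0)).
Qed.

End Kernel.

(** * Bounds on the Green function of the unit step *)

Section KernelBounds.
Context {d : measure_display} {T : measurableType d} {R : realType}.
Variables (P : probability T R) (I : finType) (X : I -> I -> T -> R).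
Hypothesis mX : forall i j, measurable_fun [set: T] (X i j).
Local Open Scope ereal_scope.
Implicit Types (q : I -> I -> R) (f g h : I -> R -> \bar R).
Local Notation kernel_op := (kernel_op P X).
Local Notation green := (green P X).
Local Notation mgf := (mgf P X).
Local Notation mgf_finite := (mgf_finite P X).
Local Notation resolvent := (resolvent P X).

Lemma mgf0 i j : mgf i j 0%R = 1%R.
Proof.
rewrite [LHS](_ : _ = fine (\int[P]_x (expR (0 * X i j x)%R)%:E)) //;
  under eq_integral do rewrite mul0r expR0.
by rewrite (integral_cst P measurableT) mul1e [X in fine X](@probability_setT _ _ _ P).
Qed.

Lemma mgf_finite0 : mgf_finite 0%R.
Proof.
move=> i j; under eq_integral do rewrite mul0r expR0.
by rewrite (integral_cst P measurableT) mul1e [X in X < _](@probability_setT _ _ _ P) ltry.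
Qed.

(** The minimum of [expf z v] and [kap] is a supersolution. For y > 0 it equals [kap], as kap <= v,
    and the inequality on [kap] has room for the unit source; for y <= 0 there is no source, and
    both functions are preserved. *)
Lemma green_step_bound q (z : R) (kap v : I -> R) K : (forall i j, (0 <= q i j)%R) ->
  (0 <= z)%R -> (forall i, (0 <= kap i <= v i)%R) -> mgf_finite z ->
  (forall i, 1 + \sum_j q i j * kap j <= kap i)%R ->
  (forall i, \sum_j q i j * mgf i j z * v j <= v i)%R ->
  forall i y, green q K (@stepf R I) i y <= expf z v i y.
Proof.
move=> q0 z0 kv fz Hk Hv.
have k0 i : (0 <= kap i)%R by case/andP: (kv i).
have v0 i : (0 <= v i)%R by case/andP: (kv i); apply: le_trans.
have ne := expf_nnmeas z v0; have nk := expf_nnmeas 0%R k0.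
pose h (i : I) (y : R) := (Num.min (expR (z * y) * v i) (kap i))%:E.
have nh : nnmeas h.
  split; first by move=> i y; rewrite lee_fin le_min mulr_ge0 ?expR_ge0 ?k0.
  move=> i; apply/measurable_EFinP; apply: measurable_minr => //.
  apply: measurable_funM => //; apply: measurableT_comp => //; exact: measurable_funM.
have hle1 i y : h i y <= expf z v i y by rewrite lee_fin ge_min lexx.
have hle2 i y : h i y <= expf 0 kap i y.
  by rewrite lee_fin mul0r expR0 mul1r ge_min lexx orbT.
have oh1 i y : kernel_op q h i y <= expf z v i y.
  apply: le_trans (kernel_op_mono P mX q0 nh ne hle1 i y) _.
  by rewrite kernel_op_expf // lee_fin ler_wpM2l ?expR_ge0.
have oh2 i y : kernel_op q h i y <= (kap i - 1)%:E.
  apply: le_trans (kernel_op_mono P mX q0 nh nk hle2 i y) _.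
  rewrite kernel_op_expf //; last exact: mgf_finite0.
  rewrite lee_fin mul0r expR0 mul1r.
  under eq_bigr do rewrite mgf0 mulr1.
  by rewrite lerBrDl.
move=> i y; apply: le_trans (hle1 i y).
apply: (green_supersolution mX) => //; first exact: stepf_nnmeas.
move=> {}i {}y; rewrite /stepf [h i y]/h.
have [y0|y0] := ltP 0%R y.
  rewrite min_r; first by apply: le_trans (leeD (lexx _) (oh2 i y)) _;
    rewrite -EFinD lee_fin mulr1n addrC subrK.
  have /andP[_ kvi] := kv i; apply: (le_trans kvi).
  by rewrite ler_peMl // -expR0 ler_expR mulr_ge0 // ltW.
rewrite add0e EFin_min le_min oh1 (le_trans (oh2 i y)) //.
by rewrite lee_fin lerBlDr lerDl.
Qed.

Definition qrestrict (S : pred I) q : I -> I -> R :=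
  fun i j => ((S i && S j)%:R * q i j)%R.

Lemma qrestrict_ge0 (S : pred I) q : (forall i j, (0 <= q i j)%R) ->
  forall i j, (0 <= qrestrict S q i j)%R.
Proof. by move=> q0 i j; rewrite mulr_ge0 ?ler0n. Qed.

Lemma qrestrict_le (S : pred I) q : (forall i j, (0 <= q i j)%R) ->
  forall i j, (0 <= qrestrict S q i j <= q i j)%R.
Proof.
move=> q0 i j; rewrite qrestrict_ge0 //= /qrestrict.
by case: (_ && _); rewrite ?mul1r ?mul0r.
Qed.

Lemma sum_qrestrict (S : pred I) q (x : I -> R) i : S i ->
  (\sum_j qrestrict S q i j * x j = \sum_(j | S j) q i j * x j)%R.
Proof.
move=> Si; rewrite [RHS]big_mkcond; apply: eq_bigr => j _; rewrite /qrestrict Si /=.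
by case: (S j); rewrite ?mul1r ?mul0r.
Qed.

Lemma sum_qrestrictN (S : pred I) q (x : I -> R) i : ~~ S i ->
  (\sum_j qrestrict S q i j * x j = 0)%R.
Proof. by move=> /negbTE Si; apply: big1 => j _; rewrite /qrestrict Si !mul0r. Qed.

(* The states outside S form a closed set on which the source decays faster. *)
Lemma green_step_split q (S : pred I) (a : R) (kap v : I -> R) :
  (forall i j, (0 <= q i j)%R) -> (0 <= a)%R -> mgf_finite a ->
  (forall i j, ~~ S i -> S j -> q i j = 0%R) ->
  (forall i, (0 <= kap i)%R) -> (forall i, 1 + \sum_j q i j * kap j <= kap i)%R ->
  (forall i, (0 <= v i)%R) ->
  (forall i, ~~ S i -> 1 + \sum_(j | ~~ S j) q i j * mgf i j a * v j <= v i)%R ->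
  exists C, [/\ (0 <= C)%R,
    forall K i y, ~~ S i -> green q K (@stepf R I) i y <= C%:E * @taperf R I a i y &
    forall K i y, S i -> green q K (@stepf R I) i y <=
      C%:E * green (qrestrict S q) K (@taperf R I a) i y].
Proof.
move=> q0 a0 fa closed k0 Hk v0 Hv.
have ns := @stepf_nnmeas R I; have nt := @taperf_nnmeas R I a.
have nk := expf_nnmeas 0%R k0.
have taper1 i y : @taperf R I a i y <= expf 0%R (fun=> 1%R) i y.
  rewrite lee_fin mul0r expR0 mul1r -expR0 ler_expR.
  by rewrite mulr_ge0_le0 // ge_min lexx orbT.
have tapera i y : @taperf R I a i y <= expf a (fun=> 1%R) i y.
  by rewrite lee_fin mulr1 ler_expR ler_wpM2l // ge_min lexx.
have taperE i y (C : R) : (0 <= C)%R -> forall x, x <= C%:E ->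
    x <= (C * expR (a * y))%:E -> x <= C%:E * @taperf R I a i y.
  move=> C0 x x1 x2; rewrite /taperf -EFinM.
  by case: (leP y 0%R) => _; rewrite ?mulr0 ?expR0 ?mulr1.
pose C1 := (\sum_i (kap i + v i))%R.
have C10 : (0 <= C1)%R by apply: sumr_ge0 => i _; rewrite addr_ge0.
have kC i : (kap i <= C1)%R.
  rewrite /C1 (bigD1 i) //= -addrA lerDl addr_ge0 // sumr_ge0 // => j _.
  by rewrite addr_ge0.
have vC i : (v i <= C1)%R.
  rewrite /C1 (bigD1 i) //= addrAC addrC lerDl addr_ge0 // sumr_ge0 // => j _.
  by rewrite addr_ge0.
have gk K i y : green q K (@stepf R I) i y <= (kap i)%:E.
  have := @green_expf_super _ _ _ P I X mX q 0%R (fun=> 1%R) kap K q0 _ k0 mgf_finite0 _ i y.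
  rewrite /expf mul0r expR0 mul1r => H; apply: le_trans (H _ _); last 2 first.
  - by [].
  - by move=> j; apply: le_trans (Hk j); rewrite lerD2l; apply: ler_sum => l _; rewrite mgf0 mulr1.
  apply: (green_mono P mX) => //; first exact: (@expf_nnmeas R I 0%R (fun=> 1%R)).
  by move=> j x; rewrite lee_fin mul0r expR0 mul1r; case: (0 < x)%R.
have D0 K i y : ~~ S i -> green q K (@stepf R I) i y <= C1%:E * @taperf R I a i y.
  move=> Si; apply: taperE => //.
    by apply: le_trans (gk K i y) _; rewrite lee_fin.
  pose v' j := if S j then 0%R else v j.
  have v'0 j : (0 <= v' j)%R by rewrite /v'; case: (S j).
  (* No transition leads from outside S into S, so the kernel may be restricted to the complement of
     S, where [v] is a supersolution at rate a. *)
  have E : forall K j x, ~~ S j -> green q K (@stepf R I) j x =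
      green (qrestrict (predC S) q) K (@stepf R I) j x.
    elim=> [//|L IH] j x Sj /=; congr (_ + _); apply: eq_bigr => l _.
    rewrite /qrestrict /= Sj /=; case: (boolP (S l)) => Sl /=.
      by rewrite closed // mul0r !mul0e.
    rewrite mul1r; congr (_ * _); apply: eq_integral => t _; exact: IH.
  rewrite E //.
  have b0 j : (0 <= (~~ S j)%:R :> R)%R by rewrite ler0n.
  have n1 := @expf_nnmeas R I a (fun=> 1%R) (fun=> ler01).
  apply: (@le_trans _ _ (expf a (fun j => if S j then 1%R else v j) i y)); last first.
    by rewrite /expf (negbTE Si) lee_fin mulrC ler_wpM2r ?expR_ge0.
  apply: (@le_trans _ _ (green (qrestrict (predC S) q) K (expf a (fun=> 1%R)) i y)).
    apply: (green_mono P mX) => //; first exact: qrestrict_ge0.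
    move=> j x; rewrite lee_fin mulr1; case: (ltP 0%R x) => x0; last exact: expR_ge0.
    by rewrite -expR0 ler_expR mulr_ge0 // ltW.
  apply: (green_expf_super mX) => //; first exact: qrestrict_ge0.
    by move=> j; case: (S j).
  move=> j; case: (boolP (S j)) => Sj.
    by under eq_bigr do rewrite -mulrA; rewrite sum_qrestrictN /= ?addr0 ?negbK.
  under eq_bigr do rewrite -mulrA.
  rewrite sum_qrestrict //; apply: le_trans (Hv j Sj); rewrite lerD2l.
  by apply: ler_sum => l /negbTE /= ->; rewrite mulrA.
pose C2 := (\sum_i \sum_j q i j * (1 + mgf i j a))%R.
have qm0 i j : (0 <= q i j * (1 + mgf i j a))%R by rewrite mulr_ge0 // addr_ge0 ?mgf_ge0.
have C20 : (0 <= C2)%R by apply: sumr_ge0 => i _; apply: sumr_ge0.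
have C2i i : (\sum_j q i j * (1 + mgf i j a) <= C2)%R.
  rewrite /C2 [leRHS](bigD1 i) //= lerDl; apply: sumr_ge0 => j _; exact: sumr_ge0.
have opt i y : kernel_op q (@taperf R I a) i y <= C2%:E * @taperf R I a i y.
  have le01 : forall i : I, (0 <= 1 :> R)%R by [].
  apply: taperE => //.
    apply: le_trans (kernel_op_mono P mX q0 nt (expf_nnmeas 0%R le01) taper1 i y) _.
    rewrite kernel_op_expf //; last exact: mgf_finite0.
    rewrite lee_fin mul0r expR0 mul1r; apply: le_trans (C2i i); apply: ler_sum => j _.
    by rewrite mgf0 mulr1 ler_wpM2l // lerDl mgf_ge0.
  apply: le_trans (kernel_op_mono P mX q0 nt (expf_nnmeas a le01) tapera i y) _.
  rewrite kernel_op_expf // lee_fin mulrC ler_wpM2r ?expR_ge0 //.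
  apply: le_trans (C2i i); apply: ler_sum => j _.
  by rewrite mulr1 ler_wpM2l // lerDr.
(* Large enough for the unit source, which is below the taper, plus the contribution C1 * C2 of a
   transition out of S; it also exceeds C1. *)
pose C := (1 + C1 + C1 * C2)%R.
have C0 : (0 <= C)%R by rewrite !addr_ge0 ?mulr_ge0.
have tle i y : 0 <= @taperf R I a i y by exact: nt.1.
exists C; split=> //.
  move=> K i y Si; apply: le_trans (D0 K i y Si) _; rewrite lee_wpmul2r // lee_fin.
  by rewrite /C -addrA addrCA lerDl addr_ge0 ?mulr_ge0.
have r0 := qrestrict_ge0 S q0.
pose w K : I -> R -> \bar R := fun i y => if S i then C%:E * green (qrestrict S q) K (@taperf R I
  a) i y
  else C1%:E * @taperf R I a i y.
suff H L j x : green q L (@stepf R I) j x <= w L j x.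
  by move=> K i y Si; have := H K i y; rewrite /w Si.
move: L j x.
have ngr K : nnmeas (green (qrestrict S q) K (@taperf R I a)) by exact: green_nnmeas.
have nw L : nnmeas (w L).
  split; first by move=> j x; rewrite /w; case: (S j);
    [exact: (nnmeasZ C0 (ngr L)).1|exact: (nnmeasZ C10 nt).1].
  by move=> j; rewrite /w; case: (S j); [exact: (nnmeasZ C0 (ngr L)).2|exact: (nnmeasZ C10 nt).2].
elim=> [|K IH] i y; first exact: (nw 0%N).1.
rewrite [w K.+1 i y]/w; case: (boolP (S i)) => Si; last exact: D0.
apply: (@le_trans _ _ (stepf i y + kernel_op q (w K) i y)).
  by rewrite leeD // (kernel_op_mono P mX) //; exact: green_nnmeas.
apply: (@le_trans _ _ (stepf i y + (kernel_op (qrestrict S q) (fun i y =>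
  C%:E * green (qrestrict S q) K (@taperf R I a) i y) i y +
   kernel_op q (fun i y => C1%:E * @taperf R I a i y) i y))).
  rewrite leeD // -[leRHS]big_split /=; apply: lee_sum => j _.
  rewrite /w; case: (boolP (S j)) => Sj.
    rewrite /qrestrict Si Sj mul1r leeDl // mule_ge0 ?lee_fin // integral_ge0 // => x _.
    exact: (nnmeasZ C10 nt).1.
  by rewrite /qrestrict (negbTE Sj) andbF mul0r mul0e add0e.
rewrite (kernel_opZ P mX) // (kernel_opZ P mX) // addeCA.
rewrite /= ge0_muleDr; [|exact: nt.1|exact: (kernel_op_nnmeas P mX r0 (ngr K)).1].
rewrite addeC leeD //.
apply: (@le_trans _ _ (@taperf R I a i y + C1%:E * (C2%:E * @taperf R I a i y))).
  rewrite leeD //; last by rewrite lee_wpmul2l ?lee_fin.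
  rewrite lee_fin; case: (ltP 0%R y) => y0; last exact: expR_ge0.
  by rewrite mulr0 expR0.
rewrite /taperf -!EFinM -EFinD lee_fin mulrA -[X in (X + _ <= _)%R]mul1r -mulrDl.
by rewrite ler_wpM2r ?expR_ge0 // lerD2r lerDl.
Qed.

End KernelBounds.

(** * Convexity and regularity of the Laplace transforms *)

Section MgfBounds.
Context {d : measure_display} {T : measurableType d} {R : realType}.
Variables (P : probability T R) (I : finType) (X : I -> I -> T -> R).
Hypothesis mX : forall i j, measurable_fun [set: T] (X i j).
Local Notation mgf := (mgf P X).
Local Notation mgf_finite := (mgf_finite P X).

Lemma expR_convex (t a b : R) : 0 <= t <= 1 ->
  expR ((1 - t) * a + t * b) <= (1 - t) * expR a + t * expR b.
Proof.
move=> /andP[t0 t1]; set m := _ + _.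
have Ha : expR m * (1 + (a - m)) <= expR a.
  have -> : expR a = expR m * expR (a - m) by rewrite -expRD addrC subrK.
  by rewrite ler_wpM2l ?expR_ge0 // expR_ge1Dx.
have Hb : expR m * (1 + (b - m)) <= expR b.
  have -> : expR b = expR m * expR (b - m) by rewrite -expRD addrC subrK.
  by rewrite ler_wpM2l ?expR_ge0 // expR_ge1Dx.
apply: (@le_trans _ _ ((1 - t) * (expR m * (1 + (a - m))) + t * (expR m * (1 + (b - m))))).
  have E : (1 - t) * (a - m) + t * (b - m) = 0 by rewrite /m; ring.
  rewrite [leRHS](_ : _ = expR m * (1 + ((1 - t) * (a - m) + t * (b - m)))).
    by rewrite E addr0 mulr1.
  by move: (expR m) => e; ring.
by rewrite lerD // ler_wpM2l // subr_ge0.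
Qed.

Lemma mgf_le (a b c x y z : R) i j : 0 <= a -> 0 <= b -> 0 <= c ->
  mgf_finite x -> mgf_finite y -> mgf_finite z ->
  (forall s, a * expR (x * s) <= b * expR (y * s) + c * expR (z * s)) ->
  a * mgf i j x <= b * mgf i j y + c * mgf i j z.
Proof.
move=> a0 b0 c0 fx fy fz H.
have I0 w : forall t, [set: T] t -> (0 <= (expR (w * X i j t))%:E)%E.
  by move=> t _; rewrite lee_fin expR_ge0.
have Z k w : 0 <= k -> mgf_finite w ->
    (\int[P]_t (k%:E * (expR (w * X i j t))%:E) = (k * mgf i j w)%:E)%E.
  move=> k0 fw; rewrite ge0_integralZl_EFin //; last exact: measurable_mgf.
  by rewrite mgfE.
have mZ k w : measurable_fun [set: T] (fun t => k%:E * (expR (w * X i j t))%:E)%E.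
  by apply: measurable_funeM; exact: measurable_mgf.
have Z0 k w : 0 <= k -> forall t, [set: T] t -> (0 <= k%:E * (expR (w * X i j t))%:E)%E.
  by move=> k0 t _; rewrite -EFinM lee_fin mulr_ge0 ?expR_ge0.
rewrite -lee_fin EFinD -!Z // -ge0_integralD //; try exact: Z0.
apply: ge0_le_integral => //; first exact: Z0.
  by apply: emeasurable_funD.
by move=> t _; rewrite -!EFinM -EFinD lee_fin.
Qed.

(** Convexity of exp between u and v + al s, integrated in s. The free parameters u and v receive
    logarithms of ratios of vectors in [interp_super], which takes the place of a Hoelder
    inequality. *)
Lemma mgf_interpolation (al t u v : R) i j : 0 <= t <= 1 -> mgf_finite (t * al) ->
  mgf_finite al ->
  expR ((1 - t) * u + t * v) * mgf i j (t * al) <=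
    (1 - t) * expR u + t * expR v * mgf i j al.
Proof.
move=> t01 f1 f2; have /andP[t0 t1] := t01.
have -> : (1 - t) * expR u = (1 - t) * expR u * mgf i j 0 by rewrite mgf0 mulr1.
apply: mgf_le; rewrite ?mulr_ge0 ?expR_ge0 ?subr_ge0 //; first exact: mgf_finite0.
move=> s; rewrite mul0r expR0 mulr1 -expRD -(mulrA t (expR v)) -expRD.
rewrite (_ : _ + t * al * s = (1 - t) * u + t * (v + al * s)); last by ring.
exact: expR_convex.
Qed.

Lemma mgf_le1D (al z : R) i j : 0 <= z <= al -> mgf_finite al ->
  mgf i j z <= 1 + mgf i j al.
Proof.
move=> z01 fal; rewrite -[mgf i j z]mul1r -[X in _ <= X + _](mgf0 P X i j) -[mgf i j 0]mul1r -[mgf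
  i j al]mul1r.
apply: mgf_le => //; [exact: (mgf_finite_le mX z01)|exact: mgf_finite0|].
move=> s; rewrite mul0r expR0 mul1r mulr1 mul1r.
have /andP[z0 zal] := z01.
have [s0|s0] := leP 0 s.
  by rewrite ler_wpDl // ler_expR ler_wpM2r.
by rewrite ler_wpDr ?expR_ge0 // -[leRHS]expR0 ler_expR mulr_ge0_le0 // ltW.
Qed.

(** The loss s x exp(al x) of the tangent inequality is bounded by s / (a - al) * exp(a x), again by
    a tangent inequality. A finite transform beyond al thus gives a Lipschitz bound at al. *)
Lemma mgf_left_lower (al a s : R) i j : 0 <= al - s -> 0 <= s -> al < a -> mgf_finite a ->
  mgf i j al <= mgf i j (al - s) + s / (a - al) * mgf i j a.
Proof.
move=> als s0 ala fa; have aal : 0 < a - al by rewrite subr_gt0.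
rewrite -[mgf i j al]mul1r -[mgf i j (al - s)]mul1r.
apply: mgf_le; rewrite ?divr_ge0 ?(ltW aal) //.
- by apply: (mgf_finite_le mX) fa; apply/andP; split; lra.
- by apply: (mgf_finite_le mX) fa; apply/andP; split; lra.
move=> x; rewrite !mul1r.
have E1 : expR (al * x) * (1 + (- (s * x))) <= expR ((al - s) * x).
  by rewrite mulrBl expRD ler_wpM2l ?expR_ge0 // expR_ge1Dx.
have E2 : expR (al * x) * (1 + (a - al) * x) <= expR (a * x).
  rewrite (_ : a * x = al * x + (a - al) * x); last by ring.
  by rewrite expRD ler_wpM2l ?expR_ge0 // expR_ge1Dx.
have E3 : expR (al * x) * (s * x) <= s / (a - al) * expR (a * x).
  apply: (@le_trans _ _ (s / (a - al) * (expR (al * x) * (1 + (a - al) * x)))).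
    rewrite (_ : s / (a - al) * (expR (al * x) * (1 + (a - al) * x)) =
      s / (a - al) * expR (al * x) + expR (al * x) * (s * x) * ((a - al) / (a - al)))%R;
        last by ring.
    by rewrite divff ?gt_eqF // mulr1 lerDr mulr_ge0 ?expR_ge0 ?divr_ge0 // ltW.
  by rewrite ler_wpM2l // divr_ge0 // ltW.
move: E1; rewrite mulrDr mulr1 mulrN; lra.
Qed.

Lemma mgf_right_upper (al a t : R) i j : 0 <= t <= 1 -> 0 <= al -> al <= a -> mgf_finite a ->
  mgf i j (al + t * (a - al)) <= (1 - t) * mgf i j al + t * mgf i j a.
Proof.
move=> t01 al0 ala fa; have /andP[t0 t1] := t01.
have ta : 0 <= t * (a - al) by rewrite mulr_ge0 // subr_ge0.
have ta2 : t * (a - al) <= a - al by rewrite ler_piMl // subr_ge0.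
rewrite -[leLHS]mul1r; apply: mgf_le; rewrite ?subr_ge0 //.
- by apply: (mgf_finite_le mX) fa; apply/andP; split; lra.
- by apply: (mgf_finite_le mX) fa; apply/andP; split; lra.
move=> s; rewrite mul1r (_ : (al + t * (a - al)) * s = (1 - t) * (al * s) + t * (a * s)).
  exact: expR_convex.
by ring.
Qed.

End MgfBounds.

(** * Lower bound on a basic class *)

Section SingleClass.
Context {d : measure_display} {T : measurableType d} {R : realType}.
Variables (P : probability T R) (I : finType) (X : I -> I -> T -> R).
Hypothesis mX : forall i j, measurable_fun [set: T] (X i j).
Local Open Scope ereal_scope.
Implicit Types (q : I -> I -> R) (f g h u : I -> R -> \bar R).
Local Notation kernel_op := (kernel_op P X).
Local Notation green := (green P X).
Local Notation mgf := (mgf P X).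
Local Notation mgf_finite := (mgf_finite P X).

Definition leftexpf (z : R) (v : I -> R) : I -> R -> \bar R :=
  fun i y => ((y <= 0)%R%:R * expR (z * y) * v i)%:E.

Lemma leftexpf_nnmeas z v : (forall i, (0 <= v i)%R) -> nnmeas (leftexpf z v).
Proof.
move=> v0; split.
  by move=> i y; rewrite lee_fin !mulr_ge0 ?expR_ge0 ?ler0n.
move=> i; apply/measurable_EFinP; apply: measurable_funM => //.
have [_ /(_ i)/measurable_EFinP] := @remf_nnmeas R I z 0%R.
by apply: eq_measurable_fun => y _; rewrite oppr0.
Qed.

Lemma lee_geometric (x A : \bar R) (B th : R) : (0 <= th < 1)%R ->
  (forall K, x <= A + (th ^+ K * B)%:E) -> x <= A.
Proof.
move=> /andP[th0 th1] H; case: A H => [A| |] H; rewrite ?leey //; last first.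
  by have := H 0%N; rewrite addNye leeNy_eq => /eqP ->.
case: x H => [x| |] H; last by rewrite leNye.
  rewrite lee_fin; apply/ler_addgt0Pr => e e0.
  have : (fun K => th ^+ K * B)%R @ \oo --> (0 * B)%R.
    by apply: cvgMl; apply: cvg_expr; rewrite ger0_norm.
  rewrite mul0r => /cvgrPdist_lt /(_ e e0) [K _ /(_ K (leqnn K))] /=.
  rewrite sub0r normrN => HK; have := H K; rewrite -EFinD lee_fin => /le_trans; apply.
  by rewrite lerD2l (le_trans (ler_norm _)) // ltW.
by have := H 0%N; rewrite -EFinD leye_eq.
Qed.

(** Let f be exp(al y) r truncated to S and y <= 0. By [green_step], f is at most its K-th iterate
    plus C0 times the Green function of the taper. The iterate vanishes as K grows: exp(al y) <=
    exp(al y / 2) for y <= 0, and the kernel contracts at al / 2. By [green_taperf] the other term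
    is at most C0 u at a point shifted by b plus half of exp(al y) r. *)
Lemma single_class_lower q (S : pred I) (al a eps th : R) (kap r v : I -> R) :
  (forall i j, (0 <= q i j)%R) -> (0 < al)%R -> (0 < eps)%R -> (al + 2 * eps <= a)%R ->
  mgf_finite a ->
  (forall i, (0 <= kap i)%R) -> (forall i, 1 + \sum_j q i j * kap j <= kap i)%R ->
  (forall i, (0 < r i)%R) -> (forall i, S i -> \sum_(j | S j) q i j * mgf i j al * r j = r i)%R ->
  (0 <= th < 1)%R -> (forall i, (0 < v i)%R) ->
  (forall i, S i -> \sum_(j | S j) q i j * mgf i j (al / 2) * v j <= th * v i)%R ->
  exists c, (0 < c)%R /\ forall u, nnmeas u ->
    (forall i y, stepf i y + kernel_op q u i y <= u i y) ->
    forall i y, S i -> (y <= 0)%R -> (c * expR (al * y))%:E <= u i y.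
Proof.
move=> q0 al0 eps0 ala fa k0 Hk r0 Hr th01 v0 Hv.
have /andP[th0 th1] := th01.
pose qS := qrestrict S q; have qS0 : forall i j, (0 <= qS i j)%R.
  by move=> i j; rewrite /qS qrestrict_ge0.
have fal : mgf_finite al by apply: (mgf_finite_le mX) fa; apply/andP; split; lra.
have fal2 : mgf_finite (al / 2)%R by apply: (mgf_finite_le mX) fa; apply/andP; split; lra.
have ns := @stepf_nnmeas R I; have nt := @taperf_nnmeas R I a.
pose C0 := (1 + \sum_i (kap i + (r i)^-1 + r i * (v i)^-1 + \sum_j q i j * mgf i j a * r j))%R.
have pos1 i : (0 <= kap i + (r i)^-1 + r i * (v i)^-1 + \sum_j q i j * mgf i j a * r j)%R.
  rewrite !addr_ge0 ?mulr_ge0 ?invr_ge0 ?(ltW (r0 _)) ?(ltW (v0 _)) //.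
  by apply: sumr_ge0 => j _; rewrite !mulr_ge0 ?mgf_ge0 // ltW.
have C01 : (1 <= C0)%R by rewrite lerDl sumr_ge0.
have C0i i : (kap i + (r i)^-1 + r i * (v i)^-1 + \sum_j q i j * mgf i j a * r j <= C0)%R.
  by rewrite /C0 [in leRHS](bigD1 i) //= [leRHS]addrCA lerDl addr_ge0 // sumr_ge0.
have ri i : (0 <= (r i)^-1)%R by rewrite invr_ge0 ltW.
have rvi i : (0 <= r i * (v i)^-1)%R by rewrite mulr_ge0 ?invr_ge0 // ltW.
have qri i : (0 <= \sum_j q i j * mgf i j a * r j)%R.
  by apply: sumr_ge0 => j _; rewrite !mulr_ge0 ?mgf_ge0 // ltW.
have C0pos : (0 < C0)%R by lra.
have kC i : (kap i <= C0)%R by have := C0i i; have := ri i; have := rvi i; have := qri i; lra.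
have rC i : (1 <= C0 * r i)%R.
  rewrite -ler_pdivrMr // mul1r.
  by have := C0i i; have := k0 i; have := rvi i; have := qri i; lra.
have rvC i : (r i <= C0 * v i)%R.
  rewrite -ler_pdivrMr //.
  by have := C0i i; have := k0 i; have := ri i; have := qri i; lra.
have qrC i : (\sum_j q i j * mgf i j a * r j <= C0)%R.
  by have := C0i i; have := k0 i; have := rvi i; have := ri i; lra.
have r0' i : (0 <= r i)%R by exact: ltW.
have v0' i : (0 <= v i)%R by exact: ltW.
pose f := leftexpf al (fun i => (S i)%:R * r i)%R.
have Sr0 i : (0 <= (S i)%:R * r i)%R by rewrite mulr_ge0 ?ler0n.
have nf : nnmeas f by exact: leftexpf_nnmeas.
have nct : nnmeas (fun i y => C0%:E * @taperf R I a i y) by apply: nnmeasZ => //; exact: ltW.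
have sumS (w : I -> R) i z : S i -> (\sum_j qS i j * mgf i j z * w j =
    \sum_(j | S j) q i j * mgf i j z * w j)%R.
  move=> Si; under eq_bigr do rewrite -mulrA; rewrite sum_qrestrict //.
  by under eq_bigr do rewrite mulrA.
have sumSN (w : I -> R) i z : ~~ S i -> (\sum_j qS i j * mgf i j z * w j = 0)%R.
  by move=> Si; under eq_bigr do rewrite -mulrA; rewrite sum_qrestrictN.
(* The untruncated exponential is reproduced exactly. Truncation loses the landing points x > 0,
   where exp(al x) <= exp(a x), hence a defect of order exp(a y). *)
have fstep i y : f i y <= kernel_op qS f i y + C0%:E * @taperf R I a i y.
  have kf0 : 0 <= kernel_op qS f i y by exact: (kernel_op_nnmeas P mX qS0 nf).1.
  have ct0 : 0 <= C0%:E * @taperf R I a i y by exact: nct.1.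
  rewrite {1}/f /leftexpf; case: (boolP (S i)) => Si; last by rewrite mul0r mulr0 adde_ge0.
  case: (leP y 0%R) => y0; last by rewrite !mul0r adde_ge0.
  rewrite !mul1r.
  have nfa : nnmeas (expf a (fun i => (S i)%:R * r i)%R) by exact: expf_nnmeas.
  apply: (@le_trans _ _ (kernel_op qS (fun i y => f i y + expf a (fun i =>
    (S i)%:R * r i)%R i y) i y)).
    apply: (@le_trans _ _ (kernel_op qS (expf al (fun i => (S i)%:R * r i)%R) i y)).
      rewrite kernel_op_expf // lee_fin ler_wpM2l ?expR_ge0 // sumS // -[leLHS]Hr //.
      by apply: ler_sum => j Sj; rewrite Sj mul1r.
    apply: (kernel_op_mono P mX) => //; [exact: expf_nnmeas|exact: nnmeasD|].
    move=> j x; rewrite /f /leftexpf /expf -EFinD lee_fin -mulrDl ler_wpM2r //.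
    case: (leP x 0%R) => x0; first by rewrite mul1r lerDl expR_ge0.
    by rewrite mul0r add0r ler_expR ler_wpM2r ?(ltW x0) //; lra.
  rewrite (kernel_opD P mX) // leeD // kernel_op_expf // /taperf -EFinM lee_fin.
  rewrite min_l // mulrC ler_wpM2r ?expR_ge0 // sumS // (le_trans _ (qrC i)) //.
  rewrite [leRHS](bigID S) /= ler_wpDr //.
    by apply: sumr_ge0 => j _; rewrite !mulr_ge0 ?mgf_ge0.
  by apply: ler_sum => j Sj; rewrite Sj mul1r.
(* A multiple of [r], hence still invariant, that exceeds both [kap] and 1, as [green_step_bound]
   and [green_taperf] require. *)
pose w i := (C0 * (1 + C0) * r i)%R.
have wmul z i : (\sum_j qS i j * mgf i j z * w j = C0 * (1 + C0) * \sum_j qS i j * mgf i j z * r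
  j)%R.
  by rewrite mulr_sumr; apply: eq_bigr => j _; rewrite /w; ring.
have CC : (0 < C0 * (1 + C0))%R by rewrite mulr_gt0 // addr_gt0.
have wge i : (1 + C0 <= w i)%R.
  rewrite /w mulrAC -[leLHS]mul1r ler_wpM2r //; lra.
have Hw i : (\sum_j qS i j * mgf i j al * w j <= w i)%R.
  rewrite wmul /w ler_wpM2l ?(ltW CC) //.
  by case: (boolP (S i)) => Si; [rewrite sumS // Hr|rewrite sumSN].
have gw K i y : green qS K (@stepf R I) i y <= 1%:E * expf al w i y.
  rewrite mul1e; apply: (green_step_bound mX (kap := kap)) => //; first exact: ltW.
    move=> j; rewrite k0 /=; have := kC j; have := wge j; lra.
  move=> j; apply: le_trans (Hk j); rewrite lerD2l; apply: ler_sum => l _.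
  by rewrite ler_wpM2r //; case/andP: (qrestrict_le S q0 j l).
have al0' : (0 <= al)%R by exact: ltW.
have w1 i : (1 <= w i)%R by have := wge i; lra.
have taper K b i y := @green_taperf _ _ _ P I X mX qS al a eps 1 w K b qS0 al0' eps0 ala ler01 w1
  fal Hw (gw K) i y.
set D := (1 * expR al / (1 - expR (- eps)) + 1)%R in taper.
have D0 : (0 <= D)%R.
  rewrite addr_ge0 // divr_ge0 ?mulr_ge0 ?expR_ge0 // subr_ge0 -expR0 ler_expR.
  by rewrite oppr_le0 ltW.
(* b is large enough for the contribution of y <= - b to be at most half. *)
have [b Hb] : exists b : nat, (C0 * (D * expR (- eps * b%:R) * (C0 * (1 + C0))) <= 2^-1)%R.
  have : (fun b : nat => expR (- eps) ^+ b * (C0 * D * (C0 * (1 + C0))))%R @ \oo --> (0 * (C0 * D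
    * (C0 * (1 + C0))))%R.
    by apply: cvgMl; apply: cvg_expr; rewrite ger0_norm ?expR_ge0 // expR_lt1 oppr_lt0.
  have half0 : (0 < 2^-1 :> R)%R by rewrite invr_gt0.
  rewrite mul0r => /cvgrPdist_lt /(_ _ half0)[b _ /(_ b (leqnn b))] /=.
  rewrite sub0r normrN => Hb; exists b; apply: le_trans (ltW Hb).
  rewrite (le_trans _ (ler_norm _)) // -expRM_natr.
  by rewrite le_eqVlt; apply/orP; left; apply/eqP; ring.
(* The exponential undoes the shift by b, 2 * C0 is the factor in [key], and the last C0 comes from
   r i >= 1 / C0. *)
pose c := (expR (- (al * b%:R)) / (2 * C0 * C0))%R.
have c0 : (0 < c)%R by rewrite divr_gt0 ?expR_gt0 // !mulr_gt0.
exists c; split=> // u nu Hu.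
have gu K i y : green qS K (@stepf R I) i y <= u i y.
  apply: (green_supersolution mX) => // {}i {}y; apply: le_trans (Hu i y); rewrite leeD //.
  by apply: (kernel_op_le P mX) => // j l; exact: qrestrict_le.
have key i y : S i -> (y <= 0)%R -> (expR (al * y) * r i)%:E <= 2%:E * (C0%:E * u i (y + b%:R)%R).
  move=> Si y0.
  have H1 : (expR (al * y) * r i)%:E <= C0%:E * u i (y + b%:R)%R + (2^-1 * (expR (al * y) * r
    i))%:E.
    apply: (@lee_geometric _ _ (expR (al / 2 * y) * (C0 * v i))%R th) => // K.
    have := green_step mX K qS0 nf nct fstep i y.
    rewrite {1}/f /leftexpf Si y0 !mul1r => /le_trans; apply.
    rewrite addeC leeD //.
      rewrite (greenZ P mX) //; last exact: ltW.
      apply: le_trans (lee_wpmul2l _ (taper K b i y)) _; first by rewrite lee_fin ltW.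
      rewrite ge0_muleDr; [|exact: (green_nnmeas P mX K qS0 ns).1|]; last first.
        have wi0 := le_trans ler01 (w1 i).
        by rewrite /expf -EFinM lee_fin mulr_ge0 // mulr_ge0 ?expR_ge0.
      rewrite leeD // ?lee_wpmul2l ?lee_fin ?(ltW C0pos) //.
      rewrite /w.
      apply: (@le_trans _ _ (C0 * (D * expR (- eps * b%:R) * (C0 * (1 + C0))) * (expR (al * y) * r
        i)))%R.
        by rewrite le_eqVlt; apply/orP; left; apply/eqP; ring.
      by rewrite ler_wpM2r // mulr_ge0 ?expR_ge0.
    have := @iter_kernel_op_expf _ _ _ P I X mX qS (al / 2)%R (fun i =>
      C0 * v i)%R th K qS0 _ fal2 th0 _ f nf _ i y.
    rewrite /expf -EFinM; apply.
    - by move=> j; rewrite mulr_ge0 // ltW.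
    - move=> j; rewrite mulrCA.
      rewrite (_ : (\sum_l _ = C0 * \sum_l qS j l * mgf j l (al / 2) * v l)%R); last first.
        by rewrite mulr_sumr; apply: eq_bigr => l _; ring.
      rewrite ler_wpM2l ?(ltW C0pos) //.
      by case: (boolP (S j)) => Sj; [rewrite sumS // Hv|rewrite sumSN // mulr_ge0].
    move=> j x; rewrite /f /leftexpf lee_fin.
    case: (leP x 0%R) => x0; last by rewrite !mul0r !mulr_ge0 ?expR_ge0 ?(ltW C0pos).
    rewrite mul1r ler_pM ?expR_ge0 //.
      by rewrite ler_expR; nra.
    by apply: le_trans (rvC j); case: (S j); rewrite ?mul1r ?mul0r.
  case: (u i _) H1 (nu.1 i (y + b%:R)%R) => [x| |] //.
  - rewrite -!EFinM -EFinD !lee_fin => H1 _; lra.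
  - by move=> _ _; rewrite gt0_muley ?lte_fin // gt0_muley ?lte_fin // leey.
move=> i y Si y0.
have yb : (y - b%:R <= 0)%R by have := ler0n R b; lra.
have := key i (y - b%:R)%R Si yb; rewrite subrK.
case: (u i y) (nu.1 i y) => [x| |] //; last by move=> _ _; rewrite leey.
rewrite -!EFinM !lee_fin => x0 H.
rewrite /c mulrAC ler_pdivrMr ?mulr_gt0 //.
have -> : (expR (- (al * b%:R)) * expR (al * y) = expR (al * (y - b%:R)))%R.
  by rewrite -expRD; congr expR; ring.
have e0 := expR_ge0 (al * (y - b%:R)).
have := rC i; move: (r0 i) H e0 C0pos; move: (expR _) (r i) => E s; nra.
Qed.

End SingleClass.

(** * Supersolutions across classes *)

Section Blocks.
Variables (R : realType) (I : finType).
Implicit Types (M q : I -> I -> R) (S : pred I).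

(** Counterparts of [access] and [mutual_access] for a kernel on any finite type; [mgf_mx_acc] and
    [mgf_mx_sim] identify them. *)
Definition acc q : rel I := connect (fun i j => (i != j) && (q i j != 0)).
Definition sim q : rel I := fun i j => acc q i j && acc q j i.
Definition height q (i : I) : nat := #|[pred j | acc q i j]|.

Lemma sim_refl q i : sim q i i. Proof. by rewrite /sim /acc connect0. Qed.

Lemma sim_sym q i j : sim q i j = sim q j i. Proof. by rewrite /sim andbC. Qed.

Lemma acc_trans q i j k : acc q i j -> acc q j k -> acc q i k.
Proof. exact: connect_trans. Qed.

Lemma sim_trans q i j k : sim q i j -> sim q j k -> sim q i k.
Proof.
move=> /andP[ij ji] /andP[jk kj]; apply/andP; split.
  exact: acc_trans ij jk.
exact: acc_trans kj ji.
Qed.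

Lemma acc1 q i j : q i j != 0 -> acc q i j.
Proof.
move=> qij; have [->|ij] := eqVneq i j; first exact: connect0.
by apply: connect1; rewrite ij.
Qed.

Lemma height_lt q i j : acc q i j -> ~~ acc q j i -> (height q j < height q i)%N.
Proof.
move=> ij Nji; apply: proper_card; apply/properP; split.
  by apply/fintype.subsetP => k; rewrite !inE; exact: acc_trans.
by exists i; rewrite ?inE //; exact: connect0.
Qed.

Lemma height_sim q i j : sim q i j -> height q i = height q j.
Proof.
move=> /andP[ij ji]; apply: eq_card => k; rewrite !inE.
by apply/idP/idP; exact: acc_trans.
Qed.

(* Entering a state of smaller height costs a factor C / T, which makes up for
   the weights a i growing by at most tau i / c. *)
Lemma block_supersolution q M S (x a tau : I -> R) (c C T : R) :
  (forall i j, 0 <= M i j) -> (forall i j, M i j != 0 -> q i j != 0) ->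
  (forall i, 0 < x i) -> (forall i, 0 < a i) -> (forall i, 0 <= tau i) ->
  0 < c -> 0 <= C -> 1 <= T -> 2 * C <= c * T ->
  (forall i, S i -> \sum_(j | S j && sim q i j) M i j * x j <= (1 - tau i) * x i) ->
  (forall i j, S i -> S j -> sim q i j -> a i = a j) ->
  (forall i j, S i -> S j -> q i j != 0 -> ~~ sim q i j -> c * a j <= tau i * a i) ->
  (forall i, S i -> \sum_j M i j * x j <= C * x i) ->
  forall i, S i -> \sum_(j | S j) M i j * (T ^+ height q j * a j * x j) <=
    (1 - tau i / 2) * (T ^+ height q i * a i * x i).
Proof.
move=> M0 Mq x0 a0 tau0 c0 C0 T1 CT Hsim Hasim Ha HC i Si.
have T0 : 0 < T by lra.
set A := T ^+ height q i * a i.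
have A0 : 0 < A by rewrite mulr_gt0 ?exprn_gt0.
rewrite (bigID (sim q i)) /=.
have H1 : \sum_(j | S j && sim q i j) M i j * (T ^+ height q j * a j * x j) <=
    A * ((1 - tau i) * x i).
  rewrite (eq_bigr (fun j => A * (M i j * x j))).
    by rewrite -mulr_sumr ler_wpM2l ?(ltW A0) ?Hsim.
  move=> j /andP[Sj ij]; rewrite /A (height_sim ij) (Hasim i j) //; ring.
have H2 : \sum_(j | S j && ~~ sim q i j) M i j * (T ^+ height q j * a j * x j) <=
    (A / T * (tau i / c)) * (C * x i).
  apply: (@le_trans _ _ (\sum_j (A / T * (tau i / c)) * (M i j * x j))); last first.
    rewrite -mulr_sumr ler_wpM2l ?HC // mulr_ge0 ?divr_ge0 ?(ltW A0) ?(ltW T0) //.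
    exact: ltW.
  rewrite [leRHS](bigID (fun j => S j && ~~ sim q i j)) /= ler_wpDr //.
    apply: sumr_ge0 => j _.
    by rewrite !mulr_ge0 ?invr_ge0 ?exprn_ge0 ?(ltW (a0 i)) ?(ltW T0) ?(ltW c0) ?(ltW (x0 j)).
  apply: ler_sum => j /andP[Sj ij].
  have [->|Mij] := eqVneq (M i j) 0; first by rewrite !mul0r mulr0.
  have qij := Mq _ _ Mij; have aij := acc1 qij.
  have Naji : ~~ acc q j i by move: ij; rewrite /sim aij.
  rewrite [leRHS]mulrCA ler_wpM2l //.
  rewrite ler_wpM2r ?(ltW (x0 j)) //.
  have h1 : T ^+ height q j <= T ^+ height q i / T.
    rewrite ler_pdivlMr // -exprSr; apply: ler_weXn2l => //; exact: height_lt.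
  have h2 : a j <= tau i / c * a i.
    by rewrite mulrAC ler_pdivlMr // mulrC Ha.
  rewrite /A (_ : _ / T * _ = T ^+ height q i / T * (tau i / c * a i)); last by ring.
  by rewrite ler_pM // ?exprn_ge0 // ltW.
apply: le_trans (lerD H1 H2) _.
(* By 2 C <= c T the transitions to lower classes use at most half of the margin tau i. *)
have H3 : A / T * (tau i / c) * (C * x i) <= A * (tau i / 2 * x i).
  have Ax : 0 <= A * (tau i * x i) by rewrite mulr_ge0 ?(ltW A0) // mulr_ge0 // ltW.
  rewrite (_ : A / T * (tau i / c) * (C * x i) = A * (tau i * x i) * (C / (c * T))); last first.
    by rewrite invfM; ring.
  rewrite (_ : A * (tau i / 2 * x i) = A * (tau i * x i) * 2^-1); last by ring.
  by rewrite ler_wpM2l // ler_pdivrMr ?mulr_gt0 // mulrC ler_pdivlMr // mulrC.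
apply: le_trans (lerD (lexx _) H3) _.
by rewrite le_eqVlt; apply/orP; left; apply/eqP; field.
Qed.

End Blocks.

Section CoreData.
Context {d : measure_display} {T : measurableType d} {R : realType}.
Variables (P : probability T R) (I : finType) (X : I -> I -> T -> R).
Hypothesis mX : forall i j, measurable_fun [set: T] (X i j).
Local Notation mgf := (mgf P X).
Local Notation mgf_finite := (mgf_finite P X).

Lemma mgf_gt0 i j z : mgf_finite z -> 0 < mgf i j z.
Proof.
move=> fz; rewrite lt_neqAle mgf_ge0 andbT eq_sym; apply/eqP => m0.
have [H _] := @ae_eq_integral_abs _ _ _ P setT measurableT (fun x => (expR (z * X i j x))%:E)
  (measurable_mgf mX z i j).
have : (\int[P]_(x in [set: T]) `|(expR (z * X i j x))%:E| = 0)%E.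
  under eq_integral do rewrite /= ger0_norm ?expR_ge0 //.
  by rewrite mgfE // m0.
move=> /H [N [mN N0 sN]].
have : P [set: T] = 0%E.
  apply/eqP; rewrite -measure_le0 -N0; apply: le_measure; rewrite ?inE //.
  move=> x _; apply: sN => /= /(_ Logic.I).
  by move=> /eqP; rewrite eqe gt_eqF ?expR_gt0.
by move=> E; have := @probability_setT _ _ _ P; rewrite E => /eqP; rewrite eqe eq_sym oner_eq0.
Qed.

(* rho i is the Perron root at al of the class of i, with left and right eigenvectors
   l and r on that class; b i is the largest number of basic classes in a chain starting
   at the class of i; kap bounds the mean number of steps until a reset. *)
Record core_data (q : I -> I -> R) (al : R) (basic : pred I) (b : I -> nat)
    (rho r l kap : I -> R) : Prop := CoreData {
  cd_q0 : forall i j, 0 <= q i j;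
  cd_al0 : 0 < al;
  cd_basic : forall i j, sim q i j -> basic i = basic j;
  cd_b_acc : forall i j, acc q i j -> (b j <= b i)%N;
  cd_b_basic : forall i j, acc q i j -> ~~ acc q j i -> basic i -> (b j < b i)%N;
  cd_b0 : forall i, basic i -> (0 < b i)%N;
  cd_r0 : forall i, 0 < r i;
  cd_l0 : forall i, 0 < l i;
  cd_rho0 : forall i, 0 <= rho i;
  cd_rho1 : forall i, basic i -> rho i = 1;
  cd_rho : forall i, ~~ basic i -> rho i < 1;
  cd_Mr : forall i, \sum_(j | sim q i j) q i j * mgf i j al * r j = rho i * r i;
  cd_lM : forall j, basic j -> \sum_(i | sim q j i) l i * (q i j * mgf i j al) = l j;
  cd_kap0 : forall i, 0 < kap i;
  cd_kap : forall i, 1 + \sum_j q i j * kap j <= kap i }.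

Section Core.
Variables (q : I -> I -> R) (al : R) (basic : pred I) (b : I -> nat).
Variables (rho r l kap : I -> R).
Hypothesis cd : core_data q al basic b rho r l kap.
Hypothesis fal : mgf_finite al.

Let q0 := cd_q0 cd.
Let al0 := cd_al0 cd.
Let r0 := cd_r0 cd.
Let kap0 := cd_kap0 cd.

Definition interp (t : R) (i : I) : R := expR ((1 - t) * ln (kap i) + t * ln (r i)).

Lemma interp_gt0 t i : 0 < interp t i. Proof. exact: expR_gt0. Qed.

Lemma b_sim i j : sim q i j -> b i = b j.
Proof.
move=> /andP[ij ji]; apply/eqP; rewrite eqn_leq.
by rewrite (cd_b_acc cd ij) (cd_b_acc cd ji).
Qed.

(* Log-convexity in z of the Perron root of a class, in terms of explicit
   positive vectors: geometric means of kap (at z = 0) and r (at z = al). *)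
Lemma interp_super t i : 0 <= t <= 1 ->
  \sum_(j | sim q i j) q i j * mgf i j (t * al) * interp t j <=
    ((1 - t) * (1 - (kap i)^-1) + t * rho i) * interp t i.
Proof.
move=> t01; have /andP[t0 t1] := t01.
have ft : mgf_finite (t * al).
  apply: (mgf_finite_le mX) fal; rewrite mulr_ge0 ?(ltW al0) //=.
  by rewrite ler_piMl // ltW.
apply: (@le_trans _ _ (\sum_(j | sim q i j)
   ((1 - t) * (q i j * kap j / kap i) + t * (q i j * mgf i j al * r j / r i)) * interp t i)).
  apply: ler_sum => j _.
  have -> : interp t j = expR ((1 - t) * (ln (kap j) - ln (kap i)) + t * (ln (r j) - ln (r i)))
      * interp t i.
    by rewrite -expRD; congr expR; ring.
  rewrite mulrA ler_wpM2r ?(ltW (interp_gt0 _ _)) //.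
  have := @mgf_interpolation _ _ _ P I X mX al t (ln (kap j) - ln (kap i)) (ln (r j) - ln (r i)) i
    j t01 ft fal.
  rewrite !expRD !expRN !lnK ?posrE // => H.
  rewrite -mulrA [X in _ * X]mulrC; apply: le_trans (ler_wpM2l (q0 i j) H) _.
  by rewrite le_eqVlt; apply/orP; left; apply/eqP; ring.
rewrite -mulr_suml ler_wpM2r ?(ltW (interp_gt0 _ _)) //.
rewrite big_split /= -!mulr_sumr -!mulr_suml.
rewrite (cd_Mr cd) mulfK ?gt_eqF // lerD2r ler_wpM2l ?subr_ge0 //.
rewrite ler_pdivrMr // mulrBl mul1r mulVf ?gt_eqF //.
rewrite lerBrDl; apply: le_trans (cd_kap cd i); rewrite lerD2l.
rewrite [leRHS](bigID (sim q i)) /= lerDl; apply: sumr_ge0 => j _.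
by rewrite mulr_ge0 // ltW.
Qed.

Lemma interp_bounds : exists2 D, 1 <= D & forall t i, 0 <= t <= 1 -> D^-1 <= interp t i <= D.
Proof.
pose L := \sum_i (`|ln (kap i)| + `|ln (r i)|).
have L0 : 0 <= L by apply: sumr_ge0 => i _; rewrite addr_ge0.
exists (expR L); first by rewrite -expR0 ler_expR.
move=> t i /andP[t0 t1]; rewrite -expRN !ler_expR.
have Li : `|ln (kap i)| + `|ln (r i)| <= L.
  by rewrite /L (bigD1 i) //= lerDl sumr_ge0 // => j _; rewrite addr_ge0.
have : `|(1 - t) * ln (kap i) + t * ln (r i)| <= L.
  apply: le_trans (ler_normD _ _) _; rewrite !normrM (ger0_norm t0) (@ger0_norm _ (1 - t));
    last by lra.
  have := normr_ge0 (ln (kap i)); have := normr_ge0 (ln (r i)).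
  move: `|_| `|_| Li => A B; nra.
by rewrite ler_norml.
Qed.

Lemma finite_pos_lower (F : I -> R) (S : pred I) : (forall i, S i -> 0 < F i) ->
  exists2 c, 0 < c <= 1 & forall i, S i -> c <= F i.
Proof.
move=> F0; exists (\big[Num.min/1]_(i | S i) F i).
  apply/andP; split; last first.
    elim/big_rec : _ => // i x _; by rewrite ge_min => ->; rewrite orbT.
  by elim/big_rec : _ => // i x Si x0; rewrite lt_min F0.
by move=> i Si; rewrite (bigD1 i) //= ge_min lexx.
Qed.

Lemma finite_upper (F : I -> R) : exists2 C, 1 <= C & forall i, F i <= C.
Proof.
exists (1 + \sum_i `|F i|); first by rewrite lerDl sumr_ge0.
move=> i; apply: le_trans (ler_norm _) _; rewrite (bigD1 i) //= addrCA lerDl.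
by rewrite addr_ge0 // sumr_ge0.
Qed.

(** [block_supersolution] with the vectors [interp] at t = 1 - e / al: basic classes have a margin c
    e, the others c. The weight e^-(b i - 1) drops by a factor e at least when a basic class is
    left, which matches the small margin. States with b = 0 are excluded because there the truncated
    predecessor gives the same weight as for b = 1, and leaving the last basic class would gain
    nothing. *)
Lemma super_vectors : exists e0 C, [/\ 0 < e0 <= 1, e0 <= al / 2, 0 < C &
  forall e, 0 < e <= e0 -> exists v : I -> R,
  [/\ forall i, 1 <= v i, forall i, v i <= C * e^-1 ^+ (b i).-1 &
    forall i, (0 < b i)%N ->
      \sum_(j | (0 < b j)%N) q i j * mgf i j (al - e) * v j <= v i]].
Proof.
have [D D1 HD] := interp_bounds; have D0 : 0 < D by lra.
have [c1 /andP[c10 c11] Hc1] : exists2 c, 0 < c <= 1 & forall i, true -> c <= (kap i)^-1.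
  by apply: finite_pos_lower => i _; rewrite invr_gt0.
have [c2 /andP[c20 c21] Hc2] : exists2 c, 0 < c <= 1 & forall i, ~~ basic i -> c <= 1 - rho i.
  by apply: finite_pos_lower => i Bi; rewrite subr_gt0 (cd_rho cd).
have [C0 C01 HC0] : exists2 C, 1 <= C & forall i, \sum_j q i j * (1 + mgf i j al) <= C.
  exact: finite_upper.
(* The first bound serves basic classes, whose margin is (e / al) / kap i; the second serves the
   others, whose margin is at least t c2 with t >= 1/2. *)
pose c := Num.min (c1 / al) (c2 / 2).
have c0 : 0 < c by rewrite lt_min !divr_gt0.
pose C := C0 * D * D.
have CC0 : 0 <= C by rewrite !mulr_ge0 ?(ltW D0) //; lra.
pose TT := 1 + 2 * C / c.
have TT1 : 1 <= TT by rewrite lerDl divr_ge0 ?(ltW c0) // mulr_ge0.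
have TC : 2 * C <= c * TT by rewrite /TT mulrDr mulr1 [c * (_ / c)]mulrC divfK ?gt_eqF // lerDr ltW.
exists (Num.min 1 (al / 2)), (D * (TT ^+ #|I| * D)); split.
- by rewrite lt_min ltr01 divr_gt0 //= ge_min lexx.
- by rewrite ge_min lexx orbT.
- by rewrite !mulr_gt0 ?exprn_gt0 //; lra.
move=> e /andP[e0]; rewrite le_min => /andP[e1 eal].
pose t := 1 - e / al.
have eal1 : e / al <= 2^-1 by rewrite ler_pdivrMr // mulrC.
have eal0 : 0 < e / al by rewrite divr_gt0.
have t01 : 0 <= t <= 1 by rewrite /t; lra.
have tal : t * al = al - e by rewrite /t mulrBl mul1r divfK ?gt_eqF.
pose S i := (0 < b i)%N.
pose a i := e^-1 ^+ (b i).-1.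
pose tau i := if basic i then c * e else c.
have ei1 : 1 <= e^-1 by rewrite invf_ge1.
have ei0 : 0 < e^-1 by rewrite invr_gt0.
have a0 i : 0 < a i by rewrite exprn_gt0.
have tau0 i : 0 <= tau i by rewrite /tau; case: ifP => _; rewrite ?mulr_ge0 ?(ltW c0) // ltW.
pose M i j := q i j * mgf i j (al - e).
have M0 i j : 0 <= M i j by rewrite mulr_ge0 ?mgf_ge0.
have Mq i j : M i j != 0 -> q i j != 0.
  by apply: contraNN => /eqP E; rewrite /M E mul0r.
have fr i : 0 <= (kap i)^-1 <= 1.
  rewrite invr_ge0 (ltW (kap0 i)) invf_le1 //=.
  apply: le_trans (cd_kap cd i); rewrite lerDl sumr_ge0 // => j _.
  by rewrite mulr_ge0 // ltW.
have Htau i : (1 - t) * (1 - (kap i)^-1) + t * rho i <= 1 - tau i.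
  have := Hc1 i isT; have /andP[_ k1] := fr i; have := cd_rho0 cd i.
  rewrite /tau; case: (boolP (basic i)) => Bi R0 K0.
    rewrite (cd_rho1 cd Bi).
    have : c * e <= (e / al) * (kap i)^-1.
      rewrite mulrC -mulrA ler_wpM2l ?(ltW e0) // ge_min; apply/orP; left.
      by rewrite mulrC ler_wpM2l // invr_ge0 ltW.
    by rewrite /t; lra.
  have := Hc2 i Bi => H2; have : c <= c2 / 2 by rewrite ge_min lexx orbT.
  have t2 : t >= 2^-1 by rewrite /t; lra.
  have t3 : 0 <= 1 - t by rewrite /t; lra.
  have A1 : (1 - t) * (1 - (kap i)^-1) <= 1 - t by rewrite ler_piMr //; lra.
  have A2 : t * rho i <= t * (1 - c2) by rewrite ler_wpM2l //; lra.
  have A3 : 2^-1 * c2 <= t * c2 by rewrite ler_wpM2r // ltW.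
  by lra.
have := @block_supersolution R I q M S (interp t) a tau c C TT M0 Mq (interp_gt0 t) a0 tau0 c0 CC0
  TT1 TC.
move=> H; have {H} Hv := H _ _ _ _.
pose v i := D * (TT ^+ height q i * a i * interp t i).
have Dt i : D^-1 <= interp t i <= D by exact: HD.
exists v; split.
- move=> i; have /andP[H1 _] := Dt i.
  rewrite /v -ler_pdivrMl // mulr1; apply: le_trans H1 _.
  rewrite ler_peMl ?(ltW (interp_gt0 _ _)) // mulr_ege1 // exprn_ege1 //.
- move=> i; rewrite /v -[leRHS]mulrA ler_wpM2l ?(ltW D0) // [leRHS]mulrAC.
  have /andP[_ H2] := Dt i.
  have TTh : 0 <= TT ^+ height q i by rewrite exprn_ge0 //; lra.
  rewrite ler_pM ?(ltW (interp_gt0 _ _)) //; first by rewrite mulr_ge0 // ltW.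
  rewrite ler_wpM2r ?(ltW (a0 i)) //.
  by apply: ler_weXn2l => //; exact: max_card.
move=> i Si; rewrite /v.
rewrite (eq_bigr (fun j => D * (M i j * (TT ^+ height q j * a j * interp t j)))); last first.
  by move=> j _; rewrite /M mulrCA.
rewrite -mulr_sumr ler_wpM2l ?(ltW D0) //.
apply: le_trans (Hv _ _ _ _ i Si) _.
- move=> k Sk; apply: le_trans (ler_wpM2r (ltW (interp_gt0 t k)) (Htau k)).
  apply: le_trans (interp_super k t01).
  rewrite [leRHS](bigID S) /= tal.
  rewrite [in leRHS](eq_bigl (fun j => S j && sim q k j)); last by move=> j; rewrite andbC.
  rewrite lerDl; apply: sumr_ge0 => j _.
  by rewrite mulr_ge0 ?(ltW (interp_gt0 _ _)) //; exact: (M0 k j).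
- by move=> k j _ _ kj; rewrite /a (b_sim kj).
- move=> k j Sk Sj qkj Nkj; have kj := acc1 qkj.
  have Njk : ~~ acc q j k by move: Nkj; rewrite /sim kj.
  rewrite /tau /a; case: (boolP (basic k)) => Bk.
    have := cd_b_basic cd kj Njk Bk; rewrite /S in Sj Sk *.
    move=> bb; rewrite -mulrA ler_wpM2l ?(ltW c0) //.
    have -> : (b k).-1 = ((b k).-2).+1 by move: bb Sj; case: (b k) => [|[|n]] //; case: (b j).
    rewrite exprS mulVKf ?gt_eqF // ler_weXn2l //.
    by move: bb Sj; case: (b k) => [|[|n]] //; case: (b j) => [|m] //=.
  rewrite ler_wpM2l ?(ltW c0) // ler_weXn2l //.
  have := cd_b_acc cd kj; case: (b k) => [|n]; case: (b j) => [|m] //=.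
- move=> k Sk; have /andP[H1 _] := Dt k.
  apply: (@le_trans _ _ (C0 * D)); last first.
    rewrite /C -[leLHS]mulr1 -!mulrA ler_wpM2l //; first lra.
    by rewrite ler_wpM2l ?(ltW D0) // -ler_pdivrMl // mulr1.
  apply: (@le_trans _ _ ((\sum_j q k j * (1 + mgf k j al)) * D)); last by rewrite ler_wpM2r // ltW.
  rewrite mulr_suml; apply: ler_sum => j _; have /andP[_ H2] := Dt j.
  rewrite ler_pM ?(ltW (interp_gt0 _ _)) // ler_wpM2l //.
  by apply: (mgf_le1D mX) fal; apply/andP; split; lra.
have := tau0 i; have : 0 <= TT ^+ height q i * a i * interp t i.
  by rewrite !mulr_ge0 ?exprn_ge0 ?(ltW (a0 _)) ?(ltW (interp_gt0 _ _)) //; lra.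
move: (tau i) (_ * interp t i) => A B; nra.
Qed.

End Core.
End CoreData.

(** * Exponential upper bound *)

Section CoreUpper.
Context {d : measure_display} {T : measurableType d} {R : realType}.
Variables (P : probability T R) (I : finType) (X : I -> I -> T -> R).
Hypothesis mX : forall i j, measurable_fun [set: T] (X i j).
Local Notation mgf := (mgf P X).
Local Notation mgf_finite := (mgf_finite P X).
Local Notation green := (green P X).
Variables (q : I -> I -> R) (al : R) (basic : pred I) (b : I -> nat).
Variables (rho r l kap : I -> R).
Hypothesis cd : core_data P X q al basic b rho r l kap.
Variable a0 : R.
Hypotheses (ala0 : al < a0) (fa0 : mgf_finite a0).

Let q0 := cd_q0 cd.
Let al0 := cd_al0 cd.
Let r0 := cd_r0 cd.
Let kap0 := cd_kap0 cd.

Let fal : mgf_finite al.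
Proof. by apply: (mgf_finite_le mX) fa0; apply/andP; split; apply: ltW. Qed.

(** States with b = 0 lie in classes of root less than 1 at al. By convexity of the transforms on
    [al, a0], half of the margin 1 - rho survives slightly to the right of al. *)
Lemma nonbasic_super_vector : exists a v, [/\ al < a <= a0, forall i, 0 <= v i &
  forall i, b i = 0%N -> 1 + \sum_(j | b j == 0%N) q i j * mgf i j a * v j <= v i].
Proof.
have nb i : b i = 0%N -> ~~ basic i.
  by move=> bi; apply/negP => /(cd_b0 cd); rewrite bi.
have [c2 /andP[c20 c21] Hc2] : exists2 c, 0 < c <= 1 & forall i, ~~ basic i -> c <= 1 - rho i.
  by apply: finite_pos_lower => i Bi; rewrite subr_gt0 (cd_rho cd).
have [rm /andP[rm0 _] Hrm] : exists2 c, 0 < c <= 1 & forall i, true -> c <= r i.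
  exact: finite_pos_lower.
have [C0 C01 HC0] : exists2 C, 1 <= C & forall i, (\sum_j q i j * (1 + mgf i j a0) * r j) / r i <=
  C.
  exact: finite_upper.
have C0' : 0 < C0 by lra.
pose c := c2 / 2; have c0 : 0 < c by rewrite divr_gt0.
pose t := Num.min 1 (c / C0).
have t0 : 0 < t by rewrite lt_min ltr01 divr_gt0.
have t1 : t <= 1 by rewrite ge_min lexx.
have tC : t * C0 <= c by rewrite -ler_pdivlMr // ge_min lexx orbT.
pose a := al + t * (a0 - al).
have aa : al < a <= a0.
  have h : 0 < a0 - al by rewrite subr_gt0.
  apply/andP; split; first by rewrite /a ltrDl mulr_gt0.
  rewrite /a -lerBrDl; exact: ler_piMl (ltW h) t1.
have fa : mgf_finite a.
  by case/andP: aa => aa1 aa2; apply: (mgf_finite_le mX) fa0;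
    rewrite aa2 andbT (le_trans (ltW al0)) // ltW.
have t01 : 0 <= t <= 1 by rewrite (ltW t0) t1.
pose M i j := q i j * mgf i j a.
have M0 i j : 0 <= M i j by rewrite mulr_ge0 ?mgf_ge0.
have Mq i j : M i j != 0 -> q i j != 0.
  by apply: contraNN => /eqP E; rewrite /M E mul0r.
pose TT := 1 + 2 * C0 / c.
have TT1 : 1 <= TT by rewrite lerDl divr_ge0 ?(ltW c0) // mulr_ge0 // ltW.
have TC : 2 * C0 <= c * TT.
  by rewrite /TT mulrDr mulr1 [c * (_ / c)]mulrC divfK ?gt_eqF // lerDr ltW.
have HC0' i : \sum_j q i j * (1 + mgf i j a0) * r j <= C0 * r i by rewrite -ler_pdivrMr.
have := @block_supersolution R I q M (fun i => b i == 0%N) r (fun=> 1) (fun=> c) c C0 TT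
  M0 Mq r0 (fun=> ltr01) (fun=> ltW c0) c0 (ltW C0') TT1 TC.
move=> H; have {H} Hv := H _ _ _ _.
have Hv' : forall i, b i == 0%N -> \sum_(j | b j == 0%N) M i j * (TT ^+ height q j * 1 * r j) <=
    (1 - c / 2) * (TT ^+ height q i * 1 * r i).
  apply: Hv.
  - move=> i /eqP bi.
    apply: (@le_trans _ _ (\sum_(j | sim q i j) M i j * r j)).
      rewrite [leRHS](bigID (fun j => b j == 0%N)) /=.
      rewrite [in leRHS](eq_bigl (fun j => (b j == 0%N) && sim q i j)); last by move=> j;
        rewrite andbC.
      by rewrite lerDl; apply: sumr_ge0 => j _; rewrite mulr_ge0 // ltW.
    apply: (@le_trans _ _ (rho i * r i + t * (C0 * r i))).
      rewrite -(cd_Mr cd).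
      apply: (@le_trans _ _ (\sum_(j | sim q i j) (q i j * mgf i j al * r j + t * (q i j * (1 +
        mgf i j a0) * r j)))).
        apply: ler_sum => j _; rewrite /M.
        have := @mgf_right_upper _ _ _ P I X mX al a0 t i j t01 (ltW al0) (ltW ala0) fa0.
        rewrite -/a => H.
        have := ler_wpM2l (q0 i j) H => {H} H.
        have := ler_wpM2r (ltW (r0 j)) H => {H} H.
        apply: le_trans H _.
        have x1 : 0 <= q i j * r j by rewrite mulr_ge0 // ltW.
        have x2 := mgf_ge0 P X i j al; have x3 := mgf_ge0 P X i j a0.
        have x4 : 0 <= q i j * r j * (t * (1 + mgf i j al)) by rewrite !mulr_ge0 ?addr_ge0 // ltW.
        by rewrite -subr_ge0 (_ : _ - _ = q i j * r j * (t * (1 + mgf i j al))) //; ring.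
      rewrite big_split /= lerD2l -mulr_sumr ler_wpM2l ?(ltW t0) //.
      apply: le_trans (HC0' i); rewrite [leRHS](bigID (sim q i)) /= lerDl.
      by apply: sumr_ge0 => j _; rewrite !mulr_ge0 ?addr_ge0 ?mgf_ge0 // ltW.
    rewrite mulrA -mulrDl ler_wpM2r ?(ltW (r0 i)) //.
    have := Hc2 i (nb i bi); rewrite /c in tC *; lra.
  - by [].
  - by move=> i j _ _ _ _; rewrite !mulr1.
  - move=> i _; apply: le_trans (HC0' i); apply: ler_sum => j _.
    rewrite ler_wpM2r ?(ltW (r0 j)) // ler_wpM2l //.
    apply: (mgf_le1D mX) fa0; case/andP: aa => aa1 ->; rewrite andbT.
    by rewrite (le_trans (ltW al0)) // ltW.
(* Scales the remaining margin, at least c / 2 * rm, up to the required 1. *)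
pose s := 2 / (c * rm).
have s0 : 0 < s by rewrite divr_gt0 // mulr_gt0.
have TTh i : 1 <= TT ^+ height q i by rewrite exprn_ege1.
exists a, (fun i => s * (TT ^+ height q i * 1 * r i)); split=> //.
  move=> i; rewrite mulr_ge0 ?(ltW s0) // mulr_ge0 ?(ltW (r0 i)) // mulr1.
  exact: le_trans ler01 (TTh i).
move=> i /eqP bi.
rewrite (eq_bigr (fun j => s * (M i j * (TT ^+ height q j * 1 * r j)))); last first.
  by move=> j _; rewrite /M mulrCA.
rewrite -mulr_sumr; apply: le_trans (lerD (lexx _) (ler_wpM2l (ltW s0) (Hv' i bi))) _.

have H : 1 <= s * (c / 2 * (TT ^+ height q i * 1 * r i)).
  rewrite /s (_ : 2 / (c * rm) * (c / 2 * (TT ^+ height q i * 1 * r i)) = TT ^+ height q i * (r i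
    / rm)); last first.
    by field; rewrite !gt_eqF.
  by rewrite mulr_ege1 // ler_pdivlMr // mul1r Hrm.
lra.
Qed.

Lemma core_upper dd : (0 < dd)%N -> (forall i, (b i <= dd)%N) -> exists C w0, [/\ 0 < C, 1 <= w0 &
  forall K i w, w0 <= w ->
    (green q K (@stepf R I) i (- w) <= (C * w ^+ dd.-1 * expR (- (al * w)))%:E)%E].
Proof.
move=> dd0 bd.
have [a [v0 [/andP[ala aa0] v00 Hv0]]] := nonbasic_super_vector.
have a00 : 0 <= a by rewrite (le_trans (ltW al0)) // ltW.
have fa : mgf_finite a by apply: (mgf_finite_le mX) fa0; rewrite a00.
pose S : pred I := fun i => (0 < b i)%N.
have SN i : ~~ S i = (b i == 0%N) by rewrite /S -leqNgt leqn0.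
have closed i j : ~~ S i -> S j -> q i j = 0.
  rewrite SN => /eqP bi Sj; apply/eqP; apply: contraTT Sj => qij.
  by rewrite SN -leqn0 -bi (cd_b_acc cd) // acc1.
have Hv0' i : ~~ S i -> 1 + \sum_(j | ~~ S j) q i j * mgf i j a * v0 j <= v0 i.
  rewrite SN => /eqP /Hv0; apply: le_trans; rewrite lerD2l.
  by rewrite (eq_bigl (fun j => b j == 0%N)).
have kap0' i : 0 <= kap i by exact: ltW.
have [C [C0 D0 D1]] := green_step_split mX q0 a00 fa closed kap0' (cd_kap cd) v00 Hv0'.
have [e0 [C1 [/andP[e00 e01] e0al C10 Hv]]] := super_vectors mX cd fal.
have [Ck Ck1 HCk] : exists2 C, 1 <= C & forall i, kap i <= C by exact: finite_upper.
pose eps := (a - al) / 2; have eps0 : 0 < eps by rewrite divr_gt0 // subr_gt0.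
have ee : 0 < 1 - expR (- eps) by rewrite subr_gt0 expR_lt1 oppr_lt0.
pose D := Ck * expR al / (1 - expR (- eps)) + 1.
have D00 : 0 <= D by rewrite addr_ge0 // divr_ge0 ?(ltW ee) // mulr_ge0 ?expR_ge0 //; lra.
pose CC := C * (Ck + D) * C1 * expR 1 + C + 1.
have CC1 : 0 <= C * (Ck + D) * C1 * expR 1.
  by rewrite !mulr_ge0 ?expR_ge0 ?(ltW C10) //; lra.
exists CC, e0^-1; split; first by rewrite /CC; lra.
  by rewrite invf_ge1.
move=> K i w ww; have w1 : 1 <= w by apply: le_trans ww; rewrite invf_ge1.
have w0 : 0 < w by lra.
have wd : 1 <= w ^+ dd.-1 by rewrite exprn_ege1.
have [Si|Si] := boolP (S i); last first.
  apply: le_trans (D0 K i (- w) Si) _; rewrite /taperf -EFinM lee_fin.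
  rewrite min_l ?oppr_le0 ?(ltW w0) //.
  rewrite ler_pM ?expR_ge0 //; last by rewrite ler_expR mulrN lerN2 ler_wpM2r ?(ltW w0) // ltW.
  apply: (@le_trans _ _ (CC * 1)); last by rewrite ler_wpM2l // /CC; lra.
  by rewrite mulr1 /CC; lra.
apply: le_trans (D1 K i (- w) Si) _.
(* exp((al - e) (- w)) is then exp 1 times exp(- al w), and [v] is at most C1 w^(dd - 1). *)
pose e := w^-1; have e_0 : 0 < e by rewrite invr_gt0.
have ee0 : e <= e0 by rewrite -(invrK e0) lef_pV2 // posrE ?invr_gt0.
have [v [v1 vC Mv]] : exists v : I -> R,
  [/\ forall i, 1 <= v i, forall i, v i <= C1 * e^-1 ^+ (b i).-1 &
    forall i, (0 < b i)%N ->
      \sum_(j | (0 < b j)%N) q i j * mgf i j (al - e) * v j <= v i].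
  by apply: Hv; rewrite e_0.
have z0 : 0 <= al - e by lra.
have fz : mgf_finite (al - e).
  by apply: (mgf_finite_le mX) fal; rewrite z0 lerBlDr lerDl ltW.
have qS0 := qrestrict_ge0 S q0.
have v0' i0 : 0 <= v i0 by have := v1 i0; lra.
have MvS i0 : \sum_j qrestrict S q i0 j * mgf i0 j (al - e) * v j <= v i0.
  under eq_bigr do rewrite -mulrA.
  have [Si0|Si0] := boolP (S i0); last by rewrite sum_qrestrictN.
  rewrite sum_qrestrict //; under eq_bigr do rewrite mulrA; exact: Mv.
(* [v] is scaled by Ck to dominate [kap], as [green_step_bound] requires; the constant does not
   depend on w. *)
have gC i0 y : (green (qrestrict S q) K (@stepf R I) i0 y <= Ck%:E * expf (al - e) v i0 y)%E.
  have := @green_step_bound _ _ _ P I X mX (qrestrict S q) (al - e) kap (fun i =>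
    Ck * v i) K qS0 z0 _ fz _ _ i0 y.
  rewrite /expf -EFinM mulrCA; apply.
  - move=> j; rewrite kap0' /= (le_trans (HCk j)) // ler_peMr //; lra.
  - move=> j; apply: le_trans (cd_kap cd j); rewrite lerD2l; apply: ler_sum => m _.
    by rewrite ler_wpM2r //; case/andP: (qrestrict_le S q0 j m).
  - move=> j; rewrite (eq_bigr (fun m => Ck * (qrestrict S q j m * mgf j m (al - e) * v m))).
      by rewrite -mulr_sumr ler_wpM2l //; lra.
    by move=> m _; rewrite mulrCA.
have ze : al - e + 2 * eps <= a by rewrite /eps; lra.
have Ck0 : 0 <= Ck by lra.
have := @green_taperf _ _ _ P I X mX (qrestrict S q) (al - e) a eps Ck v K 0%N qS0 z0 eps0 ze Ck0
  v1 fz MvS gC i (- w).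
rewrite mulr0n addr0 mulr0 expR0 mulr1 => H.
have {}H : (green (qrestrict S q) K (taperf a) i (- w) <= ((Ck + D) * (expR (- (al * w)) * expR 1
  * (C1 * w ^+ dd.-1)))%:E)%E.
  apply: le_trans H _; apply: le_trans (leeD (gC i (- w)) (lexx _)) _.
  rewrite /expf -!EFinM -EFinD lee_fin -mulrDl.
  have E : expR ((al - e) * - w) = expR (- (al * w)) * expR 1.
    by rewrite -expRD; congr expR; rewrite /e; field; rewrite gt_eqF.
  rewrite E; apply: ler_pM => //.
  - rewrite addr_ge0 // addr_ge0 // divr_ge0 ?(ltW ee) // mulr_ge0 ?expR_ge0 //.
  - by rewrite !mulr_ge0 ?expR_ge0.
  - rewrite lerD2l /D lerD2r ler_wpM2r ?invr_ge0 ?(ltW ee) // ler_wpM2l // ler_expR; lra.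
  rewrite ler_wpM2l ?mulr_ge0 ?expR_ge0 //; apply: le_trans (vC i) _.
  rewrite ler_wpM2l ?(ltW C10) // /e invrK ler_weXn2l //.
  by have := bd i; case: (b i) => [|m]; case: dd dd0 {bd wd} => [|dd'].
apply: le_trans (lee_wpmul2l _ H) _; first by rewrite lee_fin.
rewrite -EFinM lee_fin.
rewrite (_ : C * _ = C * (Ck + D) * C1 * expR 1 * w ^+ dd.-1 * expR (- (al * w))); last by ring.
rewrite ler_wpM2r ?expR_ge0 // ler_wpM2r //; first lra.
by rewrite /CC; lra.
Qed.

End CoreUpper.

(** * Exponential lower bound *)

Section ResolventLimit.
Context {d : measure_display} {T : measurableType d} {R : realType}.
Variables (P : probability T R) (I : finType) (X : I -> I -> T -> R).
Local Notation mgf := (mgf P X).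
Local Notation resolvent := (resolvent P X).

Lemma resolvent_le q z K (bb v : I -> R) : (forall i j, 0 <= q i j) ->
  (forall i, 0 <= v i) -> (forall i, bb i + \sum_j q i j * mgf i j z * v j <= v i) ->
  forall i, resolvent q z K bb i <= v i.
Proof.
move=> q0 v0 Hv; elim: K => [//|K IH] i /=; apply: le_trans (Hv i); rewrite lerD2l.
by apply: ler_sum => j _; rewrite ler_wpM2l // mulr_ge0 ?mgf_ge0.
Qed.

Lemma resolvent_nondecreasing q z (bb : I -> R) i : (forall i j, 0 <= q i j) ->
  (forall i, 0 <= bb i) -> nondecreasing_seq (fun K => resolvent q z K bb i).
Proof.
move=> q0 b0; apply/nondecreasing_seqP => K; elim: K i => [|K IH] i.
  exact: (resolvent_ge0 P X z 1 q0 b0 i).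
rewrite /= lerD2l; apply: ler_sum => j _.
by rewrite ler_wpM2l ?IH // mulr_ge0 ?mgf_ge0.
Qed.

(** The partial sums increase and are bounded by [v]. The limit solves the equation exactly, as the
    pairing argument of [chain_lower] needs, while bounds are still proved for finite K. *)
Lemma resolvent_limit q z (bb v : I -> R) : (forall i j, 0 <= q i j) ->
  (forall i, 0 <= bb i) -> (forall i, 0 <= v i) ->
  (forall i, bb i + \sum_j q i j * mgf i j z * v j <= v i) ->
  exists Rv : I -> R, [/\ forall i, 0 <= Rv i,
    forall i, Rv i = bb i + \sum_j q i j * mgf i j z * Rv j &
    forall i B, (forall K, resolvent q z K bb i <= B) -> Rv i <= B].
Proof.
move=> q0 b0 v0 Hv; pose u i K := resolvent q z K bb i.
have cu i : cvgn (u i).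
  apply: nondecreasing_is_cvgn; first exact: resolvent_nondecreasing.
  by exists (v i) => _ [K _ <-]; exact: resolvent_le.
exists (fun i => limn (u i)); split.
- move=> i; apply: limr_ge => //; apply: nearW => K; exact: resolvent_ge0.
- move=> i; have H1 : (fun K => u i K.+1) @ \oo --> limn (u i) by rewrite cvg_shiftS.
  have H2 : forall s : seq I, (fun K => \sum_(j <- s) q i j * mgf i j z * u j K) @ \oo -->
      \sum_(j <- s) q i j * mgf i j z * limn (u j).
    elim=> [|j s IH].
      under eq_fun do rewrite big_nil; rewrite big_nil; exact: cvg_cst.
    under eq_fun do rewrite big_cons; rewrite big_cons; apply: cvgD => //.
    by apply: cvgMr; exact: cu.
  have H3 : (fun K => u i K.+1) @ \oo --> bb i + \sum_j q i j * mgf i j z * limn (u j).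
    by apply: cvgD; [exact: cvg_cst|exact: H2].
  exact: (cvg_unique _ H1 H3).
- by move=> i B HB; apply: limr_le => //; apply: nearW.
Qed.

End ResolventLimit.

Lemma lipschitz_arith (R : realType) (m m' Z x : R) :
  x * m <= 2^-1 * m -> Z <= x * m -> m <= m' + Z ->
  (1 - x) * m <= m' /\ 2^-1 * m <= m'.
Proof. by move=> h1 h2 h3; split; lra. Qed.

(* Compares the Laplace weight at al - s with exp(al y) on y <= 0, up to a far part
   (y > 0), discounted by exp(- s w / 2), and a small constant (y < - w). *)
Lemma left_window (R : realType) (al s w y : R) : 0 < al -> 0 < s -> s <= al / 2 -> 0 < w ->
  expR ((al - s) * (y + w)) <= (y <= 0)%R%:R * expR (al * (y + w)) +
    expR (- (s * w / 2)) * expR ((al - s / 2) * (y + w)) + 2 * s / al.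
Proof.
move=> al0 s0 sal w0; set p := y + w.
have c0 : 0 <= 2 * s / al by rewrite divr_ge0 ?mulr_ge0 ?(ltW al0) // ltW.
have [y0|y0] := leP y 0; last first.
  rewrite mul0r add0r ler_wpDr // -expRD ler_expR.
  have wp : w <= p by rewrite /p lerDr ltW.
  have : 0 <= s * (p - w) by rewrite mulr_ge0 ?subr_ge0 // ltW.
  by clear; move: p => p; lra.
rewrite mul1r; have [p0|p0] := leP 0 p.
  apply: (@le_trans _ _ (expR (al * p))).
    by rewrite ler_expR ler_wpM2r // lerBlDr lerDl ltW.
  by rewrite -addrA lerDl addr_ge0 // mulr_ge0 ?expR_ge0.
rewrite addrAC ler_wpDr ?mulr_ge0 ?expR_ge0 //.
have H1 : expR ((al - s) * p) * (1 + s * p) <= expR (al * p).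
  rewrite (_ : al * p = (al - s) * p + s * p); last by ring.
  by rewrite expRD ler_wpM2l ?expR_ge0 // expR_ge1Dx.
have H2 : expR ((al - s) * p) <= expR (al / 2 * p).
  by rewrite ler_expR ler_wnM2r ?(ltW p0) //; clear -sal; lra.
have H3 : - (al / 2 * p) * expR (al / 2 * p) <= 1.
  set t := - _; have -> : expR (al / 2 * p) = (expR t)^-1 by rewrite -expRN /t opprK.
  rewrite ler_pdivrMr ?expR_gt0 // mul1r (le_trans _ (expR_ge1Dx _)) //.
  by rewrite lerDr.
have H4 : (- (s * p)) * expR ((al - s) * p) <= 2 * s / al.
  have sp0 : 0 <= - (s * p) by rewrite -mulrN mulr_ge0 ?oppr_ge0 // ltW.
  apply: le_trans (ler_wpM2l sp0 H2) _.
  rewrite (_ : - (s * p) * expR (al / 2 * p) = 2 * s / al * (- (al / 2 * p) * expR (al / 2 * p)));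
    last first.
    by field; rewrite gt_eqF.
  by rewrite ler_piMr.
move: H1 H4; rewrite mulrDr mulr1 mulNr.
by clear; move: (expR _) (expR _) => A B; lra.
Qed.

Section CoreLower.
Context {d : measure_display} {T : measurableType d} {R : realType}.
Variables (P : probability T R) (I : finType) (X : I -> I -> T -> R).
Hypothesis mX : forall i j, measurable_fun [set: T] (X i j).
Local Notation mgf := (mgf P X).
Local Notation mgf_finite := (mgf_finite P X).
Local Notation resolvent := (resolvent P X).
Variables (q : I -> I -> R) (al : R) (basic : pred I) (b : I -> nat).
Variables (rho r l kap : I -> R).
Hypothesis cd : core_data P X q al basic b rho r l kap.
Variable a0 : R.
Hypotheses (ala0 : al < a0) (fa0 : mgf_finite a0).
Variable g0 : I.
Hypothesis Bg0 : basic g0.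

Let q0 := cd_q0 cd.
Let al0 := cd_al0 cd.
Let l0 := cd_l0 cd.

Let fal : mgf_finite al.
Proof. by apply: (mgf_finite_le mX) fa0; apply/andP; split; apply: ltW. Qed.

(* The chain restricted to states with access to a basic class and stopped on
   reaching the class of g0. *)
Definition stopped i j : R := [&& 0 < b i, 0 < b j & ~~ sim q g0 i]%N%:R * q i j.

Lemma stopped_ge0 i j : 0 <= stopped i j.
Proof. by rewrite mulr_ge0 ?ler0n. Qed.

Lemma stopped_le i j : stopped i j <= q i j.
Proof. by rewrite /stopped; case: [&& _, _ & _]; rewrite ?mul1r ?mul0r. Qed.

(** [mgf_left_lower] made relative to the positive number mgf i j al. The restriction e0 <= 1 / (2
    C) gives the second bound. *)
Lemma mgf_lipschitz : exists e0 C, [/\ 0 < e0 <= 1, e0 <= al / 2, 0 < C &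
  forall e, 0 <= e <= e0 -> forall i j,
    (1 - C * e) * mgf i j al <= mgf i j (al - e) /\ 2^-1 * mgf i j al <= mgf i j (al - e)].
Proof.
have [C C1 HC] : exists2 C, 1 <= C & forall ij : I * I,
  mgf ij.1 ij.2 a0 / (a0 - al) / mgf ij.1 ij.2 al <= C.
  exact: finite_upper.
have C0 : 0 < C by lra.
exists (Num.min (Num.min 1 (al / 2)) (2 * C)^-1), C; split=> //.
- by rewrite !lt_min ltr01 divr_gt0 //= invr_gt0 mulr_gt0 //= !ge_min lexx.
- by rewrite !ge_min lexx orbT.
move=> e /andP[e0]; rewrite !le_min => /andP[/andP[e1 e2] e3] i j.
have Ce : C * e <= 2^-1.
  have : e * (2 * C) <= 1 by rewrite -ler_pdivlMr ?mulr_gt0 // mul1r.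
  lra.
have m0 : 0 < mgf i j al by exact: mgf_gt0.
have aa : 0 < a0 - al by rewrite subr_gt0.
have := @mgf_left_lower _ _ _ P I X mX al a0 e i j ltac:(by lra) e0 ala0 fa0.
have : e / (a0 - al) * mgf i j a0 <= C * e * mgf i j al.
  have := HC (i, j); rewrite /= ler_pdivrMr // => H.
  rewrite (_ : e / _ * _ = e * (mgf i j a0 / (a0 - al))); last by ring.
  by rewrite [C * e]mulrC -mulrA ler_wpM2l.
have : C * e * mgf i j al <= 2^-1 * mgf i j al by rewrite ler_wpM2r // ltW.
by move=> h1 h2 h3; apply: lipschitz_arith h3.
Qed.

(* Rv plays the role of the Green function of the stopped chain, evaluated on
   the class of g0. *)
Definition green_like e0 (Phi : R -> (I -> R) -> Prop) :=
  forall e, 0 < e <= e0 -> forall Rv : I -> R, (forall i, 0 <= Rv i) ->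
  (forall i, sim q g0 i -> Rv i = 1) ->
  (forall i, \sum_j stopped i j * mgf i j (al - e) * Rv j <= Rv i) -> Phi e Rv.

Lemma green_harnack e0 C i j : e0 <= al / 2 ->
  (forall e, 0 <= e <= e0 -> forall i j,
    (1 - C * e) * mgf i j al <= mgf i j (al - e) /\ 2^-1 * mgf i j al <= mgf i j (al - e)) ->
  acc q i j -> acc q j g0 ->
  exists2 c, 0 < c & green_like e0 (fun e Rv => c * Rv j <= Rv i).
Proof.
move=> e0al Hm /connectP[p + ->] {j}; elim: p i => [|k p IH] i /=.
  by move=> _ _; exists 1 => // e _ Rv _ _ _; rewrite mul1r.
move=> /andP[/andP[ik qik] pk] lg0.
have kl : acc q k (last k p) by apply/connectP; exists p.
have il : acc q i (last k p) by apply: acc_trans kl; exact: acc1.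
have [gi|Ngi] := boolP (sim q g0 i).
  exists 1 => // e _ Rv _ H1 _; rewrite mul1r !H1 //.
  by case/andP: gi => gi ig; rewrite /sim lg0 andbT; apply: acc_trans il.
have [c c0 Hc] := IH k pk lg0.
have m0 : 0 < mgf i k al by exact: mgf_gt0.
have q00 : 0 < q i k by rewrite lt_neqAle eq_sym qik q0.
exists (q i k * (2^-1 * mgf i k al) * c); first by rewrite !mulr_gt0.
move=> e ee Rv Rv0 R1 HR; apply: le_trans (HR i).
have kg0 : acc q k g0 by apply: acc_trans kl lg0.
have bk : (0 < b k)%N by apply: leq_trans (cd_b0 cd Bg0) (cd_b_acc cd kg0).
have bi : (0 < b i)%N by apply: leq_trans bk (cd_b_acc cd (acc1 qik)).
rewrite (bigD1 k) //= ler_wpDr //.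
  by apply: sumr_ge0 => m _; rewrite !mulr_ge0 ?mgf_ge0 ?stopped_ge0.
rewrite /stopped bi bk Ngi mul1r -[leLHS]mulrA.
have ee' : 0 <= e <= e0 by case/andP: ee => /ltW -> ->.
apply: ler_pM; rewrite ?mulr_ge0 ?(ltW m0) ?(ltW c0) //.
  by rewrite ler_wpM2l // (Hm e ee' i k).2.
exact: (Hc e ee Rv Rv0 R1 HR).
Qed.

Lemma exit_edge i k : acc q i k -> ~~ acc q k i ->
  exists j m, [/\ sim q i j, ~~ sim q i m, q j m != 0 & acc q m k].
Proof.
move=> /connectP[p + ->] {k}; elim/last_ind: p => [|p k IH] /=.
  by rewrite /acc connect0.
rewrite rcons_path last_rcons => /andP[pp /andP[lk qlk]] Nki.
have il : acc q i (last i p) by apply/connectP; exists p.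
have [li|Nli] := boolP (acc q (last i p) i).
  exists (last i p), k; split=> //; first by rewrite /sim il.
    by rewrite /sim (negbTE Nki) andbF.
  exact: connect0.
have [j [m [H1 H2 H3 H4]]] := IH pp Nli.
exists j, m; split=> //; apply: acc_trans H4 _; exact: acc1.
Qed.

(** Pairing with the left eigenvector on a basic class costs only a fraction C e, while an edge
    towards the rest of the chain injects a fixed multiple of the previous bound. The total over the
    class is therefore at least 1 / (C e) times this injection. [belast] leaves out the class of g0,
    where [Rv] is 1. *)
Lemma chain_lower e0 C i s : 0 < C -> e0 <= al / 2 ->
  (forall e, 0 <= e <= e0 -> forall i j,
    (1 - C * e) * mgf i j al <= mgf i j (al - e) /\ 2^-1 * mgf i j al <= mgf i j (al - e)) ->
  path (fun i j => acc q i j && ~~ acc q j i) i s -> sim q g0 (last i s) ->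
  forall j, acc q j i -> exists2 c, 0 < c &
    green_like e0 (fun e Rv => c * e^-1 ^+ count basic (belast i s) <= Rv j).
Proof.
move=> C0 e0al Hm; elim: s i => [|k s IH] i /=.
  move=> _ gi j ji; have ig0 : acc q i g0 by case/andP: gi.
  have [c c0 Hc] := green_harnack e0al Hm ji ig0.
  exists c => // e ee Rv Rv0 R1 HR; rewrite expr0 mulr1.
  by have := Hc e ee Rv Rv0 R1 HR; rewrite R1 // mulr1.
move=> /andP[/andP[ik Nki] ps] gl j ji.
have acc_last k' s' : path (fun i j => acc q i j && ~~ acc q j i) k' s' -> acc q k' (last k' s').
  elim: s' k' => [|m s' IH'] k' /=; first by rewrite /acc connect0.
  by move=> /andP[/andP[km _]] /IH'; apply: acc_trans.
have kg0 : acc q k g0.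
  by apply: acc_trans (acc_last k s ps) _; case/andP: gl.
have [Bi|Bi] := boolP (basic i); last first.
  rewrite add0n; apply: IH => //; exact: acc_trans ji ik.
have ig0 : acc q i g0 by apply: acc_trans ik kg0.
have Ngi : ~~ sim q g0 i.
  apply: contra Nki => /andP[gi _]; exact: acc_trans kg0 gi.
have [m [n [im Nin qmn nk]]] := exit_edge ik Nki.
have [c1 c10 Hc1] := IH k ps gl n nk.
have [c2 c20 Hc2] := green_harnack e0al Hm ji ig0.
have [c3 c30 Hc3] : exists2 c3, 0 < c3 & green_like e0 (fun e Rv =>
    forall j', sim q i j' -> c3 * Rv j' <= Rv i).
  have /choice[F HF] : forall j', exists c, 0 < c /\ (sim q i j' ->
      green_like e0 (fun e Rv => c * Rv j' <= Rv i)).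
    move=> j'; have [/andP[ij' j'i]|N] := boolP (sim q i j'); last by exists 1.
    have [c c0' Hc] := green_harnack e0al Hm ij' (acc_trans j'i ig0).
    by exists c.
  have [c3 /andP[c30 _] Hc3] : exists2 c, 0 < c <= 1 & forall j', true -> c <= F j'.
    by apply: finite_pos_lower => j' _; exact: (HF j').1.
  exists c3 => // e ee Rv Rv0 R1 HR j' ij'.
  apply: le_trans ((HF j').2 ij' e ee Rv Rv0 R1 HR); by rewrite ler_wpM2r // Hc3.
pose L := \sum_(j' | sim q i j') l j'.
have L0 : 0 < L.
  rewrite /L (bigD1 i) ?sim_refl //= ltr_pwDl // sumr_ge0 // => j' _; exact: ltW.
have bi : (0 < b i)%N by exact: cd_b0 cd _ Bi.
have q_mn : 0 < q m n by rewrite lt_neqAle eq_sym qmn q0.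
have m_mn : 0 < mgf m n al by exact: mgf_gt0.
pose beta := l m * (q m n * (2^-1 * mgf m n al)) * c1.
have beta0 : 0 < beta by rewrite !mulr_gt0.
exists (c2 * (c3 * beta / (C * L))); first by rewrite mulr_gt0 // divr_gt0 ?mulr_gt0.
move=> e ee Rv Rv0 R1 HR; have /andP[e_0 ee0] := ee.
have ee' : 0 <= e <= e0 by rewrite (ltW e_0).
apply: le_trans (Hc2 e ee Rv Rv0 R1 HR).
rewrite -[leLHS]mulrA ler_wpM2l ?(ltW c20) //.
set k' := count _ _.
have Hn := Hc1 e ee Rv Rv0 R1 HR; have Hcl := Hc3 e ee Rv Rv0 R1 HR.
pose Y := \sum_(j' | sim q i j') l j' * Rv j'.
have Y1 : c3 * Y <= L * Rv i.
  rewrite /Y mulr_sumr /L mulr_suml; apply: ler_sum => j' ij'.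
  by rewrite mulrCA ler_wpM2l ?(ltW (l0 j')) // Hcl.
have bn : (0 < b n)%N.
  by apply: leq_trans (cd_b0 cd Bg0) (cd_b_acc cd (acc_trans nk kg0)).
(* Transitions within the class return (1 - C e) Y by the left eigenvector; the edge from m to n out
   of the class contributes the second term. *)
have Y2 : (1 - C * e) * Y + beta * e^-1 ^+ k' <= Y.
  apply: (@le_trans _ _ (\sum_(j' | sim q i j') l j' *
      (\sum_m' stopped j' m' * mgf j' m' (al - e) * Rv m'))); last first.
    by apply: ler_sum => j' ij'; rewrite ler_wpM2l ?(ltW (l0 j')) // HR.
  apply: (@le_trans _ _ (\sum_(j' | sim q i j') (l j' *
     (\sum_(m' | sim q i m') q j' m' * ((1 - C * e) * mgf j' m' al) * Rv m') +
     (j' == m)%:R * (beta * e^-1 ^+ k')))).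
    rewrite big_split /= lerD //.
      rewrite (eq_bigr (fun j' => \sum_(m' | sim q i m') (1 - C * e) * (l j' * (q j' m' * mgf j'
        m' al) * Rv m'))); last first.
        by move=> j' _; rewrite mulr_sumr; apply: eq_bigr => m' _; ring.
      rewrite exchange_big /= /Y mulr_sumr le_eqVlt; apply/orP; left; apply/eqP.
      apply: eq_bigr => m' im'; rewrite -mulr_sumr -mulr_suml; congr (_ * (_ * _)).
      have Bm' : basic m' by rewrite -(cd_basic cd im').
      rewrite -(cd_lM cd Bm'); apply: eq_bigl => j'.
      apply/idP/idP => [m'j'|]; last by apply: sim_trans; rewrite sim_sym.
      exact: sim_trans im' m'j'.
    rewrite (bigD1 m) //= eqxx mul1r lerDl sumr_ge0 // => j' _.
    rewrite mulr_ge0 ?ler0n // mulr_ge0 ?(ltW beta0) // exprn_ge0 // invr_ge0.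
    exact: ltW.
  apply: ler_sum => j' ij'.
  have bj' : (0 < b j')%N by rewrite -(b_sim cd ij').
  have Ngj' : ~~ sim q g0 j'.
    by apply: contra Ngi => gj'; apply: sim_trans gj' _; rewrite sim_sym.
  rewrite [in leRHS](bigID (sim q i)) /= mulrDr lerD //.
    rewrite ler_wpM2l ?(ltW (l0 j')) //; apply: ler_sum => m' im'.
    rewrite ler_wpM2r // /stopped bj' -(b_sim cd im') bi Ngj' mul1r ler_wpM2l //.
    exact: (Hm e ee' j' m').1.
  have S0 m' : 0 <= stopped j' m' * mgf j' m' (al - e) * Rv m'.
    by rewrite !mulr_ge0 ?mgf_ge0 ?stopped_ge0.
  have [->|_] := eqVneq j' m; last first.
    by rewrite mul0r mulr_ge0 ?(ltW (l0 j')) // sumr_ge0 // => m' _;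
      rewrite !mulr_ge0 ?mgf_ge0 ?stopped_ge0.
  rewrite mul1r /beta -!mulrA ler_wpM2l ?(ltW (l0 m)) //.
  rewrite (bigD1 n) //= ler_wpDr //.
    by apply: sumr_ge0 => m' _; rewrite !mulr_ge0 ?mgf_ge0 ?stopped_ge0.
  have bm : (0 < b m)%N by rewrite -(b_sim cd im).
  have Ngm : ~~ sim q g0 m.
    by apply: contra Ngi => gm; apply: sim_trans gm _; rewrite sim_sym.
  rewrite /stopped bm bn Ngm mul1r -[leRHS]mulrA ler_wpM2l ?(ltW q_mn) //.
  rewrite mulrA ler_pM ?mulr_ge0 ?invr_ge0 ?(ltW m_mn) ?(ltW c10) ?exprn_ge0 ?invr_ge0 ?(ltW e_0)
    //.
  exact: (Hm e ee' m n).2.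
have Y3 : beta * e^-1 ^+ k' <= C * e * Y by lra.
rewrite exprS (_ : c3 * beta / (C * L) * (e^-1 * e^-1 ^+ k') =
  (c3 / (C * L * e)) * (beta * e^-1 ^+ k')); last first.
  by rewrite !invfM; ring.
have P0 : 0 <= c3 / (C * L * e) by rewrite divr_ge0 ?mulr_ge0 ?(ltW c30) ?(ltW C0) ?(ltW L0) ?(ltW
  e_0).
apply: le_trans (ler_wpM2l P0 Y3) _.
rewrite (_ : c3 / (C * L * e) * (C * e * Y) = c3 * Y / L); last first.
  by field; rewrite !gt_eqF.
by rewrite ler_pdivrMr // [leRHS]mulrC.
Qed.

End CoreLower.

(** [chain_lower] gives Rv j >= c2 e^-n for the Green matrix at al - e. [left_window], used as a
    source on the class of g0, bounds [Rv] by a multiple of exp(al w) u j (- w) and two errors, each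
    at most a quarter of c2 e^-n. *)
Lemma core_lower {d : measure_display} {T : measurableType d} {R : realType}
  (P : probability T R) (I : finType) (X : I -> I -> T -> R)
  (mX : forall i j, measurable_fun [set: T] (X i j))
  (q : I -> I -> R) (al : R) (basic : pred I) (b : I -> nat) (rho r l kap : I -> R)
  (cd : core_data P X q al basic b rho r l kap)
  (a0 : R) (ala0 : al < a0) (fa0 : mgf_finite P X a0) (g0 : I) (Bg0 : basic g0)
  (dd : nat) (i : I) (s : seq I) : (forall i, (b i <= dd)%N) ->
  path (fun i j => acc q i j && ~~ acc q j i) i s -> sim q g0 (last i s) ->
  (count basic (belast i s)).+1 = dd -> forall j, acc q j i ->
  exists c w0 : R, [/\ 0 < c, 1 <= w0 & forall u : I -> R -> \bar R, nnmeas u ->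
    (forall i y, (stepf i y + kernel_op P X q u i y <= u i y)%E) ->
    forall w : R, w0 <= w -> ((c * w ^+ dd.-1 * expR (- (al * w)))%R%:E <= u j (- w)%R)%E].
Proof.
move=> bd ps gs Edd j ji.
have q0 := cd_q0 cd; have al0 := cd_al0 cd.
have fal : mgf_finite P X al.
  by apply: (mgf_finite_le mX) fa0; apply/andP; split; apply: ltW.
pose mgf := mgf P X; pose mgf_finite := mgf_finite P X; pose resolvent := resolvent P X.
rewrite -Edd; set n := count _ _ => /=.
have [km /andP[km0 km1] Hkm] : exists2 c, 0 < c <= 1 & forall i, true -> c <= (kap i)^-1.
  by apply: finite_pos_lower => m _; rewrite invr_gt0 (cd_kap0 cd).
have [Ck Ck1 HCk] : exists2 C, 1 <= C & forall i, kap i <= C by exact: finite_upper.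
have [eL [CL [/andP[eL0 eL1] eLal CL0 Hm]]] := mgf_lipschitz mX cd ala0 fa0.
have [eV [CV [/andP[eV0 eV1] eVal CV0 HV]]] := super_vectors mX cd fal.
pose e0 := Num.min eL eV.
have e00 : 0 < e0 by rewrite lt_min eL0.
have e01 : e0 <= 1 by rewrite ge_min eL1.
have e0al : e0 <= al / 2 by rewrite ge_min eLal.
have e0V : e0 <= eV by rewrite ge_min lexx orbT.
have Hm' e : 0 <= e <= e0 -> forall i j,
    (1 - CL * e) * mgf i j al <= mgf i j (al - e) /\ 2^-1 * mgf i j al <= mgf i j (al - e).
  by move=> /andP[x0 x1]; apply: Hm; rewrite x0 (le_trans x1) // ge_min lexx.
have [c2 c20 Hc2] := chain_lower mX cd ala0 fa0 Bg0 CL0 e0al Hm' ps gs ji.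
(* Bound on the factor of [interp_super] at t = 1/2 on a basic class: half of 1 - 1 / kap i plus
   1/2. *)
pose th := 1 - km / 2.
pose eps := (a0 - al) / 2; have eps0 : 0 < eps by rewrite divr_gt0 // subr_gt0.
(* Makes exp(- b0 / 2) CV 2^n at most c2 / 4, since exp(x) >= x; the power of 2 comes from the super
   vector at e / 2. *)
pose b0 := 8 * CV * 2 ^+ n / c2.
have b00 : 0 < b0 by rewrite divr_gt0 // !mulr_gt0 // exprn_gt0.
(* The second term ensures e = b0 / w <= e0, the third that the constant part of the window,
   weighted by Ck, is at most c2 / 4. *)
pose w0 := 1 + b0 / e0 + 8 * b0 * Ck / (al * c2).
have Ck0 : 0 < Ck by clear -Ck1; lra.
have w01 : 0 <= b0 / e0 by rewrite divr_ge0 // ltW.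
have w02 : 0 <= 8 * b0 * Ck / (al * c2) by exact: divr_ge0 (mulr_ge0 (mulr_ge0 (ler0n _ 8) (ltW
  b00)) (ltW Ck0)) (mulr_ge0 (ltW al0) (ltW c20)).
suff [c1 [c10 Hc1]] : exists c1, 0 < c1 /\ forall u : I -> R -> \bar R, nnmeas u ->
    (forall i y, stepf i y + kernel_op P X q u i y <= u i y)%E ->
    forall i y, sim q g0 i -> y <= 0 -> ((c1 * expR (al * y))%:E <= u i y)%E.
  exists (c1 * c2 / 2 / b0 ^+ n), w0; split.
  - by rewrite !divr_gt0 ?exprn_gt0 // mulr_gt0.
  - by rewrite /w0; clear -w01 w02; lra.
  move=> u nu Hu w ww.
  have wpos : 0 < w by rewrite (lt_le_trans _ ww) // /w0; clear -w01 w02; lra.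
  pose e := b0 / w; have e_0 : 0 < e by rewrite divr_gt0.
  have ee0 : e <= e0.
    rewrite ler_pdivrMr // mulrC -ler_pdivrMr //; apply: le_trans ww.
    by rewrite /w0; clear -w02; lra.
  have e1 : e <= 1 by exact: le_trans e01.
  have eal : e <= al / 2 by exact: le_trans e0al.
  have ei1 : 1 <= e^-1 by rewrite invf_ge1.
  have eCk : 2 * e / al * Ck <= c2 / 4.
    have : 8 * b0 * Ck / (al * c2) <= w by apply: le_trans ww; rewrite /w0; clear -w01; lra.
    rewrite ler_pdivrMr ?mulr_gt0 // => H.
    rewrite (_ : 2 * e / al * Ck = (8 * b0 * Ck) / (4 * al * w)); last first.
      by rewrite /e; field; rewrite !gt_eqF.
    rewrite ler_pdivrMr ?mulr_gt0 //; apply: le_trans H _.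
    by rewrite le_eqVlt; apply/orP; left; apply/eqP; field.
  have ew : e * w = b0 by rewrite /e divfK // gt_eqF.
  pose bb (i : I) : R := (sim q g0 i)%:R.
  have bb0 m : 0 <= bb m by rewrite ler0n.
  have bb1 m : bb m <= 1 by rewrite /bb; case: (sim _ _ _).
  pose st := stopped q b g0; have st0 : forall i j, 0 <= st i j by exact: (stopped_ge0 cd g0).
  have st_zero m k : sim q g0 m -> st m k = 0.
    by move=> gm; rewrite /st /stopped gm /= !andbF mul0r.
  (* Needed at x = e for the existence of [Rv], and at x = e / 2 for the far part of the window. *)
  have super x : 0 < x <= e0 -> exists v, [/\ forall i, 1 <= v i,
      forall i, v i <= CV * x^-1 ^+ n &
      forall i, bb i + \sum_j st i j * mgf i j (al - x) * v j <= v i].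
    move=> /andP[x0 x1]; have xV : 0 < x <= eV by rewrite x0 (le_trans x1).
    have [v [v1 vC Mv]] := HV x xV; exists v; split=> //.
      move=> m; apply: le_trans (vC m) _; rewrite ler_wpM2l ?(ltW CV0) // ler_weXn2l //.
        by rewrite invf_ge1 // (le_trans x1).
      by have := bd m; rewrite -Edd -/n; case: (b m) => [|bm].
    move=> m; rewrite /bb; have [gm|gm] := boolP (sim q g0 m).
      rewrite big1 ?addr0 // => k _; by rewrite st_zero // !mul0r.
    rewrite add0r; have [bm|bm] := ltnP 0 (b m); last first.
      rewrite big1 ?(le_trans ler01) // => k _.
      by rewrite /st /stopped ltnNge bm /= !mul0r.
    apply: le_trans (Mv m bm); rewrite [leRHS]big_mkcond; apply: ler_sum => k _.
    rewrite /st /stopped bm gm andbT /=; case: (0 < b k)%N; rewrite ?mul1r ?mul0r //.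
  have e_in : 0 < e <= e0 by rewrite e_0.
  have e2_in : 0 < e / 2 <= e0 by rewrite divr_gt0 //= (le_trans _ ee0) //; clear -e_0; lra.
  have [v [v1 vC Mv]] := super e e_in.
  have [v2 [v21 v2C Mv2]] := super (e / 2) e2_in.
  have v0 m : 0 <= v m by exact: le_trans ler01 (v1 m).
  have v20 m : 0 <= v2 m by exact: le_trans ler01 (v21 m).
  have [Rv [Rv0 HRv Rlim]] := resolvent_limit st0 bb0 v0 Mv.
  have R1 m : sim q g0 m -> Rv m = 1.
    move=> gm; rewrite HRv big1 ?addr0 /bb ?gm // => k _; by rewrite st_zero // !mul0r.
  have RvS m : \sum_j st m j * mgf m j (al - e) * Rv j <= Rv m by rewrite [leRHS]HRv lerDr.
  have lowR := Hc2 e e_in Rv Rv0 R1 RvS.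
  have fin z : 0 <= z <= al -> mgf_finite z by move=> zz; apply: (mgf_finite_le mX) fal.
  have fe : mgf_finite (al - e).
    by apply: fin; rewrite lerBlDr lerDl (ltW e_0) andbT; clear -eal al0; lra.
  have fe2 : mgf_finite (al - e / 2).
    by apply: fin; apply/andP; clear -eal al0 e_0; split; lra.
  case Eu : (u j (- w)%R) => [uu| |]; last 2 first.
  - by rewrite leey.
  - by have := nu.1 j (- w)%R; rewrite Eu.
  rewrite lee_fin.
  (* The left side is the Green function of F at - w. The terms G1, G2 and G3 of the window are
     bounded by [u], by the super vector at e / 2, and by [kap] respectively. *)
  have key K : resolvent st (al - e) K bb j <=
      expR (al * w) * (c1^-1 * uu) + expR (- (b0 / 2)) * (CV * (e / 2)^-1 ^+ n) + 2 * e / al * Ck.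
    pose F := fun (i : I) (y : R) => ((expR ((al - e) * w))%:E * expf (al - e) bb i y)%E.
    pose G1 := fun (i : I) (y : R) => ((expR (al * w))%:E * leftexpf al bb i y)%E.
    pose G2 := fun (i : I) (y : R) => ((expR (- (b0 / 2)) * expR ((al - e / 2) * w))%:E * expf (al
      - e / 2) bb i y)%E.
    pose G3 := fun (i : I) (y : R) => ((2 * e / al)%:E * expf 0 bb i y)%E.
    have ca0 : 0 <= 2 * e / al by exact: divr_ge0 (mulr_ge0 (ler0n _ 2) (ltW e_0)) (ltW al0).
    have nE z : nnmeas (expf z bb) by exact: expf_nnmeas.
    have nL : nnmeas (leftexpf al bb) by exact: leftexpf_nnmeas.
    have nF : nnmeas F by apply: nnmeasZ => //; exact: expR_ge0.
    have nG1 : nnmeas G1 by apply: nnmeasZ => //; exact: expR_ge0.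
    have nG2 : nnmeas G2 by apply: nnmeasZ => //; rewrite mulr_ge0 ?expR_ge0.
    have nG3 : nnmeas G3 by apply: nnmeasZ.
    have nG12 : nnmeas (fun i y => G1 i y + G2 i y)%E by exact: nnmeasD.
    have : (green P X st K F j (- w) <= green P X st K (fun i y =>
      G1 i y + G2 i y + G3 i y) j (- w))%E.
      apply: (green_mono P mX) => //; first exact: nnmeasD.
      move=> m y; rewrite /F /G1 /G2 /G3 /expf /leftexpf -!EFinM -!EFinD lee_fin.
      have := left_window y al0 e_0 eal wpos; rewrite ew => H.
      have := ler_wpM2r (bb0 m) H => {}H.
      rewrite mul0r expR0 mul1r.
      have E1 : expR ((al - e) * w) * (expR ((al - e) * y) * bb m) = expR ((al - e) * (y + w)) *
        bb m.
        by rewrite mulrA -expRD; congr (expR _ * _); ring.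
      have E2 : expR (al * w) * ((y <= 0)%R%:R * expR (al * y) * bb m) = (y <= 0)%R%:R * expR (al
        * (y + w)) * bb m.
        by rewrite mulrDr expRD; ring.
      have E3 : expR (- (b0 / 2)) * expR ((al - e / 2) * w) * (expR ((al - e / 2) * y) * bb m) =
        expR (- (b0 / 2)) * expR ((al - e / 2) * (y + w)) * bb m.
        by rewrite (mulrDr _ y w) expRD; ring.
      by rewrite E1 E2 E3 -!mulrDl.
    have ex0 x : 0 <= expR x :> R by exact: expR_ge0.
    have ey0 : 0 <= expR (- (b0 / 2)) * expR ((al - e / 2) * w) by rewrite mulr_ge0.
    have f00 : mgf_finite 0 by exact: mgf_finite0.
    have gD f g y : nnmeas f -> nnmeas g -> (green P X st K (fun i y =>
      f i y + g i y) j y = green P X st K f j y + green P X st K g j y)%E.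
      by move=> nf ng; exact: (greenD P mX).
    rewrite (gD _ _ _ nG12 nG3) (gD _ _ _ nG1 nG2).
    have gZ c f y : 0 <= c -> nnmeas f -> (green P X st K (fun i y =>
      c%:E * f i y) j y = c%:E * green P X st K f j y)%E.
      by move=> c0 nf; rewrite (greenZ P mX).
    rewrite /F /G1 /G2 /G3 !gZ //.
    rewrite !(green_expf mX) //.
    (* [u] is a supersolution for the stopped kernel with source c1 * leftexpf: on the class of g0
       the kernel vanishes and c1 bounds [u] from below; elsewhere the source vanishes. *)
    have HL : (green P X st K (leftexpf al bb) j (- w) <= (c1^-1 * uu)%:E)%E.
      have : (green P X st K (fun i y => c1%:E * leftexpf al bb i y) j (- w) <= u j (- w)%R)%E.
        apply: (green_supersolution mX) => //; first by apply: nnmeasZ => //; exact: ltW.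
        move=> m y; have k0 := (kernel_op_nnmeas P mX st0 nu).1 m y.
        have [gm|gm] := boolP (sim q g0 m).
          rewrite (_ : kernel_op P X st u m y = 0%E) ?adde0; last first.
            by apply: big1 => k _; rewrite st_zero // mul0e.
          rewrite /leftexpf /bb gm mulr1 -EFinM; have [y0|y0] := leP y 0.
            by rewrite mul1r; exact: Hc1.
          by rewrite mul0r mulr0; exact: nu.1.
        rewrite /leftexpf /bb (negbTE gm) mulr0 mule0 add0e.
        apply: le_trans (Hu m y); rewrite (le_trans _ (leeDr _ _)) //; last first.
          by rewrite lee_fin ler0n.
        by apply: (kernel_op_le P mX) => // m' k'; rewrite st0 (stopped_le cd g0).
      rewrite (greenZ P mX) ?(ltW c10) // Eu muleC -lee_pdivlMr // => H.
      by rewrite mulrC EFinM.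
    have e1' : 0 <= expR (al * w) by exact: expR_ge0.
    move=> H; have {H} := le_trans H (leeD (leeD (lee_wpmul2l _ HL) (lexx _)) (lexx _)).
    rewrite lee_fin => /(_ e1'); rewrite /expf -!EFinM -!EFinD lee_fin.
    rewrite [X in X <= _ -> _](_ : _ = resolvent st (al - e) K bb j); last first.
      by rewrite /resolvent mulrN !expRN; field; rewrite !gt_eqF ?expR_gt0.
    move=> /le_trans; apply.
    rewrite mul0r expR0 mul1r -!addrA lerD2l lerD //.
      rewrite [leLHS](_ : _ = expR (- (b0 / 2)) * resolvent st (al - e / 2) K bb j); last first.
        by rewrite /resolvent mulrN !expRN; field; rewrite !gt_eqF ?expR_gt0.
      rewrite ler_wpM2l ?expR_ge0 //; apply: le_trans (v2C j).
      exact: resolvent_le.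
    rewrite ler_wpM2l //; apply: le_trans (HCk j).
    apply: resolvent_le => //; first by move=> m; rewrite ltW // (cd_kap0 cd).
    move=> m; apply: le_trans (cd_kap cd m); rewrite lerD //; apply: ler_sum => k _.
    by rewrite mgf0 mulr1 ler_wpM2r ?(stopped_le cd g0) // ltW // (cd_kap0 cd).
  have := le_trans lowR (Rlim j _ key); rewrite -/n.
  have E0 : 0 < e^-1 ^+ n by rewrite exprn_gt0 // invr_gt0.
  have En1 : 1 <= e^-1 ^+ n by rewrite exprn_ege1.
  have M1 : expR (- (b0 / 2)) * (CV * (e / 2)^-1 ^+ n) <= c2 / 4 * e^-1 ^+ n.
    rewrite invfM invrK exprMn (mulrC (e^-1 ^+ n)) !mulrA ler_wpM2r ?(ltW E0) //.
    rewrite expRN -mulrA mulrC ler_pdivrMr ?expR_gt0 //.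
    have : 1 + b0 / 2 <= expR (b0 / 2) by exact: expR_ge1Dx.
    have : c2 / 4 * (b0 / 2) = CV * 2 ^+ n by rewrite /b0; field; rewrite gt_eqF.
    move=> <- H; rewrite ler_wpM2l ?divr_ge0 ?(ltW c20) // (le_trans _ H) //.
    by rewrite lerDr.
  have M2 : c2 / 4 <= c2 / 4 * e^-1 ^+ n by rewrite ler_peMr // divr_ge0 // ltW.
  move=> H.
  have {H} : c2 / 2 * e^-1 ^+ n <= expR (al * w) * (c1^-1 * uu).
    by clear -H M1 M2 eCk; lra.
  rewrite [e^-1]invfM invrK exprMn => H.
  have p0 : 0 <= c1 * expR (- (al * w)) by rewrite mulr_ge0 ?expR_ge0 // ltW.
  have := ler_wpM2l p0 H.
  rewrite [X in _ <= X -> _](_ : _ = uu); last first.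
    by rewrite expRN; field; rewrite !gt_eqF ?expR_gt0.
  apply: le_trans; rewrite le_eqVlt; apply/orP; left; apply/eqP.
  by rewrite exprVn; ring.
have g0l m : sim q g0 m -> \sum_(j | sim q g0 j) q m j * mgf m j al * r j = r m.
  move=> gm; rewrite (eq_bigl (sim q m)); last first.
    move=> k; apply/idP/idP; last exact: sim_trans.
    by apply: sim_trans; rewrite sim_sym.
  by rewrite (cd_Mr cd) (cd_rho1 cd) ?mul1r // -(cd_basic cd gm).
have half01 : 0 <= (2^-1 : R) <= 1 by clear; lra.
have Hint m : sim q g0 m -> \sum_(j | sim q g0 j) q m j * mgf m j (al / 2) * interp r kap 2^-1 j <=
    th * interp r kap 2^-1 m.
  move=> gm; rewrite (eq_bigl (sim q m)); last first.
    move=> k; apply/idP/idP; last exact: sim_trans.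
    by apply: sim_trans; rewrite sim_sym.
  have := interp_super mX cd fal m half01; rewrite [2^-1 * al]mulrC => /le_trans; apply.
  rewrite ler_wpM2r ?(ltW (interp_gt0 _ _ _ _)) //.
  rewrite (cd_rho1 cd) -?(cd_basic cd gm) //.
  by have := Hkm m isT; rewrite /th; clear; lra.
have th01 : 0 <= th < 1 by rewrite /th; clear -km0 km1; lra.
have ee : al + 2 * eps <= a0 by rewrite /eps; clear; lra.
have k0 m : 0 <= kap m by rewrite ltW // (cd_kap0 cd).
exact: (single_class_lower mX q0 al0 eps0 ee fa0 k0 (cd_kap cd) (cd_r0 cd) g0l th01
  (fun m => interp_gt0 _ _ _ _) Hint).
Qed.

(** * Independent sums *)

Section Independence.
Context {d : measure_display} {T : measurableType d} {R : realType}.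
Variable (P : probability T R).
Local Open Scope ereal_scope.

(** Conditionally on [H], the law of the pair agrees with the product of the marginals on
    rectangles, hence everywhere. [H] stands for the other events carried along in
    [path_sum_indep]. *)
Lemma independent_pair (Z Y : T -> R) (H : set T) :
  measurable_fun [set: T] Z -> measurable_fun [set: T] Y -> measurable H ->
  (forall A B : set R, measurable A -> measurable B ->
    P (Z @^-1` A `&` Y @^-1` B `&` H) = P (Z @^-1` A) * P (Y @^-1` B) * P H) ->
  forall C : set (R * R), measurable C ->
    P ([set x | C (Z x, Y x)] `&` H) = P H * \int[P]_x P [set x' | C (Z x, Y x')].
Proof.
move=> mZ mY mH indep C mC.
have mZY : measurable_fun [set: T] (fun x => (Z x, Y x)) by exact/measurable_fun_pair.
have mpre (A : set (R * R)) : measurable A -> measurable [set x | A (Z x, Y x)].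
  by move=> mA; rewrite -[X in measurable X]setTI; exact: mZY.
have [H0|H0] := eqVneq (P H) 0.
  rewrite H0 mul0e; apply/eqP; rewrite -measure_le0 -H0.
  by apply: le_measure; rewrite ?inE //; apply: measurableI => //; exact: mpre.
pose Zp : {mfun T >-> R} := HB.pack Z (isMeasurableFun.Build _ _ _ _ _ mZ).
pose Yp : {mfun T >-> R} := HB.pack Y (isMeasurableFun.Build _ _ _ _ _ mY).
have Hf : P H \is a fin_num by exact: fin_num_measure.
have PH : (0 < fine (P H))%R by rewrite fine_gt0 // lt_neqAle eq_sym H0 measure_ge0 -ge0_fin_numE.
have ih0 : (0 <= (fine (P H))^-1)%R by rewrite invr_ge0 ltW.
pose HP := mrestr P mH.
pose m' := mscale (NngNum ih0) (pushforward HP (fun x => (Z x, Y x))).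
have E A : m' mZY A = ((fine (P H))^-1)%:E * P ([set x | A (Z x, Y x)] `&` H) by [].
have := @product_measure_unique _ _ _ _ R (distribution P Zp) (distribution P Yp) (m' mZY).
have rect A B : measurable A -> measurable B ->
    m' mZY (A `*` B) = distribution P Zp A * distribution P Yp B.
  move=> mA mB; rewrite E /=.
  rewrite [[set x | _]](_ : _ = Z @^-1` A `&` Y @^-1` B); last by [].
  rewrite indep // muleC -[X in _ * X * _]fineK // -muleA -EFinM divff ?mule1 //.
  by rewrite gt_eqF.
move=> /(_ rect C mC); rewrite [X in _ = X -> _](_ : _ = ((fine (P H))^-1)%:E * P ([set x | C (Z
  x, Y x)] `&` H)); last by [].
move=> EC.
have -> : P ([set x | C (Z x, Y x)] `&` H) =
    P H * (((fine (P H))^-1)%:E * P ([set x | C (Z x, Y x)] `&` H)).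
  rewrite -[X in _ = X * _]fineK // muleA -EFinM divff ?mul1e //.
  by rewrite gt_eqF.
rewrite -EC /product_measure1 /= ge0_integral_distribution //; last exact: measurable_fun_xsection.
congr (_ * _); apply: eq_integral => x _ /=; rewrite /distribution /pushforward /=.
by congr (P _); apply/seteqP; split => y /=; rewrite /xsection /= inE.
Qed.

End Independence.

Section PathSums.
Context {d : measure_display} {T : measurableType d} {R : realType}.
Variables (P : probability T R) (I : finType) (E : nat -> I -> I -> T -> R).
Variable F : nat -> set (set T).
Hypotheses (mE : forall t i j, measurable_fun [set: T] (E t i j))
  (FM : forall t A, F t A -> measurable A)
  (FE : forall t i j A, measurable A -> F t (E t i j @^-1` A))
  (indF : mutually_independent P F)
  (lawE : forall t i j A, measurable A -> P (E t i j @^-1` A) = P (E 0 i j @^-1` A)).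
Local Open Scope ereal_scope.

Fixpoint path_sum t i p (x : T) : R :=
  if p is j :: p' then (E t i j x + path_sum t.+1 j p' x)%R else 0%R.

Lemma path_sum_measurable t i p : measurable_fun [set: T] (path_sum t i p).
Proof.
elim: p t i => [|j p IH] t i /=; first exact: measurable_cst.
by apply: measurable_funD; [exact: mE|exact: IH].
Qed.

(** The earlier events G make the induction on [p] possible: the event on the increment at time t
    becomes one more of them before the tail of the path is treated. *)
Lemma path_sum_indep p t i s A (G : nat -> set T) : uniq s -> all (ltn^~ t) s ->
  (forall r, r \in s -> F r (G r)) -> measurable A ->
  P (path_sum t i p @^-1` A `&` \bigcap_(r in [set` s]) G r) =
    P (path_sum t i p @^-1` A) * \prod_(r <- s) P (G r).
Proof.
elim: p t i s A G => [|j p IH] t i s A G us st FG mA.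
  rewrite -indF //; have [A0|A0] := pselect (A 0%R).
    rewrite (_ : _ @^-1` A = setT) ?setTI ?probability_setT ?mul1e //.
    by apply/seteqP; split.
  rewrite (_ : _ @^-1` A = set0) ?set0I ?measure0 ?mul0e //.
  by apply/seteqP; split.
pose Z := E t i j; pose Y := path_sum t.+1 j p.
have mY : measurable_fun [set: T] Y by exact: path_sum_measurable.
have rect s' (us' : uniq s') (st' : all (ltn^~ t) s') (FG' : forall r, r \in s' -> F r (G r))
    (B C : set R) : measurable B -> measurable C ->
    P (Z @^-1` B `&` Y @^-1` C `&` \bigcap_(r in [set` s']) G r) =
    P (Z @^-1` B) * P (Y @^-1` C) * P (\bigcap_(r in [set` s']) G r).
  move=> mB mC; pose G' r := if r == t then Z @^-1` B else G r.
  have ts : t \notin s' by apply/negP => /(allP st'); rewrite /= ltnn.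
  have G's r : r \in s' -> G' r = G r.
    by rewrite /G'; case: eqP => // ->; rewrite (negbTE ts).
  have := IH t.+1 j (t :: s') C G'; rewrite /= ts us' ltnSn /=.
  have st'' : all (ltn^~ t.+1) s' by apply: sub_all st' => r /= rt; exact: ltnW.
  have FG'' r : r \in t :: s' -> F r (G' r).
    rewrite inE => /predU1P[->|rs]; first by rewrite /G' eqxx; exact: FE.
    by rewrite G's //; exact: FG'.
  move=> /(_ isT st'' FG'' mC); rewrite big_cons (_ : G' t = Z @^-1` B); last by rewrite /G' eqxx.
  rewrite (eq_big_seq (fun r => P (G r))) => [|r rs]; last by rewrite G's.
  rewrite -(indF us' FG') => H.
  rewrite -muleA muleCA -H; congr (P _); apply/seteqP; split => x.
    move=> [[Zx Yx] Gx]; split => // r /=; rewrite inE => /predU1P[->|rs].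
      by rewrite /G' eqxx.
    by rewrite G's //; exact: Gx.
  move=> [Yx Gx]; split; last first.
    by move=> r /= rs; rewrite -G's //; apply: Gx; rewrite /= inE rs orbT.
  split => //; have := Gx t; rewrite /G' eqxx; apply.
  by rewrite /= inE eqxx.
have mH (s' : seq nat) : (forall r, r \in s' -> F r (G r)) -> measurable (\bigcap_(r in [set` s'])
  G r).
  by move=> FG'; apply: bigcap_measurableType => r rs; apply: FM; exact: FG'.
pose C : set (R * R) := [set z | A (z.1 + z.2)%R].
have mC : measurable C.
  rewrite -[C]setTI; apply: (_ : measurable_fun setT (fun z : R * R => z.1 + z.2)%R) => //.
  exact: measurable_funD.
have := independent_pair (mE t i j) mY (mH s FG) (rect s us st FG) mC.
have FG0 r : r \in [::] -> F r (G r) by [].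
have := independent_pair (mE t i j) mY (mH [::] FG0) (rect [::] isT isT FG0) mC.
rewrite set_nil bigcap_set0 setIT probability_setT mul1e.
by rewrite (indF us FG) => <-; rewrite muleC.
Qed.

Lemma path_sum_cons t i j p (C : set (R * R)) : measurable C ->
  P [set x | C (E t i j x, path_sum t.+1 j p x)] =
    \int[P]_x P [set x' | C (E t i j x, path_sum t.+1 j p x')].
Proof.
move=> mC.
have := @independent_pair _ _ _ P (E t i j) (path_sum t.+1 j p) setT (mE t i j)
  (path_sum_measurable _ _ _) measurableT _ C mC.
rewrite setIT probability_setT mul1e; apply => A B mA mB.
rewrite setIT mule1.
have := @path_sum_indep p t.+1 j [:: t] B (fun _ => E t i j @^-1` A) isT.
rewrite /= ltnSn => /(_ isT) H; rewrite setIC muleC.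
have {H} := H _ mB; rewrite big_seq1 set_cons1 bigcap_set1; apply.
by move=> r; rewrite inE => /eqP ->; exact: FE.
Qed.

Lemma law_integral t i j (f : R -> \bar R) y : measurable_fun [set: R] f -> (forall z, 0 <= f z) ->
  \int[P]_x f (y + E t i j x)%R = \int[P]_x f (y + E 0 i j x)%R.
Proof.
move=> mf f0; have mg : measurable_fun [set: R] (fun z => f (y + z)%R).
  by apply: measurableT_comp mf _; apply: measurable_funD.
pose Z k : {mfun T >-> R} := HB.pack (E k i j) (isMeasurableFun.Build _ _ _ _ _ (mE k i j)).
have G k : \int[P]_x f (y + E k i j x)%R = \int[distribution P (Z k)]_z f (y + z)%R.
  by rewrite ge0_integral_distribution.
rewrite !G; apply: eq_measure_integral => A mA _; exact: lawE.
Qed.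

(** The increments at successive times are replaced by the law at time 0, which matches one
    application of [kernel_op] per step; [path_sum_tail] justifies this. *)
Fixpoint path_tail i p (y : R) : \bar R :=
  if p is j :: p' then \int[P]_x path_tail j p' (y + E 0 i j x)%R else (0 < y)%R%:R%:E.

Lemma path_tail_ge0 i p y : 0 <= path_tail i p y.
Proof.
case: p => [|j p] /=; first by rewrite lee_fin ler0n.
elim: p i j y => [|k p IH] i j y; apply: integral_ge0 => x _ /=; first by rewrite lee_fin ler0n.
exact: IH.
Qed.

Lemma path_tail_measurable i p : measurable_fun [set: R] (path_tail i p).
Proof.
elim: p i => [|j p IH] i.
  by have := (@stepf_nnmeas R I).2 i.
pose f (z : R * T) := path_tail j p (z.1 + E 0 i j z.2)%R.
have mf : measurable_fun [set: R * T] f.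
  apply: measurableT_comp (IH j) _; apply: measurable_funD => //.
  by apply: measurableT_comp => //; exact: mE.
exact: (@measurable_fun_fubini_tonelli_F _ _ _ _ _ P f mf (fun z => path_tail_ge0 _ _ _)).
Qed.

Lemma path_sum_tail t i p y : P [set x | (0 < y + path_sum t i p x)%R] = path_tail i p y.
Proof.
elim: p t i y => [|j p IH] t i y /=.
  rewrite addr0; case: ltP => _; rewrite ?mulr1n ?mulr0n.
    by rewrite -[RHS](probability_setT P); congr (P _); apply/seteqP; split.
  by rewrite -[RHS](measure0 P); congr (P _); apply/seteqP; split.
pose C : set (R * R) := [set z | (0 < y + (z.1 + z.2))%R].
have mC : measurable C.
  have mg : measurable_fun [set: R * R] (fun z => y + (z.1 + z.2))%R.
    by apply: measurable_funD => //; exact: measurable_funD.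
  have := mg measurableT `]0%R, +oo[%classic (measurable_itv _); rewrite setTI.
  congr measurable; apply/seteqP; split => z /=; rewrite /C /= in_itv /= andbT //.
rewrite [LHS](path_sum_cons t i j p mC).
rewrite -(law_integral t) //; last by move=> z; exact: path_tail_ge0.
  by apply: eq_integral => x _; rewrite -(IH t.+1); congr (P _); apply/seteqP; split => z /=;
    rewrite /C /= addrA.
exact: path_tail_measurable.
Qed.

Fixpoint paths k : seq (seq I) :=
  if k is k'.+1 then [seq j :: p | j <- enum I, p <- paths k'] else [:: [::]].

Lemma big_paths k (f : seq I -> \bar R) :
  \sum_(p <- paths k.+1) f p = \sum_j \sum_(p <- paths k) f (j :: p).
Proof. by rewrite /= big_allpairs_dep big_enum. Qed.

Variable q : I -> I -> R.
Hypothesis q0 : forall i j, (0 <= q i j)%R.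

Fixpoint path_weight i p : R :=
  if p is j :: p' then (q i j * path_weight j p')%R else 1%R.

Lemma path_weight_ge0 i p : (0 <= path_weight i p)%R.
Proof. by elim: p i => [|j p IH] i //=; rewrite mulr_ge0. Qed.

Lemma iter_kernel_op_paths k i y :
  iter k (kernel_op P (E 0) q) (@stepf R I) i y =
    \sum_(p <- paths k) (path_weight i p)%:E * path_tail i p y.
Proof.
elim: k i y => [|k IH] i y; first by rewrite /= big_seq1 mul1e.
rewrite big_paths iterS /kernel_op; apply: eq_bigr => j _ /=.
transitivity ((q i j)%:E * \int[P]_x
    \sum_(p <- paths k) (path_weight j p)%:E * path_tail j p (y + E 0 i j x)%R).
  by congr (_ * _); apply: eq_integral => x _; rewrite IH.
have mt p : measurable_fun [set: T] (fun x => path_tail j p (y + E 0 i j x)%R).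
  by apply: measurableT_comp (path_tail_measurable j p) _; apply: measurable_funD => //; exact: mE.
have t0 p z : 0 <= path_tail j p z by exact: path_tail_ge0.
have w0 p : 0 <= (path_weight j p)%:E by rewrite lee_fin path_weight_ge0.
rewrite ge0_integral_sum //; last 2 first.
- by move=> p; apply: measurable_funeM.
- by move=> p x _; rewrite mule_ge0.
rewrite ge0_sume_distrr; last by move=> p _; apply: integral_ge0 => x _; rewrite mule_ge0.
apply: eq_bigr => p _; rewrite ge0_integralZl_EFin //; last exact: path_weight_ge0.
by rewrite muleA -EFinM.
Qed.

Lemma survival_paths k i :
  \sum_(p <- paths k) (path_weight i p)%:E = (survival q k i)%:E.
Proof.
elim: k i => [|k IH] i; first by rewrite big_seq1.
rewrite big_paths /= -sumEFin; apply: eq_bigr => j _.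
by rewrite EFinM -IH ge0_sume_distrr // => p _; rewrite lee_fin path_weight_ge0.
Qed.

End PathSums.

(** * Decomposition at the last reset *)

Lemma sigma_of_preimage {I U : Type} {d} {S : measurableType d} (f : I -> U -> S) i B :
  measurable B -> sigma_of f (f i @^-1` B).
Proof.
by move=> mB; apply: sub_sigma_algebra; exists i => //; exists B => //; rewrite setTI.
Qed.

Section SigmaOf.
Context {I : Type} {d} {T : measurableType d} {d'} {S : measurableType d'}.
Implicit Types f : I -> T -> S.

Lemma sigma_ofI f A B : sigma_of f A -> sigma_of f B -> sigma_of f (A `&` B).
Proof. exact: (@measurableI _ (g_sigma_algebraType _)). Qed.

Lemma sigma_of_sub f (G : set (set T)) : sigma_algebra setT G ->
  (forall i B, measurable B -> G (f i @^-1` B)) -> sigma_of f `<=` G.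
Proof.
move=> sG fG; apply: smallest_sub => // A [i _ [B mB <-]].
by rewrite setTI; exact: fG.
Qed.

Lemma sigma_of_measurable f : (forall i, measurable_fun [set: T] (f i)) ->
  sigma_of f `<=` measurable.
Proof.
move=> mf; apply: sigma_of_sub; first exact: sigma_algebra_measurable.
by move=> i B mB; rewrite -[X in measurable X]setTI; exact: mf.
Qed.

End SigmaOf.

Lemma sigma_of_comp {I J : Type} {d} {T : measurableType d} {d'} {S : measurableType d'}
    (f : I -> T -> S) (h : J -> I) : sigma_of (fun j => f (h j)) `<=` sigma_of f.
Proof.
apply: sigma_of_sub; first exact: smallest_sigma_algebra.
by move=> j B mB; exact: sigma_of_preimage.
Qed.

Section Partition.
Context {d : measure_display} {T : measurableType d} {R : realType}.
Variable P : probability T R.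
Local Open Scope ereal_scope.

Lemma measure_partition m (f : T -> 'I_m) A : (forall k, measurable [set x | f x = k]) ->
  measurable A -> P A = \sum_k P (A `&` [set x | f x = k]).
Proof.
move=> mf mA; rewrite -measure_bigsetU_ord; last 2 first.
- by move=> k; exact: measurableI.
- by apply/trivIsetP => i j _ _ /eqP ij; apply/seteqP; split => x // -[[_ /= fi] [_ /= fj]];
  apply: ij; rewrite -fi.
congr (P _); apply/seteqP; split => x.
  move=> Ax; rewrite (bigD1 (f x)) //=; left; split => //.
by elim/big_ind : _ => // [B C HB HC [/HB|/HC]|k _ []].
Qed.

Lemma measure_split (f : T -> bool) A : measurable [set x | f x] ->
  measurable A -> P A = P (A `&` [set x | f x = true]) + P (A `&` [set x | f x = false]).
Proof.
move=> mf mA; rewrite -measureU.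
- congr (P _); apply/seteqP; split => x; last by case=> -[].
  by move=> Ax; case: (boolP (f x)) => [|/negbTE] fx; [left|right].
- exact: measurableI.
- apply: measurableI => //; rewrite (_ : [set _ | _] = ~` [set x | f x]).
    exact: measurableC.
  by apply/seteqP; split => x /=; [move=> ->|move/negP/negbTE].
- by apply/seteqP; split => x // -[[_ /= ->] []].
Qed.

End Partition.

Section Modulation.
Context {d : measure_display} {T : measurableType d} {R : realType}.
Variables (P : probability T R) (n : nat).
Local Notation N := n.+1.
Variables (Pi Ups : 'M[R]_N) (varpi : 'cV[R]_N) (eps : nat -> T -> 'M[R]_N).
Variables (W : nat -> T -> R) (V : nat -> T -> bool) (J : nat -> T -> 'I_N).
Hypothesis model : reset_chain P Pi Ups varpi eps W V J.
Local Open Scope ereal_scope.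

Definition survive (i j : 'I_N) : R := (Pi i j * Ups i j)%R.
Local Notation q := survive.
Local Notation past s := (sigma_of (fun r : 'I_s.+1 => fun x => (V r x, J r x))).
Local Notation VJ t := (fun x => (V t x, J t x)).

Lemma survive_ge0 i j : (0 <= q i j)%R.
Proof. by rewrite mulr_ge0 ?(rc_Pi_ge0 model) //; case/andP: (rc_Ups01 model i j). Qed.

Definition modstate t u i : set T := [set x | V t x = u /\ J t x = i].

Lemma modstateE t u i : modstate t u i = VJ t @^-1` ([set u] `*` [set i]).
Proof. by apply/seteqP; split => x. Qed.

Lemma mVJ t : measurable_fun [set: T] (VJ t).
Proof. exact: (rc_markovVJ model).1. Qed.

Lemma measurable_state u i : measurable ([set u] `*` [set i] : set (bool * 'I_N)).
Proof. exact: measurableX. Qed.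

Lemma past_modstate s t u i : (t <= s)%N -> past s (modstate t u i).
Proof.
move=> ts; rewrite modstateE.
have := @sigma_of_preimage _ _ _ _ (fun r : 'I_s.+1 => VJ r) (Ordinal (ts : (t < s.+1)%N)).
by apply; exact: measurable_state.
Qed.

Lemma pastS s : past s `<=` past s.+1.
Proof.
exact: (@sigma_of_comp _ _ _ T _ _ (fun r : 'I_s.+2 => VJ r) (fun r : 'I_s.+1 =>
  widen_ord (leqnSn _) r)).
Qed.

Lemma past_all s : past s `<=` sigma_of (fun t => VJ t).
Proof. exact: (@sigma_of_comp _ _ _ T _ _ (fun t => VJ t) (fun r : 'I_s.+1 => val r)). Qed.

Lemma past_measurable s : past s `<=` measurable.
Proof. by apply: sigma_of_measurable => r; exact: mVJ. Qed.

Lemma measurable_modstate t u i : measurable (modstate t u i).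
Proof. by apply: (@past_measurable t); exact: past_modstate. Qed.

Lemma measurable_V t : measurable [set x | V t x].
Proof.
have mB : measurable ([set true] `*` setT : set (bool * 'I_N)) by exact: measurableX.
have := @mVJ t measurableT _ mB.
by rewrite setTI; congr measurable; apply/seteqP; split => x //= -[].
Qed.

Lemma measurable_J t i : measurable [set x | J t x = i].
Proof.
have mB : measurable (setT `*` [set i] : set (bool * 'I_N)) by exact: measurableX.
have := @mVJ t measurableT _ mB.
by rewrite setTI; congr measurable; apply/seteqP; split => x //= -[].
Qed.

(** The transition kernel depends on the present state only, so it is constant on [modstate s u i],
    and a probability known given this state holds given any past event inside it. *)
Lemma markov_step s u i B p E : measurable B -> past s E -> E `<=` modstate s u i ->
  P (modstate s u i `&` VJ s.+1 @^-1` B) = p%:E * P (modstate s u i) ->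
  P (E `&` VJ s.+1 @^-1` B) = p%:E * P E.
Proof.
move=> mB pE sE; have [k Hk] := (rc_markovVJ model).2 s.
have K A : past s A -> A `<=` modstate s u i ->
    P (A `&` VJ s.+1 @^-1` B) = k (u, i) B * P A.
  move=> pA sA; rewrite (Hk A B) //.
  rewrite (eq_integral (fun=> k (u, i) B)); last first.
    by move=> x; rewrite inE => /sA[-> ->].
  by rewrite integral_cst //; exact: past_measurable pA.
rewrite !K //; last exact: past_modstate.
have [E0 _|E0 H] := eqVneq (P E) 0; first by rewrite E0 !mule0.
congr (_ * _); move: H; have S0 : 0 < P (modstate s u i).
  apply: lt_le_trans (_ : P E <= _); first by rewrite lt_neqAle eq_sym E0 measure_ge0.
  by rewrite le_measure ?inE //; [exact: past_measurable pE|exact: measurable_modstate].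
have Sf : P (modstate s u i) \is a fin_num by apply: fin_num_measure; exact: measurable_modstate.
move/(congr1 (fun z => z * ((fine (P (modstate s u i)))^-1)%:E)).
suff Hc c : c * P (modstate s u i) * ((fine (P (modstate s u i)))^-1)%:E = c by rewrite !Hc.
 rewrite -muleA -{1}(fineK Sf) -EFinM divff ?mule1 //.
by rewrite gt_eqF // fine_gt0 // S0 ltey_eq Sf.
Qed.

Lemma fine_prob (A : set T) : measurable A -> P A = (fine (P A))%:E.
Proof. by move=> mA; rewrite fineK // fin_num_measure. Qed.

(** The normalizing sum in [rc_J] is the probability in [rc_V] and cancels. Conditioning on null
    events is excluded in both, hence the separate cases. *)
Lemma transition_stay s u i j : (0 < s)%N ->
  P (modstate s u i `&` modstate s.+1 false j) = (q i j)%:E * P (modstate s u i).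
Proof.
move=> s0; have mS := measurable_modstate s u i.
have [S0|S0] := eqVneq (P (modstate s u i)) 0.
  rewrite S0 mule0; apply/eqP; rewrite -measure_le0 -S0 le_measure ?inE //.
  by apply: measurableI => //; exact: measurable_modstate.
have SV := rc_V model s0 S0.
pose E1 := [set x | [/\ V s.+1 x = false, V s x = u & J s x = i]].
have E1E : [set x | V s.+1 x = false] `&` [set x | V s x = u /\ J s x = i] = E1.
  by apply/seteqP; split => x /=; [move=> [? []]|move=> []].
have mE1 : measurable E1.
  rewrite -E1E; apply: measurableI mS; rewrite (_ : [set _ | _] = ~` [set x | V s.+1 x]).
    by apply: measurableC; exact: measurable_V.
  by apply/seteqP; split => x /=; [move=> ->|move/negP/negbTE].
have f0 : (0 < fine (P (modstate s u i)))%R.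
  by rewrite fine_gt0 // lt_neqAle eq_sym S0 measure_ge0 /= -ge0_fin_numE // fin_num_measure.
have PE1 : fine (P E1) = ((\sum_k q i k) * fine (P (modstate s u i)))%R.
  by rewrite -[X in (X * _)%R]SV /cond_prob E1E divfK // gt_eqF.
have LE : modstate s u i `&` modstate s.+1 false j = [set x | J s.+1 x = j] `&` E1.
  by apply/seteqP; split => x /=; [move=> [[? ?] []]|move=> [? []]].
rewrite LE; have mL : measurable ([set x | J s.+1 x = j] `&` E1).
  by apply: measurableI => //; exact: measurable_J.
rewrite (fine_prob mL) (fine_prob mS) -EFinM; congr _%:E.
have [Z|Z] := eqVneq (P E1) 0.
  have -> : P ([set x | J s.+1 x = j] `&` E1) = 0.
    by apply/eqP; rewrite -measure_le0 -Z le_measure ?inE.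
  move/eqP : PE1; rewrite Z eq_sym mulf_eq0 (gt_eqF f0) orbF psumr_eq0; last first.
    by move=> k _; exact: survive_ge0.
  by move=> /allP/(_ j (mem_index_enum j)) /eqP ->; rewrite mul0r.
have := rc_J model j s0 Z; rewrite /cond_prob -/E1 PE1.
have q0 : (\sum_k q i k != 0)%R.
  apply: contraNneq Z => q0; rewrite (fine_prob mE1) PE1 q0 mul0r //.
move=> /(congr1 ( *%R^~ ((\sum_k q i k) * fine (P (modstate s u i)))%R)).
rewrite divfK ?mulf_neq0 ?(gt_eqF f0) // => ->.
by rewrite mulrA divfK.
Qed.

Lemma transition_reset s u i j : (0 < s)%N ->
  P (modstate s u i `&` modstate s.+1 true j) =
  (varpi j 0)%:E * P (modstate s u i `&` [set x | V s.+1 x]).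
Proof.
move=> s0; have mS := measurable_modstate s u i.
pose E1 := [set x | [/\ V s.+1 x = true, V s x = u & J s x = i]].
have E1E : modstate s u i `&` [set x | V s.+1 x] = E1.
  by apply/seteqP; split => x /=; [move=> [[]]|move=> []].
have mE1 : measurable E1 by rewrite -E1E; apply: measurableI => //; exact: measurable_V.
have LE : modstate s u i `&` modstate s.+1 true j = [set x | J s.+1 x = j] `&` E1.
  by apply/seteqP; split => x /=; [move=> [[? ?] []]|move=> [? []]].
rewrite E1E LE; have mL : measurable ([set x | J s.+1 x = j] `&` E1).
  by apply: measurableI => //; exact: measurable_J.
have [Z|Z] := eqVneq (P E1) 0.
  by rewrite Z mule0; apply/eqP; rewrite -measure_le0 -Z le_measure ?inE.
have := rc_J model j s0 Z; rewrite /cond_prob -/E1 => <-.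
rewrite (fine_prob mL) (fine_prob mE1) /= -EFinM divfK //.
by apply: contraNneq Z => Z; rewrite (fine_prob mE1) Z.
Qed.

Fixpoint follow s p (x : T) : Prop :=
  if p is j :: p' then (V s.+1 x = false /\ J s.+1 x = j) /\ follow s.+1 p' x else True.

Fixpoint noreset s k (x : T) : Prop :=
  if k is k'.+1 then V s.+1 x = false /\ noreset s.+1 k' x else True.

Lemma past_follow s p E : past s E -> past (s + size p) (E `&` follow s p).
Proof.
elim: p s E => [|j p IH] s E pE /=.
  rewrite addn0; have -> // : E `&` [set x | True] = E.
  by rewrite setIT.
have := IH s.+1 (E `&` modstate s.+1 false j).
rewrite addSnnS; have -> : E `&` modstate s.+1 false j `&` follow s.+1 p =
    E `&` [set x | (V s.+1 x = false /\ J s.+1 x = j) /\ follow s.+1 p x].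
  by apply/seteqP; split => x /=; [move=> [[? []]]|move=> [? [[]]]].
by apply; apply: sigma_ofI; [exact: pastS|exact: past_modstate].
Qed.

Lemma follow_prob s u i p E : (0 < s)%N -> past s E -> E `<=` modstate s u i ->
  P (E `&` follow s p) = (path_weight q i p)%:E * P E.
Proof.
elim: p s u i E => [|j p IH] s u i E s0 pE sE /=.
  by rewrite mul1e; congr (P _); apply/seteqP; split => x // [].
have -> : E `&` [set x | (V s.+1 x = false /\ J s.+1 x = j) /\ follow s.+1 p x] =
    E `&` modstate s.+1 false j `&` follow s.+1 p.
  by apply/seteqP; split => x /=; [move=> [? [[]]]|move=> [[? []]]].
rewrite (IH s.+1 false j) //; last by apply: sigma_ofI; [exact: pastS|exact: past_modstate].
rewrite modstateE (markov_step _ pE sE (p := q i j)) //; first by rewrite muleCA muleA -EFinM mulrC.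
  exact: measurable_state.
by rewrite -modstateE; exact: transition_stay.
Qed.

Lemma measurable_stay s : measurable [set x | V s x = false].
Proof.
rewrite (_ : [set _ | _] = ~` [set x | V s x]); first by apply: measurableC; exact: measurable_V.
by apply/seteqP; split => x /=; [move=> ->|move/negP/negbTE].
Qed.

Lemma measurable_follow s p : measurable (follow s p).
Proof.
have -> : follow s p = setT `&` follow s p by rewrite setTI.
apply: (@past_measurable (s + size p)); apply: past_follow.
exact: (@measurableT _ (g_sigma_algebraType _)).
Qed.

Lemma measurable_noreset s k : measurable (noreset s k).
Proof.
elim: k s => [|k IH] s; first exact: measurableT.
by apply: measurableI; [exact: measurable_stay|exact: IH].
Qed.

Lemma noreset_paths s k A : measurable A ->
  P (A `&` noreset s k) = \sum_(p <- paths 'I_N k) P (A `&` follow s p).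
Proof.
elim: k s A => [|k IH] s A mA; first by rewrite big_seq1.
rewrite big_paths; have -> : A `&` noreset s k.+1 = A `&` [set x | V s.+1 x = false] `&` noreset
  s.+1 k.
  by apply/seteqP; split => x /=; [move=> [? []]|move=> [[]]].
have mB : measurable (A `&` [set x | V s.+1 x = false]).
  by apply: measurableI => //; exact: measurable_stay.
rewrite (measure_partition P (measurable_J s.+1)); last first.
  by apply: measurableI => //; exact: measurable_noreset.
apply: eq_bigr => j _.
rewrite (setIAC _ (noreset s.+1 k)) IH; last first.
  by apply: measurableI => //; exact: measurable_J.
apply: eq_bigr => p _; congr (P _); apply/seteqP; split => x /=.
  by move=> [[[? ?] ?] ?].
by move=> [? [[]]].
Qed.

Lemma noreset_survival s k u i : (0 < s)%N ->
  P (modstate s u i `&` noreset s k) = (survival q k i)%:E * P (modstate s u i).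
Proof.
move=> s0; rewrite noreset_paths; last exact: measurable_modstate.
rewrite -survival_paths; last exact: survive_ge0.
rewrite ge0_sume_distrl; last by move=> p _; rewrite lee_fin path_weight_ge0 //; exact: survive_ge0.
by apply: eq_bigr => p _; rewrite (@follow_prob s u i) //; exact: past_modstate.
Qed.

Lemma measure_modstates s A : measurable A ->
  P A = \sum_i (P (A `&` modstate s true i) + P (A `&` modstate s false i)).
Proof.
move=> mA; rewrite (measure_partition P (measurable_J s) mA); apply: eq_bigr => i _.
rewrite (measure_split P (measurable_V s)); last by apply: measurableI => //; exact: measurable_J.
by congr (_ + _); congr (P _); apply/seteqP; split => x /=;
  [move=> [[]]|move=> [? []]| move=> [[]]|move=> [? []]].
Qed.

Lemma noreset_le s k e : (0 < s)%N -> (forall i, survival q k i <= e)%R ->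
  P (noreset s k) <= e%:E.
Proof.
move=> s0 He; rewrite (measure_modstates s (measurable_noreset s k)).
apply: (@le_trans _ _ (\sum_i e%:E * (P (setT `&` modstate s true i) + P (setT `&` modstate s
  false i)))).
  apply: lee_sum => i _; rewrite ge0_muleDr // !setTI; apply: leeD.
    by rewrite setIC noreset_survival // lee_wpmul2r // lee_fin.
  by rewrite setIC noreset_survival // lee_wpmul2r // lee_fin.
rewrite -ge0_sume_distrr; last by move=> i _; rewrite adde_ge0.
by rewrite -measure_modstates // probability_setT mule1.
Qed.

End Modulation.

Lemma measure_ae_le {d} {T : measurableType d} {R : realType} (P : probability T R) (A B : set T) :
  measurable A -> measurable B -> {ae P, forall x, A x -> B x} -> (P A <= P B)%E.
Proof.
move=> mA mB [N [mN N0 HN]].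
have AB : A `<=` B `|` N.
  by move=> x Ax; have [Bx|Bx] := pselect (B x); [left|right; apply: HN => /= /(_ Ax)].
apply: (@le_trans _ _ (P (B `|` N))).
  by apply: le_measure; rewrite ?inE //; exact: measurableU.
apply: le_trans (measureU2 P mB mN) _; by rewrite /= N0 adde0.
Qed.

Lemma measure_ae_eq {d} {T : measurableType d} {R : realType} (P : probability T R) (A B : set T) :
  measurable A -> measurable B -> {ae P, forall x, A x <-> B x} -> P A = P B.
Proof.
move=> mA mB AB; apply/eqP; rewrite eq_le; apply/andP; split; apply: measure_ae_le => //;
  by apply: filterS AB => x [].
Qed.

Section KernelIter.
Context {d : measure_display} {T : measurableType d} {R : realType}.
Variables (P : probability T R) (I : finType) (X : I -> I -> T -> R).
Hypothesis mX : forall i j, measurable_fun [set: T] (X i j).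
Variables (q : I -> I -> R) (f : I -> R -> \bar R).
Hypotheses (q0 : forall i j, (0 <= q i j)) (nf : nnmeas f).
Local Open Scope ereal_scope.

Lemma iter_kernel_op_nnmeas k : nnmeas (iter k (kernel_op P X q) f).
Proof. by elim: k => [//|k IH]; rewrite iterS; exact: kernel_op_nnmeas. Qed.

Lemma green_sum K i y : green P X q K f i y = \sum_(k < K) iter k (kernel_op P X q) f i y.
Proof.
elim: K i y => [|K IH] i y; first by rewrite big_ord0.
rewrite big_ord_recl /=; congr (_ + _); rewrite exchange_big /=.
apply: eq_bigr => j _; rewrite -ge0_sume_distrr; last first.
  by move=> k _; apply: integral_ge0 => x _; exact: (iter_kernel_op_nnmeas k).1.
congr (_ * _); rewrite -ge0_integral_sum //.
- by apply: eq_integral => x _; rewrite IH.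
- by move=> k; apply: measurable_shift (iter_kernel_op_nnmeas k).2.
- by move=> k x _; exact: (iter_kernel_op_nnmeas k).1.
Qed.

(** For [f] the unit step, the function u of the overview. *)
Definition green_lim i y : \bar R := \sum_(k <oo) iter k (kernel_op P X q) f i y.

Lemma green_lim_nnmeas : nnmeas green_lim.
Proof.
have n0 k := (iter_kernel_op_nnmeas k).1.
split; first by move=> i y; exact: nneseries_ge0.
by move=> i; apply: ge0_emeasurable_sum => [k x _ _|k _];
  [exact: n0|exact: (iter_kernel_op_nnmeas k).2].
Qed.

Lemma green_lim_super i y : f i y + kernel_op P X q green_lim i y <= green_lim i y.
Proof.
have n0 k := (iter_kernel_op_nnmeas k).1.
rewrite {2}/green_lim nneseries_recl // leeD2l // /kernel_op.
rewrite (eq_bigr (fun j => \sum_(k <oo) (q i j)%:E * \int[P]_x iter k (kernel_op P X q) f j (y + X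
  i j x)%R)); last first.
  move=> j _; rewrite nneseriesZl; last by move=> k _; apply: integral_ge0 => x _; exact: n0.
  congr (_ * _); rewrite -integral_nneseries //.
  by move=> k; apply: measurable_shift (iter_kernel_op_nnmeas k).2.
rewrite -nneseries_sum; last by move=> j k _; rewrite mule_ge0 ?lee_fin //;
  apply: integral_ge0 => x _; exact: n0.
rewrite -(@nneseries_addn _ (fun k => iter k (kernel_op P X q) f i y) 1) //.
apply: lee_nneseries => k _; rewrite ?addn1 // => _.
by apply: sume_ge0 => j _; rewrite mule_ge0 ?lee_fin //; apply: integral_ge0 => x _; exact: n0.
Qed.

Lemma green_lim_le i y b : (forall K, green P X q K f i y <= b) -> green_lim i y <= b.
Proof.
move=> H; have n0 k := (iter_kernel_op_nnmeas k).1.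
apply: lime_le; first by apply: is_cvg_nneseries => k _ _; exact: n0.
by apply: nearW => K; rewrite big_mkord -green_sum.
Qed.

End KernelIter.

Section RenewalAtResets.
Context {d : measure_display} {T : measurableType d} {R : realType}.
Variables (P : probability T R) (n : nat).
Local Notation N := n.+1.
Variables (Pi Ups : 'M[R]_N) (varpi : 'cV[R]_N) (eps : nat -> T -> 'M[R]_N).
Variables (W : nat -> T -> R) (V : nat -> T -> bool) (J : nat -> T -> 'I_N).
Hypothesis model : reset_chain P Pi Ups varpi eps W V J.
Variable sg : R.
Local Open Scope ereal_scope.

Local Notation q := (survive Pi Ups).
Local Notation modstate := (modstate V J).
Local Notation follow := (follow V J).
Local Notation noreset := (noreset V).
Local Notation mms := (measurable_modstate model).
Let q0 := survive_ge0 model.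

Definition increment t i j x : R := (sg * eps t.+1 x i j)%R.
Local Notation E := increment.
Local Notation stepf := (@stepf R 'I_N).

Local Notation F := (fun t => sigma_of (fun (ij : 'I_N * 'I_N) x => eps t.+1 x ij.1 ij.2)).

Lemma scale_measurable (A : set R) : measurable A -> measurable [set z : R | A (sg * z)%R].
Proof.
move=> mA; have mg : measurable_fun [set: R] (fun z => sg * z)%R by apply: measurable_funM.
by have := mg measurableT A mA; rewrite setTI.
Qed.

Lemma increment_measurable t i j : measurable_fun [set: T] (E t i j).
Proof.
have [mM _ _] := rc_eps_iid model.
by apply: measurable_funM => //; exact: mM.
Qed.

Lemma increment_sigma t i j A : measurable A -> F t (E t i j @^-1` A).
Proof.
move=> mA; exact: (@sigma_of_preimage _ _ _ _
  (fun (ij : 'I_N * 'I_N) x => eps t.+1 x ij.1 ij.2) (i, j) _ (scale_measurable mA)).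
Qed.

Lemma sigma_eps_measurable t A : F t A -> measurable A.
Proof. by have [mM _ _] := rc_eps_iid model; apply: sigma_of_measurable => ij; exact: mM. Qed.

Lemma increment_law t i j A : measurable A -> P (E t i j @^-1` A) = P (E 0 i j @^-1` A).
Proof.
move=> mA; have [_ _ law] := rc_eps_iid model.
have := law t [set B | A (sg * B i j)%R]; apply.
exact: (@sigma_of_preimage _ _ _ _ (fun (ij : 'I_N * 'I_N) (B : 'M[R]_N) => B ij.1 ij.2)
  (i, j) _ (scale_measurable mA)).
Qed.

Lemma path_sum_sigma t i p y : sigma_of (fun (tij : nat * 'I_N * 'I_N) x =>
  eps tij.1.1.+1 x tij.1.2 tij.2) [set x | (0 < y + path_sum E t i p x)%R].
Proof.
set f := fun (tij : nat * 'I_N * 'I_N) x => _.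
pose U := g_sigma_algebraType (\bigcup_i preimage_set_system [set: T] (f i) measurable).
have mE s k l : measurable_fun [set: U] (E s k l : U -> R).
  move=> _ A mA; rewrite setTI.
  exact: (@sigma_of_preimage _ _ _ _ f (s, k, l) _ (scale_measurable mA)).
have mS : measurable_fun [set: U] (fun x : U => y + path_sum (E : nat -> 'I_N -> 'I_N -> U -> R) t
  i p x)%R.
  by apply: measurable_funD => //; exact: path_sum_measurable.
have := mS measurableT `]0%R, +oo[%classic (measurable_itv _); rewrite setTI.
congr (@measurable _ U); apply/seteqP; split => x /=; rewrite in_itv /= andbT //.
Qed.

Lemma measurable_W t : measurable_fun [set: T] (W t).
Proof.
have := (rc_markov model).1 t => /(measurableT_comp measurable_fst)/(measurableT_comp
  measurable_fst).
exact.
Qed.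

Definition tailset t (w : R) : set T := [set x | (w < sg * W t x)%R].

Lemma measurable_tailset t w : measurable (tailset t w).
Proof.
have mg : measurable_fun [set: T] (fun x => sg * W t x)%R.
  by apply: measurable_funM => //; exact: measurable_W.
have := mg measurableT `]w, +oo[%classic (measurable_itv _); rewrite setTI.
congr measurable; apply/seteqP; split => x /=; rewrite in_itv /= andbT //.
Qed.

Definition recursive_at x := forall t, (0 < t)%N ->
  W t.+1 x = if V t.+1 x then 0%R else (W t x + eps t.+1 x (J t x) (J t.+1 x))%R.

Lemma recursive_ae : {ae P, forall x, recursive_at x}.
Proof.
apply: ae_foralln => t; have [t0|t0] := ltnP 0 t; last by apply: filterE => x.
by apply: filterS (rc_W model t0) => x ->.
Qed.

Lemma recursive_follow x s i p : recursive_at x -> (0 < s)%N -> J s x = i -> follow s p x ->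
  (sg * W (s + size p) x = sg * W s x + path_sum E s i p x)%R.
Proof.
move=> Hx; elim: p s i => [|j p IH] s i s0 Ji /=; first by rewrite addn0 addr0.
move=> [[Vs Js] fp]; rewrite addnS -addSn (IH s.+1 j) //.
by rewrite Hx // Vs Ji Js mulrDr addrA.
Qed.

(** A reset at time s gives W_s = 0, so the value later on is the sum of the increments along [p],
    which is independent of (V, J). As the recursion holds from positive times only, W_s = 0
    requires s > 1. *)
Lemma follow_tail s i p w : (1 < s)%N ->
  P (modstate s true i `&` follow s p `&` tailset (s + size p) w) =
  P (modstate s true i `&` follow s p) * path_tail P E i p (- w).
Proof.
case: s => [//|s]; rewrite ltnS => s0.
have mF : measurable (modstate s.+1 true i `&` follow s.+1 p).
  by apply: measurableI; [exact: mms|exact: (measurable_follow model)].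
pose S := [set x | (0 < - w + path_sum E s.+1 i p x)%R].
have mS : measurable S.
  apply: sigma_of_measurable (path_sum_sigma s.+1 i p (- w)) => tij.
  by have [mM _ _] := rc_eps_iid model; exact: mM.
transitivity (P (S `&` (modstate s.+1 true i `&` follow s.+1 p))).
  apply: measure_ae_eq.
  - by apply: measurableI => //; exact: measurable_tailset.
  - exact: measurableI.
  apply: filterS recursive_ae => x Hx.
  have H : modstate s.+1 true i x -> follow s.+1 p x ->
      (sg * W (s.+1 + size p) x = path_sum E s.+1 i p x)%R.
    move=> [Vs Js] fp; rewrite (@recursive_follow x s.+1 i) //.
    by rewrite Hx // Vs mulr0 add0r.
  rewrite /S /tailset; split => /=.
    by move=> [[ms fp]]; rewrite H // => ws; split => //; rewrite addrC subr_gt0.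
  by move=> [ws [ms fp]]; split => //; rewrite H //; move: ws; rewrite addrC subr_gt0.
rewrite (rc_eps_indep model (path_sum_sigma _ _ _ _)); last first.
  apply: (@past_all _ _ _ V J (s.+1 + size p)%N); apply: past_follow; exact: past_modstate.
have [_ indF _] := rc_eps_iid model.
rewrite (path_sum_tail increment_measurable sigma_eps_measurable increment_sigma indF
  increment_law).
by rewrite muleC.
Qed.

Lemma size_paths k p : p \in paths 'I_N k -> size p = k.
Proof.
elim: k p => [|k IH] p; first by rewrite inE => /eqP ->.
by move=> /allpairsP[[j p'] [/= _ pk ->]] /=; rewrite IH.
Qed.

Lemma renewal_term s k i w : (1 < s)%N ->
  P (modstate s true i `&` noreset s k `&` tailset (s + k) w) =
  P (modstate s true i) * iter k (kernel_op P (E 0) q) stepf i (- w)%R.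
Proof.
move=> s1; have s0 : (0 < s)%N by exact: ltnW.
rewrite setIAC (noreset_paths model); last first.
  by apply: measurableI; [exact: mms|exact: measurable_tailset].
rewrite (iter_kernel_op_paths P increment_measurable q0).
rewrite ge0_sume_distrr; last first.
  by move=> p _; rewrite mule_ge0 ?path_tail_ge0 // lee_fin path_weight_ge0 //; exact: q0.
apply: eq_big_seq => p /size_paths sp.
rewrite setIAC -sp follow_tail // (@follow_prob _ _ _ _ _ _ _ _ _ _ _ _ model s true i) //.
  by rewrite muleA [P _ * _]muleC.
exact: past_modstate.
Qed.

Lemma last_reset t K A : measurable A -> (K <= t)%N ->
  P A = \sum_(k < K) P (A `&` [set x | V (t - k)%N x = true] `&` noreset (t - k) k) +
    P (A `&` noreset (t - K) K).
Proof.
move=> mA; elim: K => [|K IH] Kt; first by rewrite big_ord0 add0e setIT.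
rewrite IH ?(ltnW Kt) // big_ord_recr /= -addeA; congr (_ + _).
rewrite (measure_split P (measurable_V model (t - K))); last first.
  by apply: measurableI => //; exact: (measurable_noreset model).
by rewrite subnSK //; congr (_ + _); congr (P _); apply/seteqP; split => x /=;
  [move=> [[]]|move=> [[]]|move=> [[]]|move=> [? []]].
Qed.

Lemma stationary_at t (B : set (R * bool * 'I_N)) : measurable B ->
  P [set x | B (W t x, V t x, J t x)] = P [set x | B (W 0%N x, V 0%N x, J 0%N x)].
Proof.
move=> mB; elim: t => [//|t IH]; rewrite -IH.
apply: (rc_stationary model (C := [set p | B (p t)])).
exact: (@sigma_of_preimage _ _ _ _ (fun t (p : nat -> R * bool * 'I_N) => p t) t _ mB).
Qed.

Lemma stationary_tail t w : P (tailset t w) = P (tailset 0 w).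
Proof.
have mB : measurable [set z : R * bool * 'I_N | (w < sg * z.1.1)%R].
  have mg : measurable_fun [set: R * bool * 'I_N] (fun z => sg * z.1.1)%R.
    apply: measurable_funM => //.
    exact: (measurableT_comp measurable_fst measurable_fst).
  have := mg measurableT `]w, +oo[%classic (measurable_itv _); rewrite setTI.
  congr measurable; apply/seteqP; split => x /=; rewrite in_itv /= andbT //.
exact: (stationary_at t mB).
Qed.

Lemma stationary_modstate t u i : P (modstate t u i) = P (modstate 0 u i).
Proof.
have mB : measurable (setT `*` [set u] `*` [set i] : set (R * bool * 'I_N)).
  by apply: measurableX => //; exact: measurableX.
have := stationary_at t mB; congr (P _ = P _); apply/seteqP; split => x //=;
  [move=> [[]]|move=> []|move=> [[]]|move=> []] => //.
Qed.

(** Stationarity moves the origin to time K + 2, so that the K last possible reset times all exceed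
    1, as [renewal_term] requires. The remainder has no reset during K steps after time 2. *)
Lemma renewal_decomposition K w : P (tailset 0 w) =
  \sum_i P (modstate 0 true i) * green P (E 0) q K stepf i (- w)%R +
  P (tailset (K + 2) w `&` noreset 2 K).
Proof.
rewrite -(stationary_tail (K + 2)) (last_reset (measurable_tailset (K + 2) w) (leq_addr 2 K)).
rewrite addKn; congr (_ + _).
have nf : nnmeas stepf by exact: stepf_nnmeas.
have mE0 : forall i j, measurable_fun [set: T] (E 0 i j) by exact: increment_measurable.
rewrite (eq_bigr (fun i => \sum_(k < K) P (modstate 0 true i) * iter k (kernel_op P (E 0) q) stepf
  i (- w)%R)); last first.
  move=> i _; rewrite (green_sum P mE0 q0 nf) ge0_sume_distrr // => k _.
  exact: (iter_kernel_op_nnmeas P mE0 q0 nf k).1.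
rewrite exchange_big /=; apply: eq_bigr => k _.
have kK : (k <= K)%N by exact: ltnW.
set s := (K + 2 - k)%N; have s1 : (1 < s)%N by rewrite /s -addnBAC // addn2.
rewrite (measure_partition P (measurable_J model s)); last first.
  apply: measurableI; last exact: (measurable_noreset model).
  apply: measurableI; first exact: measurable_tailset.
  exact: (measurable_V model).
apply: eq_bigr => i _; rewrite -(stationary_modstate s) -renewal_term //.
rewrite /s subnK ?(leq_trans kK) ?leq_addr //.
by congr (P _); apply/seteqP; split => x /=; [move=> [[[]]]|move=> [[[]]]].
Qed.

End RenewalAtResets.

Section TailBySurvival.
Context {d : measure_display} {T : measurableType d} {R : realType}.
Variables (P : probability T R) (n : nat).
Local Notation N := n.+1.
Variables (Pi Ups : 'M[R]_N) (varpi : 'cV[R]_N) (eps : nat -> T -> 'M[R]_N).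
Variables (W : nat -> T -> R) (V : nat -> T -> bool) (J : nat -> T -> 'I_N).
Hypothesis model : reset_chain P Pi Ups varpi eps W V J.
Variable sg : R.
Local Open Scope ereal_scope.

Local Notation q := (survive Pi Ups).
Local Notation modstate := (modstate V J).
Local Notation noreset := (noreset V).
Local Notation stepf := (@stepf R 'I_N).
Let q0 := survive_ge0 model.
Variables (kap : 'I_N -> R).
Hypotheses (k0 : forall i, (0 < kap i)%R)
  (Hk : forall i, (1 + \sum_j q i j * kap j <= kap i)%R).

Lemma noreset_small e : (0 < e)%R -> exists K, P (noreset 2 K) <= e%:E.
Proof.
have q1 i : (\sum_j q i j <= 1)%R.
  rewrite -(rc_Pi_sum model i); apply: ler_sum => j _.
  by rewrite ler_piMr ?(rc_Pi_ge0 model) //; case/andP: (rc_Ups01 model i j).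
move=> e0; have [K HK] := survival_cvg0 q0 q1 k0 Hk e0.
by exists K; exact: (noreset_le model).
Qed.

(** The weights P(V_0 = 1, J_0 = i) add up to at most 1, and the remainder is arbitrarily small by
    [noreset_small]. *)
Lemma tail_green_le w b : (forall K i, green P (increment eps sg 0) q K stepf i (- w)%R <= b%:E) ->
  P (tailset W sg 0 w) <= b%:E.
Proof.
move=> Hb; apply/lee_addgt0Pr => e e0; have [K HK] := noreset_small e0.
rewrite (renewal_decomposition model sg K w); apply: leeD.
  apply: (@le_trans _ _ (\sum_i P (modstate 0 true i) * b%:E)).
    by apply: lee_sum => i _; rewrite lee_wpmul2l.
  have b0 : 0 <= b%:E.
    by have := Hb 0%N ord0.
  rewrite -ge0_sume_distrl //.
  rewrite -[leRHS]mul1e lee_wpmul2r //.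
  rewrite -(probability_setT P) (measure_modstates model 0 measurableT).
  by apply: lee_sum => i _; rewrite setTI leeDl.
apply: le_trans HK; apply: le_measure; rewrite ?inE //.
- apply: measurableI; last exact: (measurable_noreset model).
  exact: (measurable_tailset model).
- exact: (measurable_noreset model).
Qed.

Lemma tail_green_ge w i K : P (modstate 0 true i) *
  green P (increment eps sg 0) q K stepf i (- w)%R <= P (tailset W sg 0 w).
Proof.
have nG := green_nnmeas P (increment_measurable model sg 0) K q0 (@stepf_nnmeas R 'I_N).
rewrite (renewal_decomposition model sg K w) (bigD1 i) //= -addeA leeDl // adde_ge0 //.
by apply: sume_ge0 => j _; rewrite mule_ge0 //; exact: nG.1.
Qed.

(** If resets were null events at one time, then by stationarity at all times, and [noreset 2 K]
    would have probability 1 for every K, against [noreset_small]. A reset leads to [j] with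
    probability varpi j. *)
Lemma reset_state_gt0 j : (0 < varpi j 0)%R -> 0 < P (modstate 0 true j).
Proof.
move=> vj; have VT : 0 < P [set x | V 3 x].
  rewrite lt_neqAle eq_sym measure_ge0 andbT; apply/eqP => V0.
  have half0 : (0 < 2^-1 :> R)%R by rewrite invr_gt0.
  have V0t t : P [set x | V t x] = 0.
    have mB : measurable (setT `*` [set true] `*` setT : set (R * bool * 'I_N)).
      by apply: measurableX => //; exact: measurableX.
    rewrite -V0; have E s : P [set x | V s x] = P [set x | (setT `*` [set true] `*` setT : set (R
      * bool * 'I_N)) (W s x, V s x, J s x)].
      by congr (P _); apply/seteqP; split => x //= -[[]].
    by rewrite !E !(stationary_at model _ mB).
  have [K HK] := noreset_small half0.
  suff : P (~` noreset 2 K) = 0.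
    rewrite probability_setC; last exact: (measurable_noreset model).
    move/eqP; rewrite sube_eq ?fin_num_measure ?(measurable_noreset model) // add0e => /eqP E.
    by move: HK; rewrite -E lee_fin leNgt invf_lt1 ?ltr1n.
  clear HK; move: 2%N => s; elim: K s => [|K IH] s.
    by rewrite (_ : ~` _ = set0) ?measure0 //; apply/seteqP; split => x //= /(_ I).
  apply/eqP; rewrite -measure_le0.
  apply: (@le_trans _ _ (P ([set x | V s.+1 x] `|` ~` noreset s.+1 K))).
    have mN s' k : measurable (~` noreset s' k) by apply: measurableC;
      exact: (measurable_noreset model).
    apply: le_measure; rewrite ?inE //.
    - by apply: measurableU => //; exact: (measurable_V model).
    move=> x /= H; case: (boolP (V s.+1 x)) => Vx; [by left|right => nx].
    by apply: H; split => //; exact/negbTE.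
  apply: le_trans (measureU2 _ _ _) _.
  - exact: (measurable_V model).
  - by apply: measurableC; exact: (measurable_noreset model).
  - by rewrite /= V0t IH adde0.
rewrite -(stationary_modstate model 3).
have mM := measurable_modstate model 3 true j.
rewrite (measure_modstates model 2 mM).
rewrite (eq_bigr (fun i => (varpi j 0)%:E * (P ([set x | V 3 x] `&` modstate 2 true i) +
    P ([set x | V 3 x] `&` modstate 2 false i)))); last first.
  move=> i _; rewrite ge0_muleDr // ![_ `&` modstate 2 _ _]setIC.
  by rewrite !(transition_reset model).
rewrite -ge0_sume_distrr; last by move=> i _; rewrite adde_ge0.
by rewrite -(measure_modstates model 2 (measurable_V model 3)) mule_gt0.
Qed.

End TailBySurvival.

(** * Chains of classes and the tail of the stationary law *)

(** Cuts after the last element satisfying [p]. A longest chain may thus be taken to end in a basic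
    class, where the stopped chain of [core_lower] ends. *)
Lemma truncate_path (I : eqType) (e : rel I) (p : pred I) i s :
  path e i s -> (0 < count p (i :: s))%N ->
  exists s', [/\ path e i s', p (last i s') & (count p (belast i s')).+1 = count p (i :: s)].
Proof.
elim: s i => [|j s IH] i.
  by rewrite /= addn0; case pi : (p i) => // _ _; exists [::].
move=> /andP[ij js] pos; have [c0|c0] := posnP (count p (j :: s)).
  exists [::]; rewrite /= -/(count p (j :: s)) c0 addn0 /=.
  by move: pos; rewrite [count _ _]/= -/(count p (j :: s)) c0 addn0; case: (p i).
have [s' [ps' ls' cs']] := IH j js c0; exists (j :: s'); split => //=; first by rewrite ij.
by rewrite -/(count p (j :: s)) -cs' addnS.
Qed.

Section SpectralData.
Context {R : realType} {N : nat}.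
Variable M : 'M[R]_N.
Hypothesis M0 : forall i j, 0 <= M i j.
Let A := map_mx (real_complex R) M - 1%:M.

Lemma shift_edge i j : i != j -> (A i j != 0) = (M i j != 0).
Proof.
move=> ij; rewrite !mxE (negbTE ij) mulr0n subr0.
by rewrite -[0]/(real_complex R 0) (inj_eq (@complexI _)).
Qed.

Lemma class_submx_shift g :
  class_submx A g = map_mx (real_complex R) (class_submx M g) - 1%:M.
Proof. by apply/matrixP => a b; rewrite !mxE (inj_eq enum_val_inj). Qed.

Hypothesis A0 : spectral_abscissa A = 0.
Hypothesis N0 : (0 < N)%N.

Lemma perron_root1 : (forall lam, 1 < lam -> strict_super R 'I_N M lam) /\
  exists2 v : 'rV[R]_N, v != 0 & v *m M = v.
Proof.
have [s [s0 sup [v v0 vM]]] := perron_root _ _ _ N0 M0.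
have := spectral_abscissa_shift _ _ _ _ _ M0 s0 sup v0 vM; rewrite -/A A0 => /esym/eqP.
rewrite subr_eq0 => /eqP s1; rewrite s1 in sup vM; split => //.
by exists v => //; rewrite vM scale1r.
Qed.

Lemma not_strict_super1 : ~ strict_super R 'I_N M 1.
Proof.
move=> sup; have [_ [v v0 vM]] := perron_root1.
have := strict_super_pairing _ _ _ _ (fun i => `|v 0 i|) sup (fun i => normr_ge0 _).
move=> H; have {H} H i : `|v 0 i| = 0.
  apply: H => j; rewrite mul1r -[in leLHS]vM mxE; apply: le_trans (ler_norm_sum _ _ _) _.
  by apply: ler_sum => k _; rewrite normrM (ger0_norm (M0 _ _)).
by case/eqP: v0; apply/rowP => i; rewrite mxE; apply/eqP; rewrite -normr_eq0 H.
Qed.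

(** The bound rho <= 1 comes from strict supersolutions of the whole matrix at 1 + e, restricted to
    each class. *)
Lemma class_perron_data : exists rho l r : 'I_N -> R,
  [/\ forall i, 0 <= rho i <= 1, forall i, 0 < l i /\ 0 < r i,
    forall i, basic_class A (class_of M i) = (rho i == 1),
    forall j, \sum_(i | mutual_access M j i) l i * M i j = rho j * l j &
    forall i, \sum_(j | mutual_access M i j) M i j * r j = rho i * r i].
Proof.
have [sup _] := perron_root1.
have H g : exists z : R * ('I_N -> R) * ('I_N -> R), g \in mx_classes M ->
    [/\ 0 <= z.1.1 <= 1, (forall i, 0 < z.1.2 i) /\ (forall i, 0 < z.2 i),
      forall j, j \in g -> \sum_(i in g) z.1.2 i * M i j = z.1.1 * z.1.2 j,
      forall i, i \in g -> \sum_(j in g) M i j * z.2 j = z.1.1 * z.2 i &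
      basic_class A g = (z.1.1 == 1)].
  case: (boolP (g \in mx_classes M)) => [gM|_]; last by exists (0, fun _ => 0, fun _ => 0).
  have [s [l [r [s0 [l0 r0] lM rM sp]]]] := perron_class _ M0 _ gM.
  exists (s, l, r) => _; split => //=; last first.
    by rewrite /basic_class class_submx_shift sp A0 subr_eq0.
  rewrite s0 /=; apply/ler_addgt0Pr => e e0.
  have [x [x0 Mx]] := sup (1 + e) (ltr_pwDr e0 (lexx 1)).
  apply: (perron_class_super _ _ _ _ x _ gM l0 lM x0) => i _.
  apply: le_trans (ltW (Mx i)); rewrite [leRHS](bigID (mem g)) /= lerDl.
  by apply: sumr_ge0 => j _; rewrite mulr_ge0 // ltW.
have [z Hz] := choice H.
have cM i : class_of M i \in mx_classes M by apply/mx_classesP; exists i.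
exists (fun i => (z (class_of M i)).1.1), (fun i => (z (class_of M i)).1.2 i), (fun i =>
  (z (class_of M i)).2 i).
split.
- by move=> i; have [] := Hz _ (cM i).
- by move=> i; have [_ [l0 r0] _ _ _] := Hz _ (cM i).
- by move=> i; have [] := Hz _ (cM i).
- move=> j; have [_ _ lM _ _] := Hz _ (cM j).
  rewrite -(lM j (mem_class_of _ _)).
  apply: eq_big => [i|i ji]; first by rewrite inE.
  by rewrite (class_of_eq _ _ _ ji).
- move=> i; have [_ _ _ rM _] := Hz _ (cM i).
  rewrite -(rM i (mem_class_of _ _)).
  apply: eq_big => [j|j ij]; first by rewrite inE.
  by rewrite (class_of_eq _ _ _ ij).
Qed.

(** Otherwise all roots are less than 1, and [block_supersolution] with constant weights and margins
    1 - rho glues the class eigenvectors into a strict supersolution at 1. *)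
Lemma exists_basic_class : exists i, basic_class A (class_of M i).
Proof.
have [rho [l [r [rho01 lr0 bE lM rM]]]] := class_perron_data.
apply: contrapT => Nb; apply: not_strict_super1.
have rho1 i : rho i < 1.
  rewrite lt_neqAle -bE; case/andP: (rho01 i) => _ ->; rewrite andbT.
  by apply/negP => bi; apply: Nb; exists i.
have r0 i : 0 < r i by have [] := lr0 i.
have [c /andP[c0 c1] Hc] : exists2 c, 0 < c <= 1 & forall i, true -> c <= 1 - rho i.
  by apply: finite_pos_lower => i _; rewrite subr_gt0.
have [C C1 HC] : exists2 C, 1 <= C & forall i, (\sum_j M i j * r j) / r i <= C by exact:
  finite_upper.
have C0 : 0 <= C by exact: le_trans ler01 C1.
pose T := Num.max 1 (2 * C / c).
have T1 : 1 <= T by rewrite le_max lexx.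
have TC : 2 * C <= c * T by rewrite [leRHS]mulrC -ler_pdivrMr // le_max lexx orbT.
have := @block_supersolution R _ M M xpredT r (fun=> 1) (fun i =>
  1 - rho i) c C T M0 _ r0 _ _ c0 C0 T1 TC.
move=> H; exists (fun i => T ^+ height M i * 1 * r i); split.
  by move=> i; rewrite mulr1 mulr_gt0 // exprn_gt0 // (lt_le_trans ltr01).
move=> i; rewrite mul1r; apply: le_lt_trans (_ : (1 - (1 - rho i) / 2) * (T ^+ height M i * 1 * r
  i) < _).
  apply: H => //.
  - by move=> k; rewrite subr_ge0 ltW.
  - by move=> k _; rewrite opprB addrCA subrr addr0 -rM.
  - by move=> k m _ _ _ _; rewrite !mulr1 Hc.
  - by move=> k _; rewrite -ler_pdivrMr.
rewrite mulr1 gtr_pMl ?ltrBlDr ?ltrDl ?divr_gt0 ?subr_gt0 //.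
by rewrite mulr_gt0 // exprn_gt0 // (lt_le_trans ltr01).
Qed.

Variable d : nat.
Hypothesis longest : longest_chain_length A d.

Lemma chain_shift s : is_chain A s = is_chain M s.
Proof. exact: (mx_edge_chain _ _ _ _ _ _ shift_edge). Qed.

(** The function [b] of [core_data]. The range of k suffices because no chain is longer than d. *)
Definition chain_height i : nat := \max_(k < d.+1 |
  `[< exists s, is_chain A (class_of M i :: s) /\ chain_length A (class_of M i :: s) = k >]) k.

Lemma chain_height_ge i s : is_chain A (class_of M i :: s) ->
  (chain_length A (class_of M i :: s) <= chain_height i)%N.
Proof.
move=> cs; have ld := longest.2 _ cs; rewrite -ltnS in ld.
apply: (@leq_bigmax_cond _ _ (fun k : 'I_d.+1 => k : nat) (Ordinal ld)).
by apply/asboolP; exists s.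
Qed.

Lemma chain1 i : is_chain A [:: class_of M i].
Proof. by rewrite chain_shift /is_chain /= !andbT; apply/mx_classesP; exists i. Qed.

Lemma chain_height_ex i : exists2 s, is_chain A (class_of M i :: s) &
  chain_length A (class_of M i :: s) = chain_height i.
Proof.
have l1 := longest.2 _ (chain1 i); rewrite -ltnS in l1.
pose p (k : 'I_d.+1) := `[< exists s, is_chain A (class_of M i :: s) /\ chain_length A (class_of M
  i :: s) = k >].
have : (0 < #|p|)%N.
  by apply/card_gt0P; exists (Ordinal l1); apply/asboolP; exists [::]; split => //; exact: chain1.
move=> /(eq_bigmax_cond (fun k : 'I_d.+1 => k : nat))[k /asboolP[s [cs ls]] E].
by exists s => //; rewrite ls -E; apply: eq_bigl.
Qed.

Lemma chain_height_le i : (chain_height i <= d)%N.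
Proof. by apply/bigmax_leqP => k _; rewrite -ltnS. Qed.

Lemma chain_cons i j s : access M i j -> ~~ access M j i -> is_chain A (class_of M j :: s) ->
  is_chain A (class_of M i :: class_of M j :: s).
Proof.
move=> ij ji; rewrite !chain_shift /is_chain /= => /andP[/andP[-> ->] ->].
have -> : class_of M i \in mx_classes M by apply/mx_classesP; exists i.
by rewrite class_prec_class_of ij ji.
Qed.

Lemma chain_height_acc i j : access M i j -> (chain_height j <= chain_height i)%N.
Proof.
move=> ij; case: (boolP (access M j i)) => ji.
  by rewrite /chain_height (@class_of_eq _ _ M i j) // /mutual_access ij ji.
have [s cs <-] := chain_height_ex j.
by apply: leq_trans (chain_height_ge (chain_cons ij ji cs)); rewrite /chain_length /= leq_addl.
Qed.

Lemma chain_height_basic i j : access M i j -> ~~ access M j i ->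
  basic_class A (class_of M i) -> (chain_height j < chain_height i)%N.
Proof.
move=> ij ji bi; have [s cs <-] := chain_height_ex j.
by apply: leq_trans (chain_height_ge (chain_cons ij ji cs)); rewrite /chain_length /= bi.
Qed.

Lemma chain_height_gt0 i : basic_class A (class_of M i) -> (0 < chain_height i)%N.
Proof.
by move=> bi; apply: leq_trans (chain_height_ge (chain1 i)); rewrite /chain_length /= bi.
Qed.

Lemma longest_chain_gt0 : (0 < d)%N.
Proof.
have [i bi] := exists_basic_class.
exact: leq_trans (chain_height_gt0 bi) (chain_height_le i).
Qed.

Lemma longest_chain_path : exists i s,
  [/\ path (fun i j => access M i j && ~~ access M j i) i s,
    basic_class A (class_of M (last i s)) &
    (count (fun i => basic_class A (class_of M i)) (belast i s)).+1 = d].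
Proof.
have [t ct lt] := longest.1.
have [i [s ts]] : exists i s, t = map (class_of M) (i :: s).
  move: ct; rewrite chain_shift => /and3P[t0 ta _].
  suff : exists s, t = map (class_of M) s.
    by move=> [[|i s] E]; [rewrite E in t0|exists i, s].
  elim: t ta {t0 lt} => [|g t IH]; first by exists [::].
  by move=> /andP[/mx_classesP[i ->] /IH[s ->]]; exists (i :: s).
have ps : path (fun i j => access M i j && ~~ access M j i) i s.
  move: ct; rewrite chain_shift ts => /and3P[_ _] /=; rewrite path_map.
  by apply: sub_path => k m /=; rewrite class_prec_class_of.
have cd : count (fun i => basic_class A (class_of M i)) (i :: s) = d.
  by rewrite -lt ts /chain_length count_map.
have := @truncate_path _ _ (fun i => basic_class A (class_of M i)) i s ps.
rewrite cd => /(_ longest_chain_gt0)[s' [ps' ls' cs']].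
by exists i, s'.
Qed.

End SpectralData.

Section TailBounds.
Context {d : measure_display} {T : measurableType d} {R : realType}.
Variables (P : probability T R) (n : nat).
Local Notation N := n.+1.
Variables (Pi Ups : 'M[R]_N) (varpi : 'cV[R]_N) (eps : nat -> T -> 'M[R]_N).
Variables (W : nat -> T -> R) (V : nat -> T -> bool) (J : nat -> T -> 'I_N).
Hypothesis model : reset_chain P Pi Ups varpi eps W V J.
Variables (sg al a0 : R) (dd : nat).
Local Notation q := (survive Pi Ups).
Local Notation X := (increment eps sg 0).
Hypotheses (al0 : 0 < al) (ala0 : al < a0) (fa0 : mgf_finite P X a0).

Definition mgf_mx : 'M[R]_N := \matrix_(i, j) (q i j * mgf P X i j al).
Local Notation M := mgf_mx.
Local Notation A := (map_mx (real_complex R) M - 1%:M).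
Hypotheses (A0 : spectral_abscissa A = 0) (lA : longest_chain_length A dd).

Let mX := increment_measurable model sg 0.
Let q0 := survive_ge0 model.

Let fal : mgf_finite P X al.
Proof. by apply: (mgf_finite_le mX) fa0; apply/andP; split; apply: ltW. Qed.

Lemma mgf_mx_ge0 i j : 0 <= M i j.
Proof. by rewrite mxE mulr_ge0 ?mgf_ge0 ?q0. Qed.

Lemma mgf_mx_eq0 i j : (M i j != 0) = (q i j != 0).
Proof. by rewrite mxE mulf_eq0 negb_or (gt_eqF (mgf_gt0 mX i j fal)) andbT. Qed.

Lemma mgf_mx_acc i j : acc q i j = access M i j.
Proof. by apply: eq_connect => k l; rewrite /mx_edge mgf_mx_eq0. Qed.

Lemma mgf_mx_sim i j : sim q i j = mutual_access M i j.
Proof. by rewrite /sim !mgf_mx_acc. Qed.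

Let basic i := basic_class A (class_of M i).
Let b := chain_height M dd.

Lemma reset_core_data : exists rho r l kap, core_data P X q al basic b rho r l kap.
Proof.
have [rho [l [r [rho01 lr0 bE lM rM]]]] := class_perron_data mgf_mx_ge0 A0 (ltn0Sn n).
have [kap [k0 Hk]] := reset_kappa (rc_Pi_ge0 model) (rc_Pi_sum model) (rc_Ups01 model) (rc_final
  model).
exists rho, r, l, kap; split => //.
- by move=> i j; rewrite mgf_mx_sim /basic => /class_of_eq ->.
- by move=> i j; rewrite mgf_mx_acc; exact: (chain_height_acc lA).
- by move=> i j; rewrite !mgf_mx_acc; exact: (chain_height_basic lA).
- by move=> i; exact: (chain_height_gt0 lA).
- by move=> i; have [] := lr0 i.
- by move=> i; have [] := lr0 i.
- by move=> i; have /andP[] := rho01 i.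
- by move=> i; rewrite /basic bE => /eqP.
- by move=> i; rewrite /basic bE lt_neqAle => ->; have /andP[] := rho01 i.
- move=> i; rewrite -rM; apply: eq_big => [j|j _]; first exact: mgf_mx_sim.
  by rewrite mxE.
- move=> j; rewrite /basic bE => /eqP rj; rewrite -[RHS]mul1r -rj -lM.
  apply: eq_big => [i|i _]; first exact: mgf_mx_sim.
  by rewrite mxE.
Qed.

Lemma reset_tail_upper : exists C w0, [/\ 0 < C, 1 <= w0 & forall w, w0 <= w ->
  (P (tailset W sg 0 w) <= (C * w ^+ dd.-1 * expR (- (al * w)))%:E)%E].
Proof.
have [rho [r [l [kap cd]]]] := reset_core_data.
have d0 : (0 < dd)%N by exact: (longest_chain_gt0 mgf_mx_ge0 A0 (ltn0Sn n) lA).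
have [C [w0 [C0 w1 H]]] := core_upper mX cd ala0 fa0 d0 (chain_height_le M dd).
exists C, w0; split => // w ww; apply: (tail_green_le model (cd_kap0 cd) (cd_kap cd)) => K i.
exact: H.
Qed.

Lemma reset_tail_lower : exists c w0, [/\ 0 < c, 1 <= w0 & forall w, w0 <= w ->
  ((c * w ^+ dd.-1 * expR (- (al * w)))%:E <= P (tailset W sg 0 w))%E].
Proof.
have [rho [r [l [kap cd]]]] := reset_core_data.
have [i [s [ps bl cs]]] := longest_chain_path mgf_mx_ge0 A0 (ltn0Sn n) lA.
have [k ki /(rc_initial model)[j]] := initial_class_access (hadamard Pi Ups) i.
rewrite inE => /andP[kj jk] vj.
have ji : acc q j i.
  have -> : acc q j i = access (hadamard Pi Ups) j i.
    by apply: eq_connect => x y; rewrite /mx_edge !mxE.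
  exact: connect_trans jk ki.
have ps' : path (fun i j => acc q i j && ~~ acc q j i) i s.
  by apply: sub_path ps => x y; rewrite !mgf_mx_acc.
have [c [w0 [c0 w1 H]]] := core_lower mX cd ala0 fa0 bl (chain_height_le M dd) ps'
  (sim_refl _ _) cs ji.
have p0 := reset_state_gt0 model (cd_kap0 cd) (cd_kap cd) vj.
set p := P _ in p0.
have pf : p \is a fin_num by apply: fin_num_measure; exact: (measurable_modstate model).
have fp0 : 0 < fine p by rewrite fine_gt0 // p0 ltey_eq pf.
exists (fine p * c), w0; split => //; first exact: mulr_gt0.
move=> w ww; have tf : P (tailset W sg 0 w) \is a fin_num.
  by apply: fin_num_measure; exact: (measurable_tailset model).
have nf := @stepf_nnmeas R 'I_N.
(* [core_lower] asks for a supersolution, which partial sums are not; the limit inherits from them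
   the bound by the tail divided by p. *)
have := H _ (green_lim_nnmeas P mX q0 nf) (green_lim_super P mX q0 nf) w ww.
have : (green_lim P X q (@stepf R 'I_N) j (- w)%R <= (fine (P (tailset W sg 0 w)) / fine p)%:E)%E.
  apply: (green_lim_le mX q0 nf) => K.
  have := tail_green_ge model sg w j K; rewrite -/p.
  rewrite -{1}(fineK pf) -{1}(fineK tf) muleC -lee_pdivlMr //.
move=> h1 h2; have := le_trans h2 h1; rewrite lee_fin ler_pdivlMr // => h3.
rewrite -(fineK tf) lee_fin; apply: le_trans h3.
by rewrite le_eqVlt; apply/orP; left; apply/eqP; ring.
Qed.

End TailBounds.

(** * Real transforms and passage to the limits *)

Lemma limf_pinfty_bounds (R : realType) (f : R -> \bar R) (c C w0 : R) : 0 < c ->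
  (forall w, w0 <= w -> (c%:E <= f w)%E) -> (forall w, w0 <= w -> (f w <= C%:E)%E) ->
  [/\ (0 < limf_einf f (pinfty_nbhs R))%E,
      (limf_einf f (pinfty_nbhs R) <= limf_esup f (pinfty_nbhs R))%E &
      (limf_esup f (pinfty_nbhs R) < +oo)%E].
Proof.
move=> c0 Hc HC.
have F0 : pinfty_nbhs R [set w | w0 <= w].
  by exists w0; split; [exact: num_real|move=> x /ltW].
split.
- rewrite limf_einfE; apply: (@lt_le_trans _ _ c%:E); first by rewrite lte_fin.
  apply: (@le_trans _ _ (ereal_inf (f @` [set w | w0 <= w]))); last first.
    by apply: ereal_sup_ubound; exists [set w | w0 <= w].
  by apply: le_ereal_inf_tmp => _ [w /Hc cw <-].
- rewrite limf_einfE limf_esupE; apply: ge_ereal_sup => _ [V [a [_ Va]] <-].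
  apply: le_ereal_inf_tmp => _ [U [b [_ Ub]] <-].
  pose w := Num.max a b + 1.
  have aw : a < w by rewrite ltr_pwDr // le_max lexx.
  have bw : b < w by rewrite ltr_pwDr // le_max lexx orbT.
  apply: (@le_trans _ _ (f w)).
    by apply: ereal_inf_lbound; exists w => //; exact: Va.
  by apply: ereal_sup_ubound; exists w => //; exact: Ub.
- rewrite limf_esupE; apply: (@le_lt_trans _ _ C%:E); last by rewrite ltry.
  apply: (@le_trans _ _ (ereal_sup (f @` [set w | w0 <= w]))).
    by apply: ereal_inf_lbound; exists [set w | w0 <= w].
  by apply: ge_ereal_sup => _ [w /HC cw <-].
Qed.

Section ComplexTransform.
Context {d : measure_display} {T : measurableType d} {R : realType}.
Variables (P : probability T R) (n : nat) (eps : nat -> T -> 'M[R]_n.+1) (sg al : R).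
Local Notation X := (increment eps sg 0).

Lemma laplace_real i j : laplace P (fun x => eps 1%N x i j) (real_complex R (al * sg)) =
  real_complex R (mgf P X i j al).
Proof.
rewrite /laplace /mgf /=; congr Complex.
  congr fine; rewrite unlock; apply: eq_integral => x _ /=.
  by rewrite mul0r cos0 mulr1 /increment mulrA.
rewrite unlock (eq_integral (fun=> 0%E)) ?integral0 // => x _ /=.
by rewrite mul0r sin0 mulr0.
Qed.

Lemma Amx_real (Pi Ups : 'M[R]_n.+1) : Amx P Pi Ups eps (real_complex R (al * sg)) =
  map_mx (real_complex R) (mgf_mx P Pi Ups eps sg al) - 1%:M.
Proof.
rewrite /Amx; congr (_ - _); apply/matrixP => i j; rewrite !mxE laplace_real.
by rewrite -rmorphM.
Qed.

(** A ball around the point contains a real point farther from 0. The room between al and [a0] gives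
    the Lipschitz bound at al and the faster rate a. *)
Lemma Omega_interior_real : sg ^+ 2 = 1 -> Omega_interior P eps (real_complex R (al * sg)) ->
  exists2 a0, al < a0 & mgf_finite P X a0.
Proof.
move=> /eqP; rewrite sqrf_eq1 => sg2.
have sg1 : `|sg| = 1 by case/orP: sg2 => /eqP ->; rewrite ?normrN normr1.
move=> /nbhs_ballP[e /= e0 He].
move: e0 He; case: e => e e'; rewrite ltcE /= => /andP[/eqP-> e0] He.
exists (al + e / 2); first by rewrite ltrDl divr_gt0.
have := He (real_complex R ((al + e / 2) * sg)).
move=> H i j; have {H} /(_ i j) : Omega P eps (real_complex R ((al + e / 2) * sg)).
  apply: H; rewrite -ball_normE /=.
  rewrite -rmorphB (_ : _ - _ = - (e / 2 * sg)); last by ring.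
  rewrite normc_def /= ltcE /= eqxx /= expr0n /= addr0 sqrtr_sqr normrN normrM sg1 mulr1.
  by rewrite gtr0_norm ?divr_gt0 // ltr_pdivrMr // ltr_pMr // ltr1n.
rewrite /laplace_domain /= unlock; congr (_ < _)%E; apply: eq_integral => x _ /=.
by rewrite /increment mulrA.
Qed.

End ComplexTransform.

Section TailLimits.
Context {d : measure_display} {T : measurableType d} {R : realType}.
Variables (P : probability T R) (n : nat).
Variables (Pi Ups : 'M[R]_n.+1) (varpi : 'cV[R]_n.+1) (eps : nat -> T -> 'M[R]_n.+1).
Variables (W : nat -> T -> R) (V : nat -> T -> bool) (J : nat -> T -> 'I_n.+1).
Hypothesis model : reset_chain P Pi Ups varpi eps W V J.
Variables (sg al : R) (dd : nat).
Hypotheses (sg2 : sg ^+ 2 = 1) (al0 : 0 < al).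
Local Notation z := (real_complex R (al * sg)).

Lemma reset_tail_limits : Omega_interior P eps z ->
  spectral_abscissa (Amx P Pi Ups eps z) = 0 ->
  longest_chain_length (Amx P Pi Ups eps z) dd ->
  let tail := fun w : R => ((w `^ (- dd%:R + 1) * expR (al * w))%:E * P (tailset W sg 0 w))%E in
  [/\ (0 < limf_einf tail (pinfty_nbhs R))%E,
      (limf_einf tail (pinfty_nbhs R) <= limf_esup tail (pinfty_nbhs R))%E &
      (limf_esup tail (pinfty_nbhs R) < +oo)%E].
Proof.
rewrite Amx_real => /(Omega_interior_real sg2)[a0 ala0 fa0] A0 lA /=.
have [C [w1 [C0 w11 HC]]] := reset_tail_upper model al0 ala0 fa0 A0 lA.
have [c [w2 [c0 w21 Hc]]] := reset_tail_lower model al0 ala0 fa0 A0 lA.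
have d0 : (0 < dd)%N by exact: (longest_chain_gt0 (mgf_mx_ge0 model sg al) A0 (ltn0Sn n) lA).
pose w0 := Num.max w1 w2.
have norm w k : w0 <= w -> w `^ (- dd%:R + 1) * expR (al * w) * (k * w ^+ dd.-1 * expR (- (al *
  w))) = k.
  move=> ww; have w0' : 0 < w.
    by rewrite (lt_le_trans ltr01) // (le_trans w11) // (le_trans _ ww) // le_max lexx.
  (* Valid because dd is positive, by the existence of a basic class. *)
  have -> : - dd%:R + 1 = - (dd.-1)%:R :> R.
    by rewrite -[in LHS](prednK d0) -natr1 opprD subrK.
  rewrite powRN powR_mulrn ?ltW // expRN; field.
  by rewrite !gt_eqF ?expR_gt0 ?exprn_gt0.
have k0 w : (0 <= (w `^ (- dd%:R + 1) * expR (al * w))%:E)%E.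
  by rewrite lee_fin mulr_ge0 ?powR_ge0 ?expR_ge0.
apply: (@limf_pinfty_bounds _ _ c C w0) => // w ww.
  have ww2 : w2 <= w by rewrite (le_trans _ ww) // le_max lexx orbT.
  by have := lee_wpmul2l (k0 w) (Hc w ww2); rewrite -EFinM norm.
have ww1 : w1 <= w by rewrite (le_trans _ ww) // le_max lexx.
by have := lee_wpmul2l (k0 w) (HC w ww1); rewrite -EFinM norm.
Qed.

End TailLimits.

Theorem theorem4p2 (disp : measure_display) (T : measurableType disp)
    (R : realType) (P : probability T R) (n : nat)
    (Pi Ups : 'M[R]_n.+1) (varpi : 'cV[R]_n.+1) (eps : nat -> T -> 'M[R]_n.+1)
    (W : nat -> T -> R) (V : nat -> T -> bool) (J : nat -> T -> 'I_n.+1)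
    (model : reset_chain P Pi Ups varpi eps W V J) :
  (forall (alpha : R) (d : nat), 0 < alpha ->
     Omega_interior P eps (real_complex R alpha) ->
     spectral_abscissa (Amx P Pi Ups eps (real_complex R alpha)) = 0 ->
     longest_chain_length (Amx P Pi Ups eps (real_complex R alpha)) d ->
     let tail := fun w : R => ((w `^ (- d%:R + 1) * expR (alpha * w))%:E *
       P [set x | (w < W 0%N x)%R])%E in
     (0 < limf_einf tail (pinfty_nbhs R))%E /\
     (limf_einf tail (pinfty_nbhs R) <= limf_esup tail (pinfty_nbhs R))%E /\
     (limf_esup tail (pinfty_nbhs R) < +oo)%E) /\
  (forall (beta : R) (d : nat), - beta < 0 ->
     Omega_interior P eps (real_complex R (- beta)) ->
     spectral_abscissa (Amx P Pi Ups eps (real_complex R (- beta))) = 0 ->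
     longest_chain_length (Amx P Pi Ups eps (real_complex R (- beta))) d ->
     let tail := fun w : R => ((w `^ (- d%:R + 1) * expR (beta * w))%:E *
       P [set x | (W 0%N x < - w)%R])%E in
     (0 < limf_einf tail (pinfty_nbhs R))%E /\
     (limf_einf tail (pinfty_nbhs R) <= limf_esup tail (pinfty_nbhs R))%E /\
     (limf_esup tail (pinfty_nbhs R) < +oo)%E).
Proof.
split => [alpha d a0 O A L tail | beta d b0 O A L tail].
  have s2 : (1 : R) ^+ 2 = 1 by rewrite expr1n.
  have tE : tailset W 1 0 = fun w => [set x | (w < W 0%N x)%R].
    by apply/funext => w; apply/seteqP; split => x; rewrite /tailset /= mul1r.
  have := reset_tail_limits model (dd := d) s2 a0; rewrite mulr1 tE => H.
  by have [h1 h2 h3] := H O A L; exact: (conj h1 (conj h2 h3)).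
have s2 : (- 1 : R) ^+ 2 = 1 by rewrite sqrrN expr1n.
have tE : tailset W (- 1) 0 = fun w => [set x | (W 0%N x < - w)%R].
  by apply/funext => w; apply/seteqP; split => x; rewrite /tailset /= mulN1r ltrNr.
have b0' : 0 < beta by rewrite -oppr_lt0.
have := reset_tail_limits model (dd := d) s2 b0'; rewrite mulrN1 tE => H.
by have [h1 h2 h3] := H O A L; exact: (conj h1 (conj h2 h3)).
Qed.
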